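(* Let $k$ be an algebraically closed field with $\operatorname{char} k\neq 2$. (i) Let $G=\mathrm{O}_N(k)$ and let $\mathcal O_\lambda$ be the nilpotent $G$-orbit given by the orthogonal partition $\lambda$ of $N$. Then $\mathcal O_\lambda$ is the Richardson orbit for some parabolic subgroup of $G$ if and only if $\lambda$ is of the form $$\lambda=(\lambda^0,\lambda^1,\dots,\lambda^m),$$ where $m\ge 0$; $\lambda^0$ is a (possibly empty) partition with all entries odd; for odd $i>0$, $\lambda^i$ is a nonempty even-pair partition; and for even $i>0$, $\lambda^i$ is a nonempty odd 2-step-descending partition. (ii) Let $G=\mathrm{Sp}_{2n}(k)$ and let $\mathcal O_\lambda$ be the nilpotent $G$-orbit given by the symplectic partition $\lambda$ of $2n$. Then $\mathcal O_\lambda$ is the Richardson orbit for some parabolic subgroup of $G$ if and only if $\lambda$ is of the form $$\lambda=(\lambda^1,\dots,\lambda^m,\mu),$$ where $m\ge 0$; for odd $i>0$, $\lambda^i$ is an odd-pair partition, nonempty except that $\lambda^1$ is allowed to be the empty partition; for even $i>0$, $\lambda^i$ is a nonempty even 2-step-descending partition; and $\mu$ is a (possibly empty) partition with all entries even.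
   Context: Groups: $\mathrm{O}_N(k)$ ($N\ge 3$) is the isometry group of a nondegenerate symmetric bilinear form on $k^N$, and $\mathrm{Sp}_{2n}(k)$ is the isometry group of a nondegenerate skew-symmetric bilinear form on $k^{2n}$. Parabolic subgroups of these groups are the stabilizers in $G$ of flags of totally isotropic subspaces of the natural module. Richardson orbit: for a parabolic subgroup $P$ of $G$, let $\mathfrak u$ be the Lie algebra of the unipotent radical of $P$. There is a unique nilpotent $G$-orbit in $\mathfrak g=\operatorname{Lie}G$ that intersects $\mathfrak u$ in an open dense subvariety; it is called the Richardson orbit of $P$. Partitions: a partition of $M$ is a non-increasing sequence $\lambda=(\lambda_1,\dots,\lambda_l)$ of positive integers with sum $M$. An orthogonal partition is one in which every even part occurs with even multiplicity; a symplectic partition is one in which every odd part occurs with even multiplicity. The nilpotent orbits of $\mathrm{O}_N(k)$ in its Lie algebra are parametrized by the orthogonal partitions of $N$, and those of $\mathrm{Sp}_{2n}(k)$ by the symplectic partitions of $2n$; in both cases $\mathcal O_\lambda$ consists of the nilpotent elements of $\mathfrak g$ whose Jordan block sizes on the natural module are the parts of $\lambda$. Concatenation: for partitions $\lambda^i=(\lambda^i_1,\dots,\lambda^i_{l_i})$, $i=1,\dots,m$, with $\lambda^i_{l_i}\ge\lambda^{i+1}_1$ for each $i$, $(\lambda^1,\dots,\lambda^m)$ denotes the partition $(\lambda^1_1,\dots,\lambda^1_{l_1},\lambda^2_1,\dots,\lambda^m_{l_m})$ (and analogously for sequences of partitions indexed differently; empty partitions are ignored). Let $\lambda=(\lambda_1,\dots,\lambda_l)$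 be a partition with $l$ even. It is: - an even-pair partition if each $\lambda_i$ is even and $\lambda_{2i-1}=\lambda_{2i}$ for each $i$ with $1\le i\le l/2$; - an odd-pair partition if each $\lambda_i$ is odd and $\lambda_{2i-1}=\lambda_{2i}$ for each $i$ with $1\le i\le l/2$; - an even 2-step-descending partition if each $\lambda_i$ is even and $\lambda_{2i}>\lambda_{2i+1}$ for each $i$ with $1\le i<l/2$; - an odd 2-step-descending partition if each $\lambda_i$ is odd and $\lambda_{2i}>\lambda_{2i+1}$ for each $i$ with $1\le i<l/2$. *)

(* Defs.v *)
From HB Require Import structures.
From mathcomp Require Import all_boot all_order all_algebra.
From mathcomp Require Import mpoly.

Set Implicit Arguments.
Unset Strict Implicit.
Unset Printing Implicit Defensive.

Import GRing.Theory.
Local Open Scope ring_scope.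

(* Subsets of 'M[k]_n are predicates 'M[k]_n -> Prop. Matrices act on row     *)
(* vectors from the right, so a bilinear form with Gram matrix B is           *)
(* (u, v) |-> u *m B *m v^T.                                                  *)

Section Zariski.
Variables (k : fieldType) (n : nat).
Implicit Types (S T : 'M[k]_n -> Prop) (X : 'M[k]_n).

Definition mx_eval (p : {mpoly k[n * n]}) X : k :=
  p.@[fun c => mxvec X 0 c].

(* The topology is that of the affine space 'M[k]_n. The isometry group of a  *)
(* nondegenerate form is closed in it, so for subsets of such a group this    *)
(* agrees with being closed in GL_n.                                          *)
Definition zclosed S : Prop :=
  exists I : {mpoly k[n * n]} -> Prop,
    forall X, S X <-> (forall p, I p -> mx_eval p X = 0).

Definition zopen_in S T : Prop :=
  exists2 Z, zclosed Z & forall X, S X <-> T X /\ ~ Z X.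

Definition zdense_in S T : Prop :=
  forall Z, zclosed Z -> (forall X, S X -> Z X) -> forall X, T X -> Z X.

Definition zconnected S : Prop :=
  forall Z1 Z2, zclosed Z1 -> zclosed Z2 ->
    (forall X, S X -> Z1 X \/ Z2 X) ->
    (forall X, S X -> ~ (Z1 X /\ Z2 X)) ->
  (forall X, S X -> Z1 X) \/ (forall X, S X -> Z2 X).

(* The Lie algebra of a closed matrix group H, as the Zariski tangent space   *)
(* of H at 1: all X killed by the differentials at 1 of the polynomials       *)
(* vanishing on H.                                                            *)
Definition lie (H : 'M[k]_n -> Prop) X : Prop :=
  forall p : {mpoly k[n * n]}, (forall h, H h -> mx_eval p h = 0) ->
    \sum_(c < n * n) mx_eval p^`M(c) 1%:M * mxvec X 0 c = 0.

End Zariski.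

Section Groups.
Variables (k : fieldType) (n : nat).
Implicit Types (G P U O : 'M[k]_n -> Prop) (B X g : 'M[k]_n).

Definition mx_nilpotent X : Prop := exists m : nat, X ^+ m = 0.

Definition mx_unipotent g : Prop := mx_nilpotent (g - 1%:M).

Definition is_subgroup U P : Prop :=
  [/\ forall u, U u -> P u /\ u \in unitmx,
      U 1%:M,
      forall u v, U u -> U v -> U (u *m v)
    & forall u, U u -> U (invmx u)].

Definition is_normal_subgroup U P : Prop :=
  is_subgroup U P /\
  forall p u, P p -> U u -> U (p *m u *m invmx p).

Definition conn_normal_unipotent U P : Prop :=
  [/\ is_normal_subgroup U P, zclosed U, zconnected U
    & forall u, U u -> mx_unipotent u].

Definition is_unipotent_radical U P : Prop :=
  conn_normal_unipotent U P /\
  forall V, conn_normal_unipotent V P -> forall u, V u -> U u.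

Definition isometry_group B g : Prop := g *m B *m g^T = B.

(* Subspaces of k^n are row spaces. The path from 0 makes the subspaces       *)
(* nonzero and strictly increasing; the empty flag is allowed, and its        *)
(* stabilizer is the whole group.                                             *)
Definition isotropic_flag B (F : seq 'M[k]_n) : Prop :=
  path (fun V W => (V < W)%MS) 0 F /\
  forall V, V \in F -> V *m B *m V^T = 0.

Definition is_parabolic B P : Prop :=
  exists2 F, isotropic_flag B F &
    forall g, P g <-> isometry_group B g /\ (forall V, V \in F -> stablemx V g).

Definition is_nilpotent_orbit G O : Prop :=
  exists X, [/\ lie G X, mx_nilpotent X &
    forall Y, O Y <-> exists2 g, G g & Y = g *m X *m invmx g].

Definition is_richardson_orbit G P O : Prop :=
  is_nilpotent_orbit G O /\
  exists2 U, is_unipotent_radical U P &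
    let OU X := O X /\ lie U X in
    zopen_in OU (lie U) /\ zdense_in OU (lie U).

(* Block-diagonal, with nilpotent Jordan blocks whose sizes are the entries   *)
(* of s (for sumn s = n): reshape_index s i is the number of the block that   *)
(* contains row i.                                                            *)
Definition nilp_jordan_mx (s : seq nat) : 'M[k]_n :=
  \matrix_(i, j) ((j == i.+1 :> nat) &&
                  (reshape_index s i == reshape_index s j))%:R.

Definition nilpotent_orbit G (s : seq nat) X : Prop :=
  lie G X /\
  exists2 g, g \in unitmx & X = invmx g *m nilp_jordan_mx s *m g.

End Groups.

Local Open Scope nat_scope.

Definition is_part (s : seq nat) : bool := sorted geq s && all (leq 1) s.

Definition part_of (N : nat) (s : seq nat) : bool := is_part s && (sumn s == N).

(* The i-th entry, counting from 1. *)
Definition entry (s : seq nat) (i : nat) : nat := nth 0 s i.-1.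

Definition orthogonal_part (N : nat) (s : seq nat) : Prop :=
  part_of N s /\ forall d, ~~ odd d -> ~~ odd (count_mem d s).

Definition symplectic_part (N : nat) (s : seq nat) : Prop :=
  part_of N s /\ forall d, odd d -> ~~ odd (count_mem d s).

Definition all_even (s : seq nat) : bool := all (fun d => ~~ odd d) s.
Definition all_odd (s : seq nat) : bool := all odd s.

Definition pair_part (s : seq nat) : Prop :=
  [/\ is_part s, ~~ odd (size s) &
      forall i, 1 <= i <= (size s)./2 -> entry s (2 * i - 1) = entry s (2 * i)].

Definition two_step_descending_part (s : seq nat) : Prop :=
  [/\ is_part s, ~~ odd (size s) &
      forall i, 1 <= i < (size s)./2 -> entry s (2 * i) > entry s (2 * i + 1)].

Definition even_pair (s : seq nat) : Prop := pair_part s /\ all_even s.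
Definition odd_pair (s : seq nat) : Prop := pair_part s /\ all_odd s.
Definition even_two_step_descending (s : seq nat) : Prop :=
  two_step_descending_part s /\ all_even s.
Definition odd_two_step_descending (s : seq nat) : Prop :=
  two_step_descending_part s /\ all_odd s.

(* The concatenation of ss is defined, and equal to s. That the result is     *)
(* non-increasing is the required compatibility of the last entry of each     *)
(* nonempty member with the first entry of the next one.                      *)
Definition is_concatenation (s : seq nat) (ss : seq (seq nat)) : Prop :=
  [/\ forall t, t \in ss -> is_part t, is_part (flatten ss) & s = flatten ss].

(* Main.v *)
Require Import Defs.
From HB Require Import structures.
From Stdlib Require Import Classical FunctionalExtensionality PropExtensionality.
From mathcomp Require Import all_boot all_order all_algebra.
From mathcomp Require Import mpoly ring zify.

Set Implicit Arguments.
Unset Strict Implicit.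
Unset Printing Implicit Defensive.

Import GRing.Theory.
Local Open Scope ring_scope.

(* Complete the flag F_1 < ... < F_r defining P by the perps of its members to a chain
   0 = E_0 <= ... <= E_{2r+1} = k^n with dimension jumps d_i. The unipotent radical of P is
   the group of isometries g with E_{i+1} (g - 1) <= E_i: a connected normal unipotent
   subgroup of P acts trivially on each E_{i+1}/E_i, as otherwise a commutator with an
   Eichler transformation, a reflection or a transvection would have the wrong trace on that
   quotient. By the Cayley transform its Lie algebra u consists of the skew X with
   E_{i+1} X <= E_i.

   Similar skew nilpotents are conjugate under G, since an invertible matrix has a square
   root that is a polynomial in it. So the Richardson orbit is determined by the maximal
   ranks on u of the powers X^j. The chain bounds rank X^j by sum_t (mu_t - j), where
   mu_t = #{i : t < d_i} (truncated subtraction). Because X^j B is symmetric or alternating,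
   parity and convexity of j |-> rank X^j lower this bound to the one given by the collapse of
   mu, and for each j a direct sum of one- and two-block models attains it. A generic X attains
   it for all j at once, so the Richardson partitions are exactly the collapses of the
   sequences mu_t = 2 c_t + (t < q) with c non-increasing, q being the middle jump (even in
   the symplectic case). *)

(** * Polynomial functions and tangent spaces *)

(** Why the bound drops: the rows of mu whose parity the form forbids for a single Jordan block are
    paired, and the collapse replaces an unequal pair (a, b) by (a - 1, b + 1), which lowers the
    bound by one exactly for b < j < a. As mu is non-increasing, at most one pair is concerned for
    each j. If X^j B is alternating, rank X^j is even while the uncollapsed bound is odd. If X^j B
    is symmetric, then j - 1 and j + 1 are of the first kind, the uncollapsed bound is linear on j -
    1, j, j + 1, and convexity passes the two drops on to j. No explicit X that works for all j is
    constructed: u is a linear space, so finitely many polynomial conditions, each satisfiable on u,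
    can be met together, and density becomes a statement about polynomials in one variable along the
    lines of u. *)

Section PolynomialFunctions.
Variables (k : closedFieldType).

(** A root t of qX + 1 satisfies t q(t) = -1, so q(t) is nonzero. *)
Lemma poly_nonroot (q : {poly k}) : q != 0 -> exists t, q.[t] != 0.
Proof.
move=> q0; have /closed_rootP[t /rootP] : size (q * 'X + 1) != 1%N.
  by rewrite size_polyDl size_mulX // ?size_poly1 ?eqSS ?size_poly_eq0 // ltnS size_poly_gt0.
rewrite hornerD hornerMX hornerC => e; exists t; apply: contra_eqN e => /eqP->.
by rewrite mul0r add0r oner_neq0.
Qed.

Lemma poly_eval0 (q : {poly k}) : (forall t, q.[t] = 0) -> q = 0.
Proof.
move=> e; apply/eqP/negbNE/negP => /poly_nonroot[t]; by rewrite e eqxx.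
Qed.

(** A matrix over k[t] serves as a polynomial curve of matrices; this is its point at parameter
    t. *)
Definition mx_at m n t (g : 'M[{poly k}]_(m, n)) : 'M[k]_(m, n) :=
  map_mx (horner_eval t) g.

Section Fixed.
Variable n : nat.
Implicit Types (f g : 'M[k]_n -> k).

Definition polyfun f := exists p : {mpoly k[n * n]}, forall X, mx_eval p X = f X.

Definition polymx m l (f : 'M[k]_n -> 'M[k]_(m, l)) :=
  forall i j, polyfun (fun X => f X i j).

Lemma polyfun_ext f g : f =1 g -> polyfun f -> polyfun g.
Proof. by move=> e [p pf]; exists p => X; rewrite pf e. Qed.

Lemma polyfun_cst c : polyfun (fun=> c).
Proof. by exists c%:MP => X; rewrite /mx_eval mevalC. Qed.

Lemma polyfunD f g : polyfun f -> polyfun g -> polyfun (fun X => f X + g X).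
Proof.
move=> [p pf] [q qg]; exists (p + q) => X.
by rewrite -pf -qg /mx_eval mevalD.
Qed.

Lemma polyfunM f g : polyfun f -> polyfun g -> polyfun (fun X => f X * g X).
Proof.
move=> [p pf] [q qg]; exists (p * q) => X.
by rewrite -pf -qg /mx_eval mevalM.
Qed.

Lemma polyfun_sum (I : Type) (r : seq I) (P : pred I) (F : I -> 'M[k]_n -> k) :
  (forall i, P i -> polyfun (F i)) -> polyfun (fun X => \sum_(i <- r | P i) F i X).
Proof.
move=> h; elim: r => [|i r IH].
  apply: polyfun_ext (polyfun_cst 0) => X; by rewrite big_nil.
case Pi: (P i).
  apply: (polyfun_ext _ (polyfunD (h i Pi) IH)) => X; by rewrite big_cons Pi.
by apply: polyfun_ext IH => X; rewrite big_cons Pi.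
Qed.

Lemma polyfun_prod (I : Type) (r : seq I) (P : pred I) (F : I -> 'M[k]_n -> k) :
  (forall i, P i -> polyfun (F i)) -> polyfun (fun X => \prod_(i <- r | P i) F i X).
Proof.
move=> h; elim: r => [|i r IH].
  apply: polyfun_ext (polyfun_cst 1) => X; by rewrite big_nil.
case Pi: (P i).
  apply: (polyfun_ext _ (polyfunM (h i Pi) IH)) => X; by rewrite big_cons Pi.
by apply: polyfun_ext IH => X; rewrite big_cons Pi.
Qed.

Lemma polymx_cst m l (A : 'M_(m, l)) : polymx (fun=> A).
Proof. by move=> i j; apply: polyfun_cst. Qed.

Lemma polymx_id : polymx id.
Proof.
move=> i j; exists 'X_(mxvec_index i j) => X; by rewrite /mx_eval mevalXU mxvecE.
Qed.

Lemma polymxD m l (F G : 'M_n -> 'M_(m, l)) :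
  polymx F -> polymx G -> polymx (fun X => F X + G X).
Proof.
move=> hF hG i j; apply: (polyfun_ext _ (polyfunD (hF i j) (hG i j))) => X.
by rewrite mxE.
Qed.

Lemma polymxM m l p (F : 'M_n -> 'M_(m, l)) (G : 'M_n -> 'M_(l, p)) :
  polymx F -> polymx G -> polymx (fun X => F X *m G X).
Proof.
move=> hF hG i j.
have := @polyfun_sum _ (index_enum 'I_l) predT (fun a X => F X i a * G X a j).
move=> h; apply: (polyfun_ext _ (h _)) => [X | a _]; first by rewrite mxE.
exact: polyfunM.
Qed.

Lemma polymx_tr m l (F : 'M_n -> 'M_(m, l)) :
  polymx F -> polymx (fun X => (F X)^T).
Proof. move=> hF i j; apply: (polyfun_ext _ (hF j i)) => X; by rewrite mxE. Qed.

Lemma polymx_exp d : polymx (fun X => X ^+ d).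
Proof.
elim: d => [|d IH]; first exact: polymx_cst.
by move=> i j; apply: (polyfun_ext _ (polymxM polymx_id IH i j)) => X; rewrite exprS.
Qed.

Lemma polyfun_det m (F : 'M_n -> 'M_m) : polymx F -> polyfun (fun X => \det (F X)).
Proof.
move=> hF; apply: polyfun_sum => s _; apply: polyfunM; first exact: polyfun_cst.
by apply: polyfun_prod.
Qed.

Lemma mmap_horner N (h : 'I_N -> {poly k}) (p : {mpoly k[N]}) t :
  (mmap polyC h p).[t] = p.@[fun c => (h c).[t]].
Proof.
rewrite /meval /mmap horner_sum; apply: eq_bigr => m _.
rewrite hornerM hornerC /mmap1 horner_prod; congr (_ * _).
by apply: eq_bigr => i _; rewrite horner_exp.
Qed.

(* Chain rule: both sides are derivations in p over evaluation at h(0). *)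
Lemma mmap_coef1 N (h : 'I_N -> {poly k}) (p : {mpoly k[N]}) :
  (mmap polyC h p)`_1 = \sum_c p^`M(c).@[fun c => (h c)`_0] * (h c)`_1.
Proof.
set D := fun p => \sum_c p^`M(c).@[fun c => (h c)`_0] * (h c)`_1.
have c0 q : (mmap polyC h q)`_0 = q.@[fun c => (h c)`_0].
  rewrite -horner_coef0 mmap_horner; apply: meval_eq => c; exact: horner_coef0.
have DD q1 q2 : D (q1 + q2) = D q1 + D q2.
  rewrite /D -big_split /=; apply: eq_bigr => c _.
  by rewrite mderivD mevalD mulrDl.
have DZ a q : D (a *: q) = a * D q.
  rewrite /D mulr_sumr; apply: eq_bigr => c _.
  by rewrite mderivZ mevalZ mulrA.
have DM q1 q2 : (mmap polyC h q1)`_1 = D q1 -> (mmap polyC h q2)`_1 = D q2 ->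
    (mmap polyC h (q1 * q2))`_1 = D (q1 * q2).
  move=> e1 e2; rewrite rmorphM /= coefM !big_ord_recl big_ord0 /= addr0.
  rewrite /bump /= !c0 e1 e2 /D.
  have E c : (q1 * q2)^`M(c).@[fun c => (h c)`_0] * (h c)`_1 =
      q1.@[fun c => (h c)`_0] * (q2^`M(c).@[fun c => (h c)`_0] * (h c)`_1) +
      (q1^`M(c).@[fun c => (h c)`_0] * (h c)`_1) * q2.@[fun c => (h c)`_0].
    by rewrite mderivM mevalD !mevalM; ring.
  by rewrite (eq_bigr _ (fun c _ => E c)) big_split mulr_sumr mulr_suml.
elim/mpolyind: p => [|a m p _ _ IH].
  rewrite raddf0 coef0 big1 // => c _; by rewrite raddf0 meval0 mul0r.
rewrite -/(D _) DD DZ raddfD /= coefD IH; congr (_ + _).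
rewrite mmapZ coefCM; congr (_ * _).
rewrite mpolyXE_id; elim/big_rec: _ => [|i q _ IHq].
  rewrite rmorph1 coef1 /D big1 // => c _; by rewrite mderivC meval0 mul0r.
apply: (DM) => //; elim: (m i) => [|d IHd].
  rewrite expr0 rmorph1 coef1 /D big1 // => c _; by rewrite mderivC meval0 mul0r.
rewrite exprS; apply: DM => //; rewrite mmapX mmap1U /D (bigD1 i) //= big1 => [|c ci].
  rewrite mderivX mnm1E eqxx scale1r -[X in 'X_[X - _]]add0m addmK mpolyX0 meval1.
  by rewrite mul1r addr0.
by rewrite mderivX mnm1E eq_sym (negPf ci) scale0r meval0 mul0r.
Qed.

End Fixed.
End PolynomialFunctions.

Section Curves.
Variables (k : closedFieldType) (n : nat).
Implicit Types (S T : 'M[k]_n -> Prop) (f : 'M[k]_n -> k).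

Lemma polyfun_curve f (g : 'M[{poly k}]_n) :
  polyfun f -> exists q : {poly k}, forall t, q.[t] = f (mx_at t g).
Proof.
move=> [p pf]; exists (mmap polyC (fun c => mxvec g 0 c) p) => t.
rewrite mmap_horner -pf /mx_eval; apply: meval_eq => c.
by case/mxvec_indexP: c => i j; rewrite !mxvecE mxE.
Qed.

Lemma zclosed_family (F : ('M[k]_n -> k) -> Prop) S :
  (forall f, F f -> polyfun f) ->
  (forall X, S X <-> forall f, F f -> f X = 0) -> zclosed S.
Proof.
move=> Fp SF; exists (fun p => exists2 f, F f & forall X, mx_eval p X = f X) => X.
rewrite SF; split=> [h p [f Ff pf]|h f Ff]; first by rewrite pf h.
by have [p pf] := Fp f Ff; rewrite -pf; apply: h; exists f.
Qed.

Lemma zclosed_curve S (g : 'M[{poly k}]_n) : zclosed S ->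
  exists F : {poly k} -> Prop,
    forall t, S (mx_at t g) <-> forall q, F q -> q.[t] = 0.
Proof.
move=> [I SI]; exists (fun q => exists2 p, I p & forall t, q.[t] = mx_eval p (mx_at t g)).
move=> t; rewrite SI; split=> [h q [p Ip ->]|h p Ip]; first exact: h.
have [|q qp] := @polyfun_curve (mx_eval p) g; first by exists p.
by rewrite -qp; apply: h; exists p.
Qed.

(** Along a curve, an equation q1 of Z1 and an equation q2 of Z2 satisfy q1 q2 = 0 at every t, hence
    as polynomials. Since k[t] is a domain, the whole curve lies in Z1 or in Z2, and X0, which lies
    in only one of them, decides which. *)
Lemma zconnected_curves S X0 : S X0 ->
  (forall X, S X -> exists2 g : 'M[{poly k}]_n, forall t, S (mx_at t g) &
     mx_at 0 g = X0 /\ mx_at 1 g = X) -> zconnected S.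
Proof.
move=> S0 Sg Z1 Z2 c1 c2 cov dis.
have line X : S X -> (Z1 X0 /\ Z1 X) \/ (Z2 X0 /\ Z2 X).
  move=> /Sg[g gS [<- <-]].
  have [F1 e1] := zclosed_curve g c1; have [F2 e2] := zclosed_curve g c2.
  have [h|/not_all_ex_not[q1 /not_all_ex_not[Fq1 q10]]] :=
    classic (forall q, F1 q -> q = 0).
    by left; split; apply/e1 => q /h->; rewrite horner0.
  right; suff h q2 : F2 q2 -> q2 = 0 by split; apply/e2 => q /h->; rewrite horner0.
  move=> Fq2; have /eqP: q1 * q2 = 0.
    apply: poly_eval0 => t; rewrite hornerM.
    by case: (cov _ (gS t)) => [/e1/(_ q1 Fq1)->|/e2/(_ q2 Fq2)->]; rewrite ?mul0r ?mulr0.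
  by rewrite mulf_eq0 => /orP[/eqP|/eqP].
have [h1|h2] := cov _ S0; [left|right] => X SX.
  by have [[_]|[h2 _]] := line X SX; last by case: (dis _ S0).
by have [[h1 _]|[_]] := line X SX; first by case: (dis _ S0).
Qed.

(** By [mmap_coef1], the coefficient of t in p along the curve is the differential of p at 1 applied
    to X, and p vanishes along the whole curve. *)
Lemma lie_curve S (X : 'M[k]_n) (g : 'M[{poly k}]_n) :
  (forall t, S (mx_at t g)) ->
  (forall i j, (g i j)`_0 = (1%:M : 'M[k]_n) i j) ->
  (forall i j, (g i j)`_1 = X i j) -> lie S X.
Proof.
move=> gS g0 g1 p pS.
have : mmap polyC (fun c => mxvec g 0 c) p = 0.
  apply: poly_eval0 => t; rewrite mmap_horner -(pS _ (gS t)); apply: meval_eq => c.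
  by case/mxvec_indexP: c => i j; rewrite !mxvecE mxE.
move/(congr1 (fun q : {poly k} => q`_1)); rewrite mmap_coef1 coef0 => e.
rewrite -[RHS]e; apply: eq_bigr => c _; congr (_ * _).
  by apply: meval_eq => c'; case/mxvec_indexP: c' => i j; rewrite !mxvecE g0.
by case/mxvec_indexP: c => i j; rewrite !mxvecE g1.
Qed.

Lemma lie_coef1 S (X : 'M[k]_n) f (q : {poly k}) : lie S X -> polyfun f ->
  (forall h, S h -> f h = 0) -> (forall t, q.[t] = f (1%:M + t *: X)) -> q`_1 = 0.
Proof.
move=> lX [p pf] fS qf.
have pS h : S h -> mx_eval p h = 0 by rewrite pf; apply: fS.
rewrite -[RHS](lX p pS).
pose h c : {poly k} := (mxvec (1%:M : 'M[k]_n) 0 c)%:P + (mxvec X 0 c)%:P * 'X.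
have -> : q = mmap polyC h p.
  apply/eqP; rewrite -subr_eq0; apply/eqP/poly_eval0 => t.
  rewrite hornerD hornerN mmap_horner qf -pf; apply/eqP; rewrite subr_eq0; apply/eqP.
  apply: meval_eq => c; rewrite /h hornerD hornerMX !hornerC.
  by case/mxvec_indexP: c => i j; rewrite !mxvecE !mxE mulrC.
rewrite mmap_coef1; apply: eq_bigr => c _.
rewrite /h !coefD !coefC !coefMX /= !coefC /= add0r; congr (_ * _).
by apply: meval_eq => c'; rewrite !coefD !coefC !coefMX /= addr0.
Qed.

Lemma polyfun_line f (X Y : 'M[k]_n) : polyfun f ->
  exists q : {poly k}, forall t, q.[t] = f (X + t *: (Y - X)).
Proof.
move=> pf.
have [q qf] := polyfun_curve (\matrix_(i, j) ((X i j)%:P + ((Y - X) i j)%:P * 'X)) pf.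
exists q => t; rewrite qf; congr f; apply/matrixP => i j.
by rewrite !mxE /horner_eval hornerD hornerMX !hornerC mulrC.
Qed.

Definition zaffine T := forall X Y t, T X -> T Y -> T (X + t *: (Y - X)).

(** On the line from X to Y the product of f and g is the zero polynomial in t, while f is nonzero
    at t = 0; so g vanishes on the line, in particular at Y. *)
Lemma zaffine_dense T f g (X : 'M[k]_n) : zaffine T -> polyfun f -> polyfun g ->
  T X -> f X != 0 -> (forall Y, T Y -> f Y != 0 -> g Y = 0) ->
  forall Y, T Y -> g Y = 0.
Proof.
move=> aT pf pg TX fX fg Y TY.
have [q qf] := polyfun_line X Y pf; have [r rg] := polyfun_line X Y pg.
have /eqP: q * r = 0.
  apply: poly_eval0 => t; rewrite hornerM qf rg.
  have [->|h] := eqVneq (f (X + t *: (Y - X))) 0; first by rewrite mul0r.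
  by rewrite fg ?mulr0 //; apply: aT.
rewrite mulf_eq0 => /orP[|] /eqP e.
  by move: fX; rewrite -[X in f X]addr0 -(scale0r (Y - X)) -qf e horner0 eqxx.
by rewrite -[Y](subrK X) addrC -[Y - X]scale1r -rg e horner0.
Qed.

Lemma zaffine_common T f g (X Y : 'M[k]_n) : zaffine T -> polyfun f -> polyfun g ->
  T X -> T Y -> f X != 0 -> g Y != 0 ->
  exists2 Z, T Z & f Z * g Z != 0.
Proof.
move=> aT pf pg TX TY fX gY; apply: NNPP => h; case/eqP: gY.
apply: (zaffine_dense aT pf pg TX fX) TY => Z TZ fZ.
apply/eqP/negbNE/negP => gZ; apply: h; exists Z => //.
by rewrite mulf_eq0 negb_or fZ.
Qed.

End Curves.

Lemma expmx0 (R : pzRingType) n (A : 'M[R]_n) : A ^+ 0 = 1%:M.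
Proof. by []. Qed.

Lemma expmxS (R : pzRingType) n (A : 'M[R]_n) j : A ^+ j.+1 = A *m A ^+ j.
Proof. exact: exprS. Qed.

Lemma expmxSr (R : pzRingType) n (A : 'M[R]_n) j : A ^+ j.+1 = A ^+ j *m A.
Proof. exact: exprSr. Qed.

(** * Square roots, chains and forms *)

Section SquareRoot.
Variables (k : closedFieldType).
Hypothesis char_k : 2%N \notin [pchar k].

Lemma two_neq0 : (2 : k) != 0.
Proof. by apply: contra char_k => e; rewrite inE /= e. Qed.

Lemma quadratic_root (a b c : k) : (a != 0) || (b != 0) ->
  exists r, c + b * r + a * r ^+ 2 = 0.
Proof.
have [->/= b0|a0 _] := eqVneq a 0.
  by exists (- c / b); rewrite mul0r addr0 mulrC divfK // subrr.
have /closed_rootP[r /rootP] : size (Poly [:: c; b; a]) != 1%N.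
  by rewrite (@PolyK _ 0).
rewrite horner_Poly /= => e; exists r; rewrite -[RHS]e; ring.
Qed.

(** A Hensel-type step, one root z at a time: q + r p stays a square root modulo p and becomes one
    modulo (X - z) p if p(z) r^2 + 2 q(z) r + h(z) = 0. The only danger is p(z) = 0, a repeated
    root; then q(z)^2 = z is nonzero, and so is the linear coefficient 2 q(z). *)
Lemma sqrt_mod_split (rs : seq k) : 0 \notin rs ->
  exists q : {poly k}, \prod_(z <- rs) ('X - z%:P) %| q ^+ 2 - 'X.
Proof.
elim: rs => [|z rs IH]; first by exists 0; rewrite big_nil dvd1p.
rewrite inE negb_or eq_sym => /andP[z0 /IH[q]]; rewrite big_cons.
set p := \prod_(z <- rs) _ => /dvdpP[h eh].
have p0 : p != 0 by rewrite monic_neq0 // monic_prod_XsubC.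
have ev : q.[z] ^+ 2 - z = h.[z] * p.[z].
  by rewrite -hornerM -eh !hornerE.
have [|r er] := @quadratic_root p.[z] (2 * q.[z]) h.[z].
  have [pz|//] := eqVneq p.[z] 0; rewrite mulf_neq0 ?two_neq0 //.
  apply: contraNneq z0 => qz; move: ev; rewrite pz qz mulr0 expr0n /= add0r.
  by move/eqP; rewrite oppr_eq0.
exists (q + r%:P * p).
have -> : (q + r%:P * p) ^+ 2 - 'X = p * (h + 2 * q * r%:P + p * r%:P ^+ 2).
  by rewrite mulrDr mulrDr [p * h]mulrC -eh; ring.
rewrite mulrC dvdp_mul2l // dvdp_XsubCl; apply/rootP.
by rewrite -[RHS]er !hornerE.
Qed.

(** Cayley-Hamilton, applied to a square root of X modulo the characteristic polynomial. The root is
    displayed as a polynomial in S because stability, self-adjointness and commutation with X are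
    later inherited term by term. *)
Lemma mx_sqrt n (S : 'M[k]_n) : S \in unitmx ->
  exists d (c : nat -> k), let T := \sum_(i < d) c i *: S ^+ i in T *m T = S.
Proof.
case: n S => [|n] S Su; first by exists 0%N, (fun=> 0); apply/matrixP => -[].
have [rs ers] := closed_field_poly_normal (char_poly S).
have [|q] := @sqrt_mod_split rs.
  apply/negP => r0; move: Su; rewrite unitmxE unitfE => /eqP; apply.
  have: (char_poly S).[0] = 0.
    by rewrite ers hornerZ (eqP (_ : root _ 0)) ?mulr0 // root_prod_XsubC.
  rewrite horner_coef0 char_poly_det => /eqP; rewrite mulf_eq0 signr_eq0 /=.
  by move/eqP.
case/dvdpP => h eh; exists (size q), (fun i => q`_i) => /=.
have -> : \sum_(i < size q) q`_i *: S ^+ i = horner_mx S q.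
  rewrite -[in RHS](coefK q) poly_def rmorph_sum; apply: eq_bigr => i _.
  rewrite -mul_polyC rmorphM /= horner_mx_C rmorphXn /= horner_mx_X.
  exact/esym/mul_scalar_mx.
have: horner_mx S (q ^+ 2 - 'X) = 0.
  suff e : horner_mx S (\prod_(z <- rs) ('X - z%:P)) = 0 by rewrite eh rmorphM /= e mulr0.
  have := Cayley_Hamilton S; rewrite ers (monicP (char_poly_monic S)) scale1r.
  by [].
rewrite rmorphB /= horner_mx_X rmorphXn => /eqP; rewrite subr_eq0 => /eqP.
by rewrite expr2.
Qed.

End SquareRoot.

Section Chains.
Variables (k : fieldType) (n : nat).
Implicit Types (A C V W : 'M[k]_n) (E : nat -> 'M[k]_n).

Lemma row_base_of d A : \rank A = d -> exists2 R : 'M_(d, n), row_free R & (R :=: A)%MS.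
Proof. by move=> <-; exists (row_base A); [apply: row_base_free | apply: eq_row_base]. Qed.

Lemma sub_col_mx m1 m2 (A : 'M[k]_(m1, n)) (C : 'M_(m2, n)) :
  (A <= col_mx A C)%MS /\ (C <= col_mx A C)%MS.
Proof.
by split; [rewrite (submx_trans (addsmxSl A C))|rewrite (submx_trans (addsmxSr A C))];
  rewrite ?addsmxE.
Qed.

(** The matrix g exchanges bases R1 and R2 of complements of V :&: W in V and in W, and fixes V :&:
    W, which contains C. The columns of L1 and L2 are the coordinates along R1 and R2. As g is an
    involution, no basis of the whole space has to be completed. *)
Lemma move_subspace C V W : (C <= V)%MS -> (C <= W)%MS -> \rank V = \rank W ->
  exists2 g, g \in unitmx & C *m g = C /\ (V *m g :=: W)%MS.
Proof.
move=> CV CW eVW; set I := (V :&: W)%MS.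
have [R1 f1 e1] := row_base_of (erefl (\rank (V :\: W)%MS)).
have eD : \rank (W :\: V)%MS = \rank (V :\: W)%MS.
  have := mxrank_cap_compl V W; have := mxrank_cap_compl W V.
  by rewrite capmxC eVW; lia.
have [R2 f2 e2] := row_base_of eD.
set d := \rank _ in R1 f1 e1 eD R2 f2 e2.
pose M := col_mx (row_base I) (col_mx R1 R2).
have fM : row_free M.
  have VWM : (V + W <= M)%MS.
    have [IM sM] := sub_col_mx (row_base I) (col_mx R1 R2); rewrite -/M eq_row_base in IM sM.
    have [R1s R2s] := sub_col_mx R1 R2.
    rewrite addsmx_sub; apply/andP; split.
      rewrite -(addsmx_diff_cap_eq V W) addsmx_sub IM andbT -e1.
      exact: submx_trans sM.
    rewrite -(addsmx_diff_cap_eq W V) addsmx_sub [(W :&: V)%MS]capmxC IM andbT -e2.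
    exact: submx_trans sM.
  rewrite /row_free eqn_leq rank_leq_row /=; apply: leq_trans (mxrankS VWM).
  have := mxrank_sum_cap V W; have := mxrank_cap_compl V W; rewrite -/I -/d eVW; lia.
pose L1 := pinvmx M *m col_mx 0 (col_mx 1%:M 0) : 'M_(n, d).
pose L2 := pinvmx M *m col_mx 0 (col_mx 0 1%:M) : 'M_(n, d).
have ML1 : M *m L1 = col_mx 0 (col_mx 1%:M 0) by rewrite mulmxA mulmxVp // mul1mx.
have ML2 : M *m L2 = col_mx 0 (col_mx 0 1%:M) by rewrite mulmxA mulmxVp // mul1mx.
move: ML1 ML2; rewrite !mul_col_mx => /eq_col_mx[I1 /eq_col_mx[R11 R21]] /eq_col_mx[I2 /eq_col_mx[R12 R22]].
pose g := 1%:M + (L1 - L2) *m (R2 - R1).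
have gE m (Z : 'M_(m, n)) : Z *m g = Z + (Z *m L1 - Z *m L2) *m (R2 - R1).
  by rewrite [LHS]mulmxDr mulmx1 mulmxA [Z *m (_ - _)]mulmxBr.
have Ig : I *m g = I.
  have /submxP[D ->] : (I <= row_base I)%MS by rewrite eq_row_base submx_refl.
  by rewrite -mulmxA gE I1 I2 subr0 mul0mx addr0.
have R1g : R1 *m g = R2 by rewrite gE R11 R12 subr0 mul1mx addrC subrK.
have R2g : R2 *m g = R1 by rewrite gE R21 R22 sub0r mulNmx mul1mx opprB addrC subrK.
have gg : g *m g = 1%:M.
  rewrite {1}/g mulmxDl mul1mx -mulmxA [(R2 - R1) *m _]mulmxBl R1g R2g /g -[R1 - R2]opprB mulmxN.
  by rewrite addrK.
have gu : g \in unitmx by case/mulmx1_unit: gg.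
exists g => //; split.
  have /submxP[D ->] : (C <= I)%MS by rewrite sub_capmx CV.
  by rewrite -mulmxA Ig.
have sub : (V *m g <= W)%MS.
  rewrite -(eqmxMr g (addsmx_diff_cap_eq V W)) addsmxMr addsmx_sub Ig capmxSr andbT.
  rewrite -(eqmxMr _ e1) R1g e2; exact: diffmxSl.
apply/eqmxP; rewrite sub; rewrite -(geq_leqif (mxrank_leqif_sup sub)).
by rewrite mxrankMfree ?row_free_unit ?eVW /=.
Qed.

Lemma chain_mono s E : (forall i, (i < s)%N -> (E i <= E i.+1)%MS) ->
  forall i m, (i <= m)%N -> (m <= s)%N -> (E i <= E m)%MS.
Proof.
move=> mE i; elim=> [|m IHm]; first by rewrite leqn0 => /eqP->; rewrite submx_refl.
rewrite leq_eqVlt => /orP[/eqP-> //|]; rewrite ltnS => im ms.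
by apply: submx_trans (IHm im (ltnW ms)) _; apply/mE.
Qed.

(** The correction h that moves the top member fixes the member below it pointwise, so the part of
    the chain already matched is not disturbed. *)
Lemma chain_iso s E (E' : nat -> 'M[k]_n) :
  (forall i, (i < s)%N -> (E i <= E i.+1)%MS) ->
  (forall i, (i < s)%N -> (E' i <= E' i.+1)%MS) ->
  (forall i, (i <= s)%N -> \rank (E i) = \rank (E' i)) ->
  exists2 g, g \in unitmx & forall i, (i <= s)%N -> (E i *m g :=: E' i)%MS.
Proof.
elim: s => [|s IH] mE mE' rE.
  have [g gu [_ h]] := move_subspace (sub0mx _ _) (sub0mx _ _) (rE 0%N isT).
  by exists g => // i; rewrite leqn0 => /eqP->.
have [|||g gu hg] := IH.
- by move=> i h; apply/mE/ltnW.
- by move=> i h; apply/mE'/ltnW.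
- by move=> i h; apply/rE/leqW.
have [|||h hu [Eh hW]] := @move_subspace (E s *m g) (E s.+1 *m g) (E' s.+1).
- by rewrite submxMr // mE.
- by rewrite (hg s) // mE'.
- by rewrite mxrankMfree ?row_free_unit ?rE.
exists (g *m h) => [|i]; first by rewrite unitmx_mul gu.
rewrite leq_eqVlt => /orP[/eqP->|]; first by rewrite mulmxA.
rewrite ltnS => is_.
have /submxP[D eD] : (E i <= E s)%MS.
  exact: chain_mono (fun j h => mE j (leqW h)) _ _ is_ (leqnn s).
rewrite {1}eD mulmxA -!mulmxA [E s *m _]mulmxA Eh mulmxA -eD.
exact/hg.
Qed.

Lemma stablemx_inv V g : g \in unitmx -> stablemx V g -> stablemx V (invmx g).
Proof.
move=> gu Vg; have e : (V *m g :=: V)%MS.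
  apply/eqmxP; rewrite Vg -(geq_leqif (mxrank_leqif_sup Vg)).
  by rewrite mxrankMfree ?row_free_unit /=.
by rewrite -(eqmxMr _ e) -mulmxA mulmxV // mulmx1.
Qed.

End Chains.

Section Forms.
Variables (k : closedFieldType) (char_k : 2%N \notin [pchar k]).

(* o = false: symmetric (orthogonal groups); o = true: alternating (symplectic groups). *)
Definition eform n (o : bool) (B : 'M[k]_n) := B^T = (-1) ^+ o *: B /\ B \in unitmx.

Definition form_skew n (B X : 'M[k]_n) := X *m B + B *m X^T = 0.

(* The rank condition makes E (2r+1-i) the whole orthogonal of E i. *)
Definition sdflag n (B : 'M[k]_n) r (E : nat -> 'M[k]_n) :=
  [/\ E 0%N = 0,
      forall i, (i < r.*2.+1)%N -> (E i <= E i.+1)%MS,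
      forall i, (i <= r.*2.+1)%N -> E i *m B *m (E (r.*2.+1 - i)%N)^T = 0
    & forall i, (i <= r.*2.+1)%N -> (\rank (E i) + \rank (E (r.*2.+1 - i)%N) = n)%N].

(* T is a square root of B' B^{-1} that is a polynomial in it. *)
Lemma sqrt_congruence n o (B B' : 'M[k]_n) : eform o B -> eform o B' ->
  exists2 T, T \in unitmx &
    [/\ T *m B *m T^T = B',
        forall V : 'M_n, (V *m B' <= V *m B)%MS -> stablemx V T
      & forall X, form_skew B X -> form_skew B' X -> X *m T = T *m X].
Proof.
move=> [eB Bu] [eB' B'u]; pose S := B' *m invmx B.
have Su : S \in unitmx by rewrite unitmx_mul B'u unitmx_inv.
have SB : S *m B = B' by rewrite mulmxKV.
have sgn2 : (-1) ^+ o * (-1) ^+ o = 1 :> k by rewrite -expr2 sqrr_sign.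
(* S is self-adjoint for B, hence so is its polynomial T, and T B T^T = T T B = S B = B'. *)
have SBT : S *m B = B *m S^T.
  have eB2 : B = (-1) ^+ o *: B^T by rewrite eB scalerA sgn2 scale1r.
  rewrite SB /S trmx_mul trmx_inv {1}eB2 mulmxA -scalemxAl mulmxV ?unitmx_tr //.
  by rewrite -scalemxAl mul1mx eB' scalerA sgn2 scale1r.
have [d [c]] := mx_sqrt char_k Su; set T := \sum_(i < d) _ => /= TT.
have Tu : T \in unitmx by move: Su; rewrite -TT unitmx_mul => /andP[].
have TB : T *m B = B *m T^T.
  rewrite /T mulmx_suml raddf_sum mulmx_sumr; apply: eq_bigr => i _ /=.
  rewrite -scalemxAl linearZ -scalemxAr; congr (_ *: _).
  elim: (i : nat) => [|j IH]; first by rewrite expmx0 /= trmx1 mul1mx mulmx1.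
  by rewrite /= {1}expmxSr expmxS -mulmxA SBT [(S *m _)^T]trmx_mul mulmxA IH -mulmxA.
exists T => //; split.
- by rewrite -mulmxA -TB mulmxA TT.
- move=> V VB.
  have VS : stablemx V S by rewrite /S mulmxA -(mulmxK Bu V) submxMr // mulmxK.
  rewrite mulmx_sumr summx_sub // => i _; rewrite -scalemxAr scalemx_sub //.
  elim: (i : nat) => [|j IH]; first by rewrite expmx0 mulmx1.
  by rewrite expmxS mulmxA (submx_trans (submxMr _ VS)).
move=> X sX sX'.
have XS : X *m S = S *m X.
  move/eqP: sX; rewrite addr_eq0 => /eqP sX; move/eqP: sX'; rewrite addr_eq0 => /eqP sX'.
  apply: (can_inj (mulmxK Bu)); rewrite /= -[LHS]mulmxA SB sX' -[RHS]mulmxA sX mulmxN.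
  by rewrite [S *m _]mulmxA SB.
rewrite /T mulmx_suml mulmx_sumr; apply: eq_bigr => i _ /=.
rewrite -scalemxAl -scalemxAr; congr (_ *: _).
elim: (i : nat) => [|j IH]; first by rewrite expmx0 mul1mx mulmx1.
by rewrite expmxS mulmxA XS -!mulmxA IH.
Qed.

End Forms.

Section Nilpotent.
Variables (k : fieldType) (n : nat).
Implicit Types (X Y Z : 'M[k]_n).

Lemma geometric_mx X m : (1%:M - X) *m (\sum_(i < m) X ^+ i) = 1%:M - X ^+ m.
Proof.
elim: m => [|m IH]; first by rewrite big_ord0 mulmx0 expmx0 subrr.
rewrite big_ord_recr /= mulmxDr IH mulmxBl mul1mx -expmxS; apply: subrKA.
Qed.

Lemma nilpotent_unit X m : X ^+ m = 0 -> 1%:M - X \in unitmx.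
Proof.
move=> X0; have := geometric_mx X m; rewrite X0 subr0 => /mulmx1_unit[]; by [].
Qed.

Lemma expmxZ (a : k) X m : (a *: X) ^+ m = a ^+ m *: X ^+ m.
Proof.
elim: m => [|m IH]; first by rewrite expr0 !expmx0 scale1r.
by rewrite !expmxS IH -scalemxAl -scalemxAr scalerA -exprS.
Qed.

Lemma nilpotent_unit_add (a : k) X m : a != 0 -> X ^+ m = 0 -> a%:M + X \in unitmx.
Proof.
move=> a0 X0; have -> : a%:M + X = a *: (1%:M - (- a^-1) *: X).
  by rewrite scaleNr opprK scalerDr scalerA mulfV // scale1r scalemx1.
rewrite unitmxZ ?unitfE // (@nilpotent_unit _ m) // expmxZ X0 scaler0 //.
Qed.

Lemma conjmx_exp X (g : 'M[k]_n) m : g \in unitmx ->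
  (g *m X *m invmx g) ^+ m = g *m X ^+ m *m invmx g.
Proof.
move=> gu; elim: m => [|m IH]; first by rewrite !expmx0 mulmx1 mulmxV.
by rewrite !expmxS IH !mulmxA mulmxKV.
Qed.

End Nilpotent.

Section Flags.
Variables (k : closedFieldType).

Lemma isotropic_sub n m1 m2 m3 m4 (B : 'M[k]_n) (A : 'M_(m1, n)) (V : 'M_(m2, n))
    (C : 'M_(m3, n)) (W : 'M_(m4, n)) :
  (A <= V)%MS -> (C <= W)%MS -> V *m B *m W^T = 0 -> A *m B *m C^T = 0.
Proof.
move=> /submxP[D ->] /submxP[F ->] e.
by rewrite trmx_mul -!mulmxA [B *m _]mulmxA (mulmxA V) [V *m (B *m _)]mulmxA e mul0mx mulmx0.
Qed.

Lemma eform_sym n o (B : 'M[k]_n) m1 m2 (A : 'M_(m1, n)) (C : 'M_(m2, n)) :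
  eform o B -> A *m B *m C^T = (-1) ^+ o *: (C *m B *m A^T)^T.
Proof.
move=> [eB _]; rewrite !trmx_mul trmxK eB -scalemxAl -scalemxAr scalerA.
by rewrite -expr2 sqrr_sign scale1r mulmxA.
Qed.

Lemma eform_sym0 n o (B : 'M[k]_n) m1 m2 (A : 'M_(m1, n)) (C : 'M_(m2, n)) :
  eform o B -> A *m B *m C^T = 0 -> C *m B *m A^T = 0.
Proof. by move=> eB e; rewrite (eform_sym _ _ eB) e trmx0 scaler0. Qed.

Lemma eform_congr n o (B h : 'M[k]_n) :
  eform o B -> h \in unitmx -> eform o (h *m B *m h^T).
Proof.
move=> [eB Bu] hu; split; last by rewrite !unitmx_mul hu Bu unitmx_tr.
by rewrite !trmx_mul trmxK eB -scalemxAl -scalemxAr mulmxA.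
Qed.

Lemma isometry_unit n o (B g : 'M[k]_n) :
  eform o B -> isometry_group B g -> g \in unitmx.
Proof.
move=> [_ Bu] e; move: Bu; rewrite -{1}e !unitmx_mul; by case/andP => /andP[].
Qed.

Lemma isometry_mul n (B g h : 'M[k]_n) :
  isometry_group B g -> isometry_group B h -> isometry_group B (g *m h).
Proof.
move=> eg eh; rewrite /isometry_group trmx_mul.
by rewrite -(mulmxA g) -(mulmxA g) [h *m B *m _]mulmxA eh mulmxA eg.
Qed.

Lemma isometry_inv n o (B g : 'M[k]_n) : eform o B ->
  isometry_group B g -> isometry_group B (invmx g).
Proof.
move=> eB eg; have gu := isometry_unit eB eg.
have gTu : g^T \in unitmx by rewrite unitmx_tr.
by rewrite /isometry_group -{1}eg -(mulmxA g) mulKmx // trmx_inv mulmxK.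
Qed.

Lemma skew_conj n o (B X g : 'M[k]_n) : eform o B -> isometry_group B g ->
  form_skew B X -> form_skew B (g *m X *m invmx g).
Proof.
move=> eB eg sX; have gu := isometry_unit eB eg.
have gTu : g^T \in unitmx by rewrite unitmx_tr.
have e1 : g *m X *m invmx g *m B = g *m (X *m B) *m g^T.
  by rewrite -{1}(eg : _ = _) !mulmxA mulmxKV.
have e2 : B *m (g *m X *m invmx g)^T = g *m (B *m X^T) *m g^T.
  by rewrite -{1}eg !trmx_mul trmx_inv !mulmxA mulmxK.
by rewrite /form_skew e1 e2 -mulmxDl -mulmxDr sX mulmx0 mul0mx.
Qed.

(** X is skew for B and for h^-1 B h^-T, the latter because Y is skew for B. The square root T that
    carries the first form to the second commutes with X, so h T still conjugates X into Y, and h T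
    is an isometry of B. *)
Lemma skew_similar_conj (char_k : 2%N \notin [pchar k]) n o (B X Y h : 'M[k]_n) : eform o B -> h \in unitmx ->
  form_skew B X -> form_skew B Y -> Y = h *m X *m invmx h ->
  exists2 g, isometry_group B g & Y = g *m X *m invmx g.
Proof.
move=> eB hu sX sY eY; pose h' := invmx h.
have h'u : h' \in unitmx by rewrite unitmx_inv.
have eB' := eform_congr eB h'u.
have [T Tu [eT _ cT]] := sqrt_congruence char_k eB eB'.
exists (h *m T).
  rewrite /isometry_group trmx_mul -(mulmxA h) -(mulmxA h) [T *m B *m _]mulmxA eT.
  by rewrite /h' trmx_inv !mulmxA mulmxV // mul1mx mulmxKV // unitmx_tr.
have XT : X *m T = T *m X.
  apply: cT => //; rewrite /form_skew.
  have -> : X *m (h' *m B *m h'^T) = h' *m (Y *m B) *m h'^T.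
    by rewrite eY !mulmxA mulVmx // mul1mx.
  have -> : h' *m B *m h'^T *m X^T = h' *m (B *m Y^T) *m h'^T.
    rewrite eY !trmx_mul -!mulmxA -/h' -[X in _ = _ *m (_ *m (_ *m (_ *m X)))]trmx_mul.
    by rewrite mulVmx // trmx1 mulmx1.
  by rewrite -mulmxDl -mulmxDr sY mulmx0 mul0mx.
have gu : h *m T \in unitmx by rewrite unitmx_mul hu.
by rewrite -[LHS](mulmxK gu) -(mulmxA h) -XT eY !mulmxA mulmxKV.
Qed.

Section OneFlag.
Variables (n : nat) (o : bool) (B : 'M[k]_n) (r : nat) (E : nat -> 'M[k]_n).
Hypotheses (eB : eform o B) (fE : sdflag B r E).
Notation s := r.*2.+1.

Lemma sdflag_mono i j : (i <= j)%N -> (j <= s)%N -> (E i <= E j)%MS.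
Proof. by case: fE => _ mE _ _ ij js; apply: chain_mono mE _ _ ij js. Qed.

Lemma sdflag_full m (W : 'M_(m, n)) : (W <= E s)%MS.
Proof.
case: fE => E0 _ _ rE; apply: submx_full.
by have := rE s (leqnn _); rewrite subnn E0 mxrank0 addn0 /row_full => ->.
Qed.

(** One inclusion is the isotropy in [sdflag]; its rank condition turns it into an equality. *)
Lemma sdflag_perp m (W : 'M_(m, n)) i : (i <= s)%N ->
  (W <= E (s - i)%N)%MS <-> W *m B *m (E i)^T = 0.
Proof.
move=> is_; case: fE => _ _ iE rE; split=> [h|e].
  by apply: isotropic_sub h (submx_refl _) _; have := iE (s - i)%N (leq_subr _ _); rewrite subKn.
have [_ Bu] := eB; rewrite -(mulmxK Bu W) -[X in (_ <= X)%MS](mulmxK Bu).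
apply: submxMr; have WK : (W *m B <= kermx (E i)^T)%MS by apply/sub_kermxP.
apply: submx_trans WK _.
have EK : (E (s - i)%N *m B <= kermx (E i)^T)%MS.
  by apply/sub_kermxP; have := iE (s - i)%N (leq_subr _ _); rewrite subKn.
rewrite -(geq_leqif (mxrank_leqif_sup EK)) mxrank_ker mxrank_tr mxrankMfree ?row_free_unit //.
by have := rE i is_; lia.
Qed.

Lemma sdflag_iso i j m1 m2 (A : 'M_(m1, n)) (C : 'M_(m2, n)) : (i + j <= s)%N ->
  (A <= E i)%MS -> (C <= E j)%MS -> A *m B *m C^T = 0.
Proof.
move=> ij Ai Cj; have is_ : (i <= s)%N by lia.
apply: isotropic_sub Ai (submx_trans Cj _) _; first by apply: sdflag_mono (leq_subr i s); lia.
by case: fE => _ _ ->.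
Qed.

Definition flagP g := isometry_group B g /\ forall i, (i <= s)%N -> stablemx (E i) g.
Definition flagU g :=
  isometry_group B g /\ forall i, (i < s)%N -> (E i.+1 *m (g - 1%:M) <= E i)%MS.
Definition flagu X := form_skew B X /\ forall i, (i < s)%N -> (E i.+1 *m X <= E i)%MS.

Lemma sdflag_nilp X : (forall i, (i < s)%N -> (E i.+1 *m X <= E i)%MS) -> X ^+ s = 0.
Proof.
move=> EX; have h i : (i <= s)%N -> (E s *m X ^+ i <= E (s - i)%N)%MS.
  elim: i => [|i IH] is_; first by rewrite expmx0 mulmx1 subn0.
  rewrite expmxSr mulmxA (submx_trans (submxMr X (IH (ltnW is_)))) //.
  by rewrite -[(s - i)%N](@subnSK _ s) ?EX //; lia.
have := h s (leqnn _); rewrite subnn; case: fE => -> _ _ _; rewrite submx0 => /eqP e.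
have /submxP[D eD] := sdflag_full (1%:M : 'M_n).
by rewrite -[LHS]mul1mx eD -mulmxA e mulmx0.
Qed.

(** Members beyond the middle are orthogonals of members before it, and an isometry respects
    orthogonals. *)
Lemma flagP_half g : isometry_group B g ->
  (forall i, (i <= r)%N -> stablemx (E i) g) -> flagP g.
Proof.
move=> eg h; split=> // i is_; have [/h //|ri] := leqP i r.
have gu := isometry_unit eB eg.
have gi : stablemx (E (s - i)%N) (invmx g) by apply: stablemx_inv => //; apply: h; lia.
rewrite -{2}(subKn is_) sdflag_perp ?leq_subr //.
have -> : E i *m g *m B = E i *m B *m (invmx g)^T.
  by rewrite -{2}eg trmx_inv !mulmxA mulmxK // unitmx_tr.
rewrite -(mulmxA (E i *m B)) -trmx_mul; apply: (isotropic_sub (submx_refl _) gi).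
by case: fE => _ _ ->.
Qed.

(** The adjoint of g - 1 is g^-1 - 1, so the conditions beyond the middle are dual to those before
    it. The middle step E_{r+1} (g - 1) <= E_r is dual to itself and belongs to the hypothesis. *)
Lemma flagU_half g : flagP g ->
  (forall i, (i <= r)%N -> (E i.+1 *m (g - 1%:M) <= E i)%MS) -> flagU g.
Proof.
move=> [eg Pg] h; split=> // i is_; have [/h //|ri] := leqP i r.
have gu := isometry_unit eB eg.
have s1 : (s - i <= s)%N by apply: leq_subr.
rewrite -{2}(subKn (ltnW is_)) sdflag_perp //.
have -> : E i.+1 *m (g - 1%:M) *m B = E i.+1 *m B *m (invmx g - 1%:M)^T.
  rewrite mulmxBr mulmx1 mulmxBl linearB /= mulmxBr trmx1 mulmx1; congr (_ - _).
  by rewrite -{2}eg trmx_inv !mulmxA mulmxK // unitmx_tr.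
have sj : (s - i = (s - i.+1).+1)%N by lia.
rewrite -(mulmxA (E i.+1 *m B)) -trmx_mul; apply: (@isotropic_sub _ _ _ _ _ _ _ _ _ (E (s - i.+1)%N) (submx_refl _)).
  have -> : invmx g - 1%:M = - ((g - 1%:M) *m invmx g).
    by rewrite mulmxBl mul1mx mulmxV // opprB.
  rewrite mulmxN -eqmx_opp opprK mulmxA sj.
  apply: submx_trans (submxMr _ (h _ _)) _; first by lia.
  by apply: stablemx_inv => //; apply: Pg; lia.
by case: fE => _ _ ->.
Qed.

Lemma flagU_P g : flagU g -> flagP g.
Proof.
move=> [eg h]; split=> // i is_; case: i is_ => [|i] is_.
  by case: fE => -> _ _ _; rewrite mul0mx sub0mx.
rewrite -[g](subrK 1%:M) mulmxDr mulmx1 addmx_sub ?submx_refl //.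
by rewrite (submx_trans (h i _)) // sdflag_mono.
Qed.

Lemma flagU_nilp g : flagU g -> (g - 1%:M) ^+ s = 0.
Proof. by case=> _; apply: sdflag_nilp. Qed.

Lemma flagu_nilp X : flagu X -> X ^+ s = 0.
Proof. by case=> _; apply: sdflag_nilp. Qed.

Lemma flagU_normal : is_normal_subgroup flagU flagP.
Proof.
split; first split.
- by move=> g Ug; split; [apply: flagU_P | case: Ug => /(isometry_unit eB)].
- split=> [|i is_]; first by rewrite /isometry_group trmx1 mulmx1 mul1mx.
  by rewrite subrr mulmx0 sub0mx.
- move=> g h Ug Uh; have [_ Ph] := flagU_P Uh; case: Ug Uh => eg Ug [eh Uh].
  split=> [|i is_]; first exact: isometry_mul.
  have -> : g *m h - 1%:M = (g - 1%:M) *m h + (h - 1%:M).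
    by rewrite mulmxBl mul1mx addrA subrK.
  rewrite mulmxDr addmx_sub ?Uh // mulmxA (submx_trans (submxMr _ (Ug _ is_))) //.
  exact/Ph/ltnW.
- move=> g Ug; have [_ Pg] := flagU_P Ug; case: Ug => eg Ug.
  have gu := isometry_unit eB eg.
  split=> [|i is_]; first exact: isometry_inv eB eg.
  have -> : invmx g - 1%:M = - ((g - 1%:M) *m invmx g).
    by rewrite mulmxBl mul1mx mulmxV // opprB.
  rewrite mulmxN -eqmx_opp opprK mulmxA (submx_trans (submxMr _ (Ug _ is_))) //.
  by apply: stablemx_inv => //; apply/Pg/ltnW.
move=> p g [ep Pp] [eg Ug]; have pu := isometry_unit eB ep.
split=> [|i is_].
  by apply: isometry_mul; [apply: isometry_mul|apply: isometry_inv eB _].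
have -> : p *m g *m invmx p - 1%:M = p *m (g - 1%:M) *m invmx p.
  by rewrite mulmxBr mulmxBl mulmx1 mulmxV.
rewrite !mulmxA (submx_trans (submxMr _ (submxMr _ (Pp _ is_)))) //.
rewrite (submx_trans (submxMr _ (Ug _ is_))) //.
by apply: stablemx_inv => //; apply/Pp/ltnW.
Qed.

End OneFlag.
End Flags.

(** * The unipotent radical and its Lie algebra *)

Section Cayley.
Variables (k : closedFieldType) (char_k : 2%N \notin [pchar k]).
Let two0 := two_neq0 char_k.

(** This replaces Witt's theorem for flags. First h matches the chains linearly. For both h B h^T
    and B' the orthogonal of E' (s - i) is E' i, where s = 2r + 1; so both forms map E' i to the
    same kernel, and the square root relating them stabilizes E' i. *)
Lemma sdflags_isometric n o (B B' : 'M[k]_n) r E E' : eform o B -> eform o B' ->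
  sdflag B r E -> sdflag B' r E' ->
  (forall i, (i <= r.*2.+1)%N -> \rank (E i) = \rank (E' i)) ->
  exists2 g, g \in unitmx & g *m B *m g^T = B' /\
    forall i, (i <= r.*2.+1)%N -> (E' i *m g :=: E i)%MS.
Proof.
move=> eB eB' fE fE' rEE'.
have [h hu hE] : exists2 h, h \in unitmx & forall i, (i <= r.*2.+1)%N -> (E' i *m h :=: E i)%MS.
  apply: chain_iso; [by case: fE' | by case: fE | by move=> i is_; rewrite rEE'].
have eB1 := eform_congr eB hu.
have [T Tu [eT sT _]] := sqrt_congruence char_k eB1 eB'.
exists (T *m h); first by rewrite unitmx_mul Tu.
split; first by rewrite -eT trmx_mul !mulmxA.
move=> i is_; have si : stablemx (E' i) T.
  apply: sT; have K (C : 'M_n) : C \in unitmx -> E' i *m C *m (E' (r.*2.+1 - i)%N)^T = 0 ->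
      (E' i *m C :=: kermx (E' (r.*2.+1 - i)%N)^T)%MS.
    move=> Cu /sub_kermxP CK; apply/eqmxP; rewrite CK.
    rewrite -(geq_leqif (mxrank_leqif_sup CK)) mxrank_ker mxrank_tr mxrankMfree ?row_free_unit //=.
    by case: fE' => _ _ _ /(_ i is_); lia.
  rewrite K; [|by case: eB'|by case: fE' => _ _ ->].
  rewrite K ?submx_refl //; first by case: eB1.
  rewrite !mulmxA -(mulmxA (E' i *m h *m B)) -trmx_mul.
  case: fE => _ _ /(_ i is_) eE _; apply: isotropic_sub eE; rewrite hE ?submx_refl //.
  exact: leq_subr.
have e : (E' i *m T :=: E' i)%MS.
  apply/eqmxP; rewrite si -(geq_leqif (mxrank_leqif_sup si)).
  by rewrite mxrankMfree ?row_free_unit /=.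
by rewrite mulmxA; apply: eqmx_trans (hE i is_); apply: eqmxMr.
Qed.

Section Transform.
Variable n : nat.
Implicit Types (B X Y g : 'M[k]_n).

(** It replaces the exponential, which would need division by factorials. Its derivative at 0 in
    direction Y is 2 Y, which explains the factors 2 and 1/2 below. *)
Definition cayley Y := invmx (1%:M - Y) *m (1%:M + Y).

Lemma cayleyP Y m : Y ^+ m = 0 -> (1%:M - Y) *m cayley Y = 1%:M + Y.
Proof. by move=> Y0; rewrite mulKVmx // (nilpotent_unit Y0). Qed.

Lemma cayley_curve Y m : Y ^+ m = 0 ->
  exists g : 'M[{poly k}]_n, (forall t, mx_at t g = cayley (t *: Y)) /\
    forall i j, (g i j)`_0 = (1%:M : 'M[k]_n) i j /\ (g i j)`_1 = (2 *: Y) i j.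
Proof.
(* Two extra terms, so that the coefficients of 1 and t are in the range of the sum for every m. *)
move=> Y0; have Y2 : Y ^+ m.+2 = 0 by rewrite !expmxS Y0 !mulmx0.
exists (\matrix_(i, j) (\poly_(d < m.+2) (2 * (Y ^+ d) i j) - ((1%:M : 'M[k]_n) i j)%:P)).
split=> [t|i j].
  have tY2 : (t *: Y) ^+ m.+2 = 0 by rewrite expmxZ Y2 scaler0.
  apply: (can_inj (mulKmx (nilpotent_unit tY2))); rewrite (cayleyP tY2).
  have -> : mx_at t (\matrix_(i, j) (\poly_(d < m.+2) (2 * (Y ^+ d) i j) -
      ((1%:M : 'M[k]_n) i j)%:P)) = 2 *: (\sum_(d < m.+2) (t *: Y) ^+ d) - 1%:M.
    apply/matrixP => i j; rewrite !mxE /horner_eval hornerD hornerN hornerC.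
    rewrite horner_poly summxE mulr_sumr; congr (_ - _).
    apply: eq_bigr => d _; rewrite expmxZ mxE; ring.
  rewrite mulmxBr mulmx1 -scalemxAr geometric_mx tY2 subr0 scaler_nat mulr2n.
  by rewrite opprB addrA addrAC addrK addrC.
rewrite !mxE !coefB !coef_poly /= !coefC /= expmx0 expr1 !mxE subr0; split=> //.
by rewrite mulr_natl mulr2n addrK.
Qed.

Lemma isometry_cayley B Y m : Y ^+ m = 0 -> form_skew B Y -> isometry_group B (cayley Y).
Proof.
move=> Y0 /eqP; rewrite addr_eq0 => /eqP sY.
have u := nilpotent_unit Y0; have uT : (1%:M - Y)^T \in unitmx by rewrite unitmx_tr.
have := cayleyP Y0; move: (cayley Y) => c ec.
apply: (can_inj (mulKmx u)); apply: (can_inj (mulmxK uT)).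
rewrite /= !mulmxA ec -!mulmxA -trmx_mul ec.
rewrite !linearB !linearD /= trmx1 !(mulmxDl, mulmxDr, mulmxN, mulNmx, mul1mx, mulmx1).
rewrite !mulmxA sY !mulNmx opprK.
by apply/matrixP => i j; rewrite !mxE; ring.
Qed.

Lemma lie_cayley (S : 'M[k]_n -> Prop) Y m : Y ^+ m = 0 ->
  (forall t, S (cayley (t *: Y))) -> lie S (2 *: Y).
Proof.
move=> Y0 SY; have [g [ge g01]] := cayley_curve Y0.
apply: (@lie_curve _ _ _ _ g) => [t|i j|i j]; first by rewrite ge.
  by case: (g01 i j).
by case: (g01 i j).
Qed.

Lemma form_skewZ B t Y : form_skew B Y -> form_skew B (t *: Y).
Proof.
by rewrite /form_skew linearZ /= -scalemxAl -scalemxAr -scalerDr => ->; rewrite scaler0.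
Qed.

Lemma lie_isometry_nilp B X m : X ^+ m = 0 -> form_skew B X -> lie (isometry_group B) X.
Proof.
move=> X0 sX; have -> : X = 2 *: (2^-1 *: X) by rewrite scalerA mulfV // scale1r.
have Y0 : (2^-1 *: X) ^+ m = 0 by rewrite expmxZ X0 scaler0.
apply: (lie_cayley Y0) => t; apply: (@isometry_cayley _ _ m).
  by rewrite expmxZ Y0 scaler0.
by do 2!apply: form_skewZ.
Qed.

Lemma polymx_isometry B : polymx (fun g : 'M[k]_n => g *m B *m g^T - B).
Proof.
apply: (@polymxD _ _ _ _ _ (fun=> - B)); last exact: polymx_cst.
apply: polymxM; last exact/polymx_tr/polymx_id.
by apply: polymxM; [apply: polymx_id|apply: polymx_cst].
Qed.

(** A matrix version of [lie_coef1] for equations that are at most quadratic along 1 + tX, such as g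
    B g^T = B. *)
Lemma lie_mx m l (S : 'M[k]_n -> Prop) X (F : 'M[k]_n -> 'M[k]_(m, l)) (A C : 'M_(m, l)) :
  lie S X -> polymx F -> (forall h, S h -> F h = 0) ->
  (forall t, F (1%:M + t *: X) = t *: A + t ^+ 2 *: C) -> A = 0.
Proof.
move=> lX pF F0 FX; apply/matrixP => i j.
have e1 : (Poly [:: 0; A i j; C i j])`_1 = A i j by rewrite coef_Poly.
rewrite mxE -e1; apply: (lie_coef1 lX (pF i j)) => [h /F0->|t]; first by rewrite mxE.
by rewrite FX horner_Poly /= !mxE; ring.
Qed.

Lemma lie_isometry_skew B X (S : 'M[k]_n -> Prop) :
  (forall g, S g -> isometry_group B g) -> lie S X -> form_skew B X.
Proof.
move=> SB lX.
apply: (lie_mx (C := X *m B *m X^T) lX (@polymx_isometry B)) => [h /SB ->|t].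
  by rewrite subrr.
rewrite !linearD !linearZ /= trmx1 !(mulmxDl, mulmxDr, mul1mx, mulmx1).
rewrite -!scalemxAl; apply/matrixP => i j; rewrite !mxE; ring.
Qed.

Lemma polymx_lower m l (V : 'M_(m, n)) (W : 'M_(n, l)) :
  polymx (fun g : 'M[k]_n => V *m (g - 1%:M) *m W).
Proof.
apply: polymxM; last exact: polymx_cst.
apply: polymxM; first exact: polymx_cst.
by apply: (@polymxD _ _ _ _ _ (fun=> - 1%:M)); [apply: polymx_id|apply: polymx_cst].
Qed.

Lemma lie_lower m l (S : 'M[k]_n -> Prop) X (V : 'M_(m, n)) (W : 'M_(l, n)) :
  (forall g, S g -> (V *m (g - 1%:M) <= W)%MS) -> lie S X -> (V *m X <= W)%MS.
Proof.
move=> h lX; rewrite submxE; apply/eqP.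
apply: (@lie_mx _ _ S X (fun g => V *m (g - 1%:M) *m cokermx W) _ 0 lX).
- have p : polymx (fun g : 'M[k]_n => V *m (g + (- 1%:M)) *m cokermx W).
    apply: polymxM; last exact: polymx_cst.
    apply: polymxM; first exact: polymx_cst.
    by apply: polymxD; [apply: polymx_id|apply: polymx_cst].
  exact: p.
- by move=> g /h; rewrite submxE => /eqP.
by move=> t; rewrite addrC addKr -scalemxAr -scalemxAl scaler0 addr0.
Qed.

End Transform.

Section Radical.
Variables (n : nat) (o : bool) (B : 'M[k]_n) (r : nat) (E : nat -> 'M[k]_n).
Hypotheses (eB : eform o B) (fE : sdflag B r E).
Notation s := r.*2.+1.
Notation flagU := (flagU B r E).
Notation flagu := (flagu B r E).

Lemma flagu_cayley Y : flagu Y -> flagU (cayley Y).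
Proof.
move=> uY; have Y0 := flagu_nilp fE uY; case: uY => sY EY.
split=> [|i is_]; first exact: isometry_cayley Y0 sY.
have u := nilpotent_unit Y0.
have -> : cayley Y - 1%:M = 2 *: (invmx (1%:M - Y) *m Y).
  apply: (can_inj (mulKmx u)); rewrite mulmxBr mulmx1 (cayleyP Y0) -scalemxAr mulKVmx //.
  by rewrite opprB addrC addrA subrK scaler_nat mulr2n.
rewrite -scalemxAr scalemx_sub // mulmxA; apply: submx_trans (EY i is_).
apply/submxMr/stablemx_inv => //; rewrite mulmxBr mulmx1 addmx_sub ?submx_refl //.
by rewrite -mulmxN -eqmx_opp mulmxN opprK (submx_trans (EY i is_)) // (sdflag_mono fE).
Qed.

Lemma flaguZ t Y : flagu Y -> flagu (t *: Y).
Proof.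
case=> sY EY; split=> [|i is_]; first exact: form_skewZ.
by rewrite -scalemxAr scalemx_sub // EY.
Qed.

(** The inverse transform is (g + 1)^-1 (g - 1): the matrix g + 1 = 2 + (g - 1) is invertible
    because 2 is nonzero and g - 1 is nilpotent. *)
Lemma flagU_cayley g : flagU g -> exists2 Y, flagu Y & cayley Y = g.
Proof.
move=> Ug; have [eg Pg] := flagU_P fE Ug; have := flagU_nilp fE Ug; case: Ug => _ Ug Z0.
have eg1 : g + 1%:M = 2%:M + (g - 1%:M).
  by rewrite (raddfD (@scalar_mx k n)) /= addrC [RHS]addrC addrA subrK addrC.
have u : g + 1%:M \in unitmx by rewrite eg1 (nilpotent_unit_add two0 Z0).
have uT : (g + 1%:M)^T \in unitmx by rewrite unitmx_tr.
pose Y := invmx (g + 1%:M) *m (g - 1%:M).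
have gY : (g + 1%:M) *m Y = g - 1%:M by rewrite mulKVmx.
have uY : flagu Y.
  split=> [|i is_].
    move: (Y) gY => y gy.
    apply: (can_inj (mulKmx u)); apply: (can_inj (mulmxK uT)); rewrite /= mulmx0 mul0mx.
    have -> : (g + 1%:M) *m (y *m B + B *m y^T) *m (g + 1%:M)^T =
        ((g + 1%:M) *m y) *m B *m (g + 1%:M)^T + (g + 1%:M) *m B *m ((g + 1%:M) *m y)^T.
      by rewrite trmx_mul mulmxDr mulmxDl !mulmxA.
    rewrite gy !linearD !linearN /= trmx1.
    rewrite !(mulmxDl, mulmxDr, mulmxN, mulNmx, mul1mx, mulmx1) (eg : _ = _).
    apply/matrixP => i j; rewrite !mxE; ring.
  rewrite mulmxA; apply: submx_trans (Ug i is_); apply/submxMr/stablemx_inv => //.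
  by rewrite mulmxDr mulmx1 addmx_sub ?submx_refl ?Pg.
exists Y => //; have Y0 := flagu_nilp fE uY.
apply: (can_inj (mulKmx (nilpotent_unit Y0))); rewrite (cayleyP Y0).
apply: (can_inj (mulKmx u)); move: (Y) gY => y gy.
have -> : (g + 1%:M) *m ((1%:M - y) *m g) = ((g + 1%:M) - (g + 1%:M) *m y) *m g.
  by rewrite mulmxA mulmxBr mulmx1.
rewrite mulmxDr mulmx1 gy !(mulmxDl, mulNmx) !mul1mx.
by apply/matrixP => i j; rewrite !mxE; ring.
Qed.

Lemma lie_flagU X : lie flagU X <-> flagu X.
Proof.
split=> [lX|uX].
  split=> [|i is_]; first by apply: lie_isometry_skew lX => g [].
  by apply: lie_lower lX => g [_]; apply.
have -> : X = 2 *: (2^-1 *: X) by rewrite scalerA mulfV // scale1r.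
have uY := flaguZ 2^-1 uX; apply: (lie_cayley (flagu_nilp fE uY)) => t.
exact/flagu_cayley/flaguZ.
Qed.

Lemma zclosed_flagU : zclosed flagU.
Proof.
pose Fl i g := E i.+1 *m (g - 1%:M) *m cokermx (E i).
apply: (@zclosed_family _ _ (fun f => (exists i j, f = fun g : 'M[k]_n => (g *m B *m g^T - B) i j) \/
  exists l, (l < s)%N /\ exists i j, f = fun g => Fl l g i j)).
  move=> f [[i [j ->]]|[l [_ [i [j ->]]]]]; first exact: polymx_isometry.
  exact: polymx_lower.
move=> g; split=> [[eg Ug] f [[i [j ->]]|[l [ls [i [j ->]]]]]|h].
- by rewrite (eg : _ = _) subrr mxE.
- by have := Ug l ls; rewrite submxE /Fl => /eqP->; rewrite mxE.
split=> [|l ls].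
  apply/eqP; rewrite -subr_eq0; apply/eqP/matrixP => i j; rewrite [RHS]mxE.
  by apply: (h (fun g : 'M[k]_n => (g *m B *m g^T - B) i j)); left; exists i, j.
rewrite submxE; apply/eqP/matrixP => i j; rewrite [RHS]mxE.
by apply: (h (fun g : 'M[k]_n => Fl l g i j)); right; exists l; split=> //; exists i, j.
Qed.

Lemma zconnected_flagU : zconnected flagU.
Proof.
apply: (@zconnected_curves _ _ _ 1%:M).
  by case: (flagU_normal eB fE) => -[].
move=> g /flagU_cayley[Y uY <-]; have [c [ce _]] := cayley_curve (flagu_nilp fE uY).
exists c => [t|]; first by rewrite ce; apply/flagu_cayley/flaguZ.
by rewrite !ce scale0r scale1r /cayley subr0 addr0 mulmx1 invmx1.
Qed.

Lemma zaffine_flagu : zaffine flagu.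
Proof.
move=> X Y t [sX EX] [sY EY].
have h a Z1 Z2 : form_skew B Z1 -> form_skew B Z2 -> form_skew B (Z1 + a *: Z2).
  move=> s1 s2; rewrite /form_skew [(_ + _)^T]linearD /= linearZ /= mulmxDl mulmxDr.
  by rewrite addrACA s1 add0r -scalemxAl -scalemxAr -scalerDr s2 scaler0.
split=> [|i is_].
  by apply: (h) => //; rewrite -scaleN1r; apply: h.
rewrite mulmxDr addmx_sub ?EX // -scalemxAr scalemx_sub // mulmxBr addmx_sub ?EY //.
by rewrite -eqmx_opp opprK EX.
Qed.

End Radical.
End Cayley.

(** * Trace criteria and the quotients of the flag before the middle *)

Section Traces.
Variable k : closedFieldType.

Lemma mxtrace_nilpotent n (X : 'M[k]_n) m : X ^+ m = 0 -> \tr X = 0.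
Proof.
move=> X0; have [n0|n0] := posnP n.
  by rewrite /mxtrace big1 // => -[i ilt]; exfalso; rewrite n0 in ilt.
have [rs] := closed_field_poly_normal (char_poly X).
rewrite (monicP (char_poly_monic X)) scale1r => ers.
have r0 : {in rs, forall z, z = 0}.
  move=> z zr; have : eigenvalue X z by rewrite eigenvalue_root_char ers root_prod_XsubC.
  case/eigenvalueP => v vX v0.
  have e j : v *m X ^+ j = z ^+ j *: v.
    elim: j => [|j IH]; first by rewrite expmx0 mulmx1 expr0 scale1r.
    by rewrite expmxS mulmxA vX -scalemxAl IH scalerA -exprS.
  have := e m; rewrite X0 mulmx0 => /esym/eqP; rewrite scaler_eq0 (negPf v0) orbF.
  by rewrite expf_eq0 => /andP[_ /eqP].
have e : char_poly X = 'X^(size rs).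
  rewrite ers big_seq (eq_bigr (fun=> 'X)); last by move=> z /r0->; rewrite subr0.
  by rewrite -big_seq big_const_seq count_predT iter_mulr_1.
have sz : size rs = n by apply: succn_inj; rewrite -(size_char_poly X) e size_polyXn.
by apply: oppr_inj; rewrite -char_poly_trace // e coefXn sz oppr0 ltn_eqF // prednK.
Qed.

Lemma mxtrace_unipotent n (g : 'M[k]_n) : mx_unipotent g -> \tr g = n%:R.
Proof.
move=> [m g0]; rewrite -[g](subrK 1%:M) mxtraceD (mxtrace_nilpotent g0) add0r.
exact: mxtrace1.
Qed.

(** Every functional f that kills v also kills vX, so every v is an eigenvector of X; the
    eigenvalues of a nilpotent matrix are 0. *)
Lemma nilpotent_scalar_eq0 n (X : 'M[k]_n) m : X ^+ m = 0 ->
  (forall (v : 'rV_n) (f : 'cV_n), v *m f = 0 -> v *m X *m f = 0) -> X = 0.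
Proof.
move=> X0 h; have vX (v : 'rV_n) : v *m X = 0.
  have /sub_rVP[a e] : (v *m X <= v)%MS.
    rewrite submxE; apply/eqP/matrixP => i j.
    have := h v (cokermx v *m delta_mx j 0).
    rewrite [v *m (_ *m _)]mulmxA mulmx_coker mul0mx mulmxA -colE => /(_ erefl)/matrixP/(_ i 0).
    by rewrite !mxE.
  have ej j : v *m X ^+ j = a ^+ j *: v.
    elim: j => [|j IH]; first by rewrite expmx0 mulmx1 expr0 scale1r.
    by rewrite expmxS mulmxA e -scalemxAl IH scalerA -exprS.
  have := ej m; rewrite X0 mulmx0 => /esym/eqP; rewrite scaler_eq0 e.
  by rewrite expf_eq0 => /orP[/andP[_ /eqP->]|/eqP->]; rewrite ?scale0r ?scaler0.
by apply/row_matrixP => i; rewrite -[X]mul1mx row_mul vX row0.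
Qed.

(** For the transvection g = 1 + fv, the trace of (1 + X) g (1 + X) g^-1 is n - (v X f)^2: the
    traces of X, of its conjugate and of X^2 vanish, and the two mixed terms cancel. *)
Lemma transvection_trace n (X : 'M[k]_n) (v : 'rV_n) (f : 'cV_n) m : X ^+ m = 0 ->
  v *m f = 0 ->
  \tr ((1%:M + X) *m ((1%:M + f *m v) *m (1%:M + X) *m (1%:M - f *m v))) = n%:R ->
  v *m X *m f = 0.
Proof.
move=> X0 vf0 trn.
have trX : \tr X = 0 := mxtrace_nilpotent X0.
have trXX : \tr (X *m X) = 0.
  apply: (@mxtrace_nilpotent _ _ m).
  by rewrite (expr2 X : X *m X = X ^+ 2) -exprM mulnC exprM X0 expr0n.
set T := _ *m _ in trn.
have eT : T = 1%:M + X + (1%:M + f *m v) *m X *m (1%:M - f *m v)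
   + (X *m X - X *m X *m f *m v + X *m f *m v *m X - X *m f *m v *m X *m f *m v).
  have fv2 : f *m v *m (f *m v) = 0 by rewrite -mulmxA (mulmxA v) vf0 mul0mx mulmx0.
  rewrite /T.
  have -> : (1%:M + f *m v) *m (1%:M + X) *m (1%:M - f *m v) =
       1%:M + (1%:M + f *m v) *m X *m (1%:M - f *m v).
    rewrite [(1%:M + f *m v) *m (1%:M + X)]mulmxDr mulmx1 mulmxDl; congr (_ + _).
    by rewrite mulmxBr mulmx1 mulmxDl mul1mx fv2 addr0 addrK.
  rewrite mulmxDl mul1mx [X *m _]mulmxDr mulmx1 addrACA [RHS]addrAC [in RHS]addrA.
  have -> : X *m ((1%:M + f *m v) *m X *m (1%:M - f *m v)) =
      X *m X - X *m X *m f *m v + X *m f *m v *m X - X *m f *m v *m X *m f *m v.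
    rewrite mulmxBr mulmx1 mulmxDl mul1mx mulmxBr mulmxDr mulmxDl !mulmxDr !mulmxA.
    by apply/matrixP => i j; rewrite !mxE; ring.
  by apply/matrixP => i j; rewrite !mxE; ring.
have tr1 : \tr ((1%:M + f *m v) *m X *m (1%:M - f *m v)) = 0.
  rewrite -mulmxA mxtrace_mulC -mulmxA; have -> : (1%:M - f *m v) *m (1%:M + f *m v) = 1%:M.
    rewrite mulmxDr mulmx1 mulmxBl mul1mx -mulmxA (mulmxA v) vf0 mul0mx mulmx0 subr0.
    by rewrite subrK.
  by rewrite mulmx1.
have tr2 : \tr (X *m f *m v *m X) = \tr (X *m X *m f *m v).
  by rewrite mxtrace_mulC !mulmxA.
move: trn; rewrite eT !mxtraceD !raddfN /= mxtrace1 trX tr1 trXX tr2 !addr0 add0r addNr add0r.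
move/eqP; rewrite -subr_eq0 addrAC subrr add0r oppr_eq0.
have -> : X *m f *m v *m X *m f *m v = (X *m f) *m ((v *m X *m f) *m v) by rewrite !mulmxA.
have [a ea] : exists a, v *m X *m f = a%:M by exists ((v *m X *m f) 0 0); apply: mx11_scalar.
rewrite mxtrace_mulC ea mul_scalar_mx -scalemxAl mxtraceZ mulmxA ea mxtrace_scalar mulr1n.
by rewrite mulf_eq0 orbb => /eqP->; apply: raddf0.
Qed.

(** R spans a complement of V in W, and L gives the coordinates along R modulo V; thus R X L is the
    matrix induced by X on W / V when X stabilizes both. *)
Lemma complement_coords n (V W : 'M[k]_n) : (V <= W)%MS ->
  exists p (R : 'M_(p, n)) (L : 'M_(n, p)),
    [/\ R *m L = 1%:M, V *m L = 0, (R <= W)%MS & (W <= V + R)%MS].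
Proof.
move=> VW; pose R := row_base (W :\: V)%MS; pose M := col_mx (row_base V) R.
exists _, R.
have [VM RM] := sub_col_mx (row_base V) R; rewrite -/M !eq_row_base in VM RM.
have WVR : (W <= V + R)%MS.
  rewrite -(addsmx_diff_cap_eq W V) addsmx_sub (submx_trans (capmxSr _ _)) ?addsmxSl // andbT.
  by rewrite (submx_trans _ (addsmxSr _ _)) // eq_row_base submx_refl.
have fM : row_free M.
  rewrite /row_free eqn_leq rank_leq_row /=.
  have WM : (W <= M)%MS.
    by rewrite (submx_trans WVR) // addsmx_sub VM (eq_row_base (W :\: V)%MS).
  apply: leq_trans (mxrankS WM); rewrite -(mxrank_cap_compl W V).
  by rewrite (capmx_idPr VW).
exists (pinvmx M *m col_mx 0 1%:M).
have : M *m (pinvmx M *m col_mx 0 1%:M) = col_mx 0 1%:M :> 'M_(_, \rank (W :\: V)%MS).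
  by rewrite mulmxA mulmxVp // mul1mx.
rewrite {1}/M mul_col_mx => /eq_col_mx[eV eR]; split=> //.
  have /submxP[D eD] : (V <= row_base V)%MS by rewrite eq_row_base submx_refl.
  by rewrite [LHS](congr1 (mulmx^~ _) eD) -mulmxA eV mulmx0.
by rewrite /R eq_row_base diffmxSl.
Qed.

End Traces.

Section GLBlocks.
Variables (k : closedFieldType) (char_k : 2%N \notin [pchar k]).
Let two0 := two_neq0 char_k.
Variables (n : nat) (o : bool) (B : 'M[k]_n) (r : nat) (E : nat -> 'M[k]_n).
Hypotheses (eB : eform o B) (fE : sdflag B r E).
Notation s := r.*2.+1.
Notation flagU := (flagU B r E).
Notation flagP := (flagP B r E).

(* An Eichler transformation x |-> x + B(x,c) a - eps B(x,a) c - B(c,c)/2 B(x,a) a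
   with a in E_{i+1}; it induces the transvection 1 + f v on E_{i+1}/E_i. *)
Lemma eichler i p (R : 'M_(p, n)) (L : 'M_(n, p)) (v : 'rV_p) (f : 'cV_p) : (i < r)%N ->
  R *m L = 1%:M -> E i *m L = 0 -> (R <= E i.+1)%MS -> v *m f = 0 ->
  exists2 g, flagP g & R *m g *m L = 1%:M + f *m v.
Proof.
move=> ir RL EL RE vf0; have [eBt Bu] := eB; pose e : k := (-1) ^+ o.
have ee : e * e = 1 by rewrite -expr2 sqrr_sign.
(* The vector a lifts v to E_{i+1}, and c represents the functional x |-> x L f, that is, B(x, c) =
   x L f. *)
pose a := v *m R; pose c := (invmx B *m L *m f)^T.
pose ka := L *m f; pose al := B *m a^T.
have aE : (a <= E i.+1)%MS by rewrite mulmx_sub.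
have Bc : B *m c^T = ka by rewrite trmxK !mulmxA mulmxV // mul1mx.
have aal : a *m al = 0 by rewrite mulmxA; apply: (sdflag_iso fE _ aE aE); lia.
have aka : a *m ka = 0 by rewrite /a /ka mulmxA -(mulmxA v) RL mulmx1.
have aB : a *m B = e *: al^T by rewrite trmx_mul trmxK eBt -scalemxAr scalerA ee scale1r.
have cB : c *m B = e *: ka^T by rewrite -Bc trmx_mul trmxK eBt -scalemxAr scalerA ee scale1r.
have cal : c *m al = 0 by rewrite mulmxA; apply: (eform_sym0 eB); rewrite -mulmxA Bc.
have [b eb] : exists b : k, c *m ka = b%:M by exists ((c *m ka) 0 0); apply: mx11_scalar.
have ebb : e * b = b.
  have := eform_sym c c eB; rewrite -mulmxA Bc eb tr_scalar_mx scale_scalar_mx => /matrixP/(_ 0 0).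
  by rewrite !mxE !mulr1n.
have EjA j : (j <= r)%N -> E j *m al = 0.
  by move=> jr; rewrite mulmxA; apply: (sdflag_iso fE _ (submx_refl _) aE); lia.
have EjK j : (j <= i)%N -> E j *m ka = 0.
  move=> ji; have /submxP[D ->] : (E j <= E i)%MS by apply: (sdflag_mono fE); lia.
  by rewrite -mulmxA (mulmxA (E i)) EL mul0mx mulmx0.
have Ral : R *m al = 0 by rewrite mulmxA; apply: (sdflag_iso fE _ RE aE); lia.
have Rka : R *m ka = f by rewrite mulmxA RL mul1mx.
have aL : a *m L = v by rewrite -mulmxA RL mulmx1.
have Ba : B *m a^T = al by [].
clearbody al ka c a e.
(* With e b = b, this makes the coefficient d e + e b + d of [al *m al^T] in g B g^T - B vanish. *)
pose d := - (b / 2).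
pose g := 1%:M + ka *m a - e *: (al *m c) + d *: (al *m a).
have kat : al^T *m a^T = 0 by rewrite -trmx_mul aal trmx0.
have kak : ka^T *m a^T = 0 by rewrite -trmx_mul aka trmx0.
have act : al^T *m c^T = 0 by rewrite -trmx_mul cal trmx0.
have ckt : ka^T *m c^T = b%:M by rewrite -trmx_mul eb tr_scalar_mx.
have gE m (Z : 'M_(m, n)) : Z *m g =
    Z + Z *m ka *m a - e *: (Z *m al *m c) + d *: (Z *m al *m a).
  by rewrite !mulmxDr mulmxN mulmx1 -!scalemxAr !mulmxA.
have gB : g *m B = B + e *: (ka *m al^T) - al *m ka^T + (d * e) *: (al *m al^T).
  rewrite /g !mulmxDl mulNmx mul1mx -!scalemxAl -!mulmxA aB cB -!scalemxAr !scalerA ee.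
  by rewrite scale1r.
have gBa : g *m B *m a^T = al.
  rewrite gB !mulmxDl mulNmx -!scalemxAl -!mulmxA kat kak !mulmx0 !scaler0 subr0 !addr0.
  by [].
have gBc : g *m B *m c^T = ka - b *: al.
  rewrite gB !mulmxDl mulNmx -!scalemxAl -!mulmxA act ckt Bc !mulmx0 !scaler0 !addr0.
  by rewrite mul_mx_scalar.
have gT : g^T = 1%:M + a^T *m ka^T - e *: (c^T *m al^T) + d *: (a^T *m al^T).
  by rewrite /g !linearD linearN !linearZ /= !trmx_mul trmx1.
exists g.
  apply: (flagP_half eB fE).
    rewrite /isometry_group gT !mulmxDr mulmxN mulmx1 -!scalemxAr !mulmxA gBa gBc gB.
    have hd : d * e + e * b + d = 0 by rewrite /d mulNr mulrAC [b * e]mulrC ebb; field.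
    rewrite mulmxBl -[b *: _ *m _]scalemxAl -[RHS]addr0.
    have <- : (d * e + e * b + d) *: (al *m al^T) = 0 by rewrite hd scale0r.
    by apply/matrixP => x y; rewrite !mxE; ring.
  move=> j jr; rewrite gE EjA // !mul0mx !scaler0 subr0 addr0.
  rewrite addmx_sub ?submx_refl //; have [ji|ij] := leqP j i.
    by rewrite EjK // mul0mx sub0mx.
  rewrite mulmx_sub // (submx_trans aE) //; apply: (sdflag_mono fE); lia.
by rewrite gE Ral Rka !mul0mx !scaler0 subr0 addr0 mulmxDl RL -mulmxA aL.
Qed.

Section Normal.
Variable V : 'M[k]_n -> Prop.
Hypotheses (nV : is_normal_subgroup V flagP) (uV : forall u, V u -> mx_unipotent u).

Lemma normal_commutator u g : V u -> flagP g -> V (u *m (g *m invmx u *m invmx g)).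
Proof. by case: nV => -[_ _ Vm Vi] nor Vu Pg; apply/Vm/nor/Vi. Qed.

(** With g in P inducing a transvection on E_{i+1} / E_i, the product u (g u g^-1) lies in V, so its
    trace on this quotient is the dimension. By [transvection_trace] every v X f with v f = 0
    vanishes, where 1 + X is the action of u on the quotient, and then X = 0. *)
Lemma normal_block u i : V u -> (i < r)%N -> (E i.+1 *m (u - 1%:M) <= E i)%MS.
Proof.
move=> Vu ir; case: (nV) => -[VP _ Vm Vi] nor.
have [Pu uu] := VP _ Vu; case: (Pu) => _ su.
have EE : (E i <= E i.+1)%MS by apply: (sdflag_mono fE); lia.
have [p [R [L [RL EL RE EiR]]]] := complement_coords EE.
have si g : flagP g -> stablemx (E i) g by case=> _; apply; lia.
have si1 g : flagP g -> stablemx (E i.+1) g by case=> _; apply; lia.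
(* Compression by R and L is multiplicative here: it is the action on the quotient. *)
have mul X Y : stablemx (E i.+1) X -> stablemx (E i) Y ->
    R *m (X *m Y) *m L = (R *m X *m L) *m (R *m Y *m L).
  move=> sX sY; have /sub_addsmxP[[D1 D2] /= e] : (R *m X <= E i + R)%MS.
    by rewrite (submx_trans (submxMr _ RE)) // (submx_trans sX).
  have /submxP[D eD] : (E i *m Y <= E i)%MS := sY.
  have -> : R *m X *m L = D2 by rewrite e mulmxDl -!mulmxA EL RL mulmx0 add0r mulmx1.
  rewrite mulmxA e !mulmxDl -(mulmxA D1) eD -!mulmxA EL !mulmx0 add0r.
  by rewrite !mulmxA.
have stabB X : stablemx (E i) X -> stablemx (E i) (X - 1%:M).
  by move=> sX; rewrite mulmxBr mulmx1 addmx_sub // -eqmx_opp opprK submx_refl.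
have stabB1 X : stablemx (E i.+1) X -> stablemx (E i.+1) (X - 1%:M).
  by move=> sX; rewrite mulmxBr mulmx1 addmx_sub // -eqmx_opp opprK submx_refl.
have rhoB X : R *m (X - 1%:M) *m L = R *m X *m L - 1%:M.
  by rewrite mulmxBr mulmx1 mulmxBl RL.
have nil g : flagP g -> mx_unipotent g -> exists m, (R *m g *m L - 1%:M) ^+ m = 0.
  move=> Pg [m g0]; exists m; rewrite -rhoB.
  have e : forall j, (R *m (g - 1%:M) *m L) ^+ j = R *m (g - 1%:M) ^+ j *m L /\
      stablemx (E i) ((g - 1%:M) ^+ j).
    elim=> [|j [IH sj]]; first by rewrite !expmx0 !mulmx1 RL submx_refl.
    rewrite expmxS IH expmxS; split; first by rewrite mul //; apply/stabB1/si1.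
    by rewrite mulmxA (submx_trans (submxMr _ (stabB _ (si _ Pg)))).
  by have [-> _] := e m; rewrite g0 mulmx0 mul0mx.
pose X := R *m u *m L - 1%:M.
have eX : R *m u *m L = 1%:M + X by rewrite addrC subrK.
have [m X0] : exists m, X ^+ m = 0 := nil _ Pu (uV Vu).
have {}X0 : X = 0.
  apply: (nilpotent_scalar_eq0 X0) => v f vf0.
  have [g Pg eg] := eichler ir RL EL RE vf0.
  have [Pg' gu] : flagP (invmx g) /\ g \in unitmx.
    case: Pg => ig sg; have gu := isometry_unit eB ig; split=> //.
    by split=> [|j js]; [apply: isometry_inv eB ig | apply: stablemx_inv => //; apply: sg].
  have eg' : R *m invmx g *m L = 1%:M - f *m v.
    have e1 : (1%:M + f *m v) *m (R *m invmx g *m L) = 1%:M.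
      by rewrite -eg -mul ?mulmxV ?mulmx1 //; [apply: si1|apply: si].
    have e2 : (1%:M - f *m v) *m (1%:M + f *m v) = 1%:M.
      rewrite mulmxDr mulmx1 mulmxBl mul1mx -mulmxA (mulmxA v) vf0 mul0mx mulmx0 subr0.
      by rewrite subrK.
    move: (R *m invmx g *m L) e1 => Y e1; have := congr1 (mulmx (1%:M - f *m v)) e1.
    by rewrite mulmxA e2 mul1mx mulmx1.
  apply: (transvection_trace X0 vf0).
  have Vw : V (u *m (g *m u *m invmx g)) by apply/Vm/nor.
  have [Pw _] := VP _ Vw; have [l wl] := nil _ Pw (uV Vw).
  have := mxtrace_nilpotent wl; rewrite raddfB /= mxtrace1 => /eqP; rewrite subr_eq0 => /eqP <-.
  have sgu : stablemx (E i) (g *m u *m invmx g).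
    by have [[_ h] _] := VP _ (nor _ _ Pg Vu); apply: h; lia.
  have sgu1 : stablemx (E i.+1) (g *m u).
    by rewrite mulmxA (submx_trans (submxMr _ (si1 _ Pg))) ?si1.
  congr (\tr _); rewrite mul ?si1 // mul ?si // mul ?si ?si1 //.
  by rewrite eX eg eg'.
rewrite X0 addr0 in eX.
have Rs : (R *m (u - 1%:M) <= E i)%MS.
  have /sub_addsmxP[[D1 D2] /= e] : (R *m (u - 1%:M) <= E i + R)%MS.
    by rewrite (submx_trans (submxMr _ RE)) // (submx_trans (stabB1 _ (si1 _ Pu))).
  have : R *m (u - 1%:M) *m L = 0 by rewrite rhoB eX subrr.
  rewrite e mulmxDl -!mulmxA EL RL mulmx0 add0r mulmx1 => ->.
  by rewrite mul0mx addr0 mulmx_sub.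
rewrite (submx_trans (submxMr _ EiR)) // addsmxMr addsmx_sub Rs andbT.
exact/stabB/si.
Qed.

End Normal.
End GLBlocks.

(** * The middle quotient of the flag and the unipotent radical *)

Section Middle.
Variables (k : closedFieldType) (char_k : 2%N \notin [pchar k]).
Let two0 := two_neq0 char_k.
Variables (n : nat) (o : bool) (B : 'M[k]_n) (r : nat) (E : nat -> 'M[k]_n).
Hypotheses (eB : eform o B) (fE : sdflag B r E).
Notation s := r.*2.+1.
Notation flagU := (flagU B r E).
Notation flagP := (flagP B r E).
Implicit Types (x y a c : 'rV[k]_n) (u g : 'M[k]_n).

Definition bform x y : k := (x *m B *m y^T) 0 0.
Local Notation b := bform.
Local Notation W := (E r.+1).

Lemma bformE x y : x *m B *m y^T = (b x y)%:M.
Proof. exact: mx11_scalar. Qed.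

Lemma bformDl x y z : b (x + y) z = b x z + b y z.
Proof. by rewrite /b !mulmxDl mxE. Qed.

Lemma bformDr x y z : b z (x + y) = b z x + b z y.
Proof. by rewrite /b linearD mulmxDr mxE. Qed.

Lemma bformZl t x y : b (t *: x) y = t * b x y.
Proof. by rewrite /b -!scalemxAl mxE. Qed.

Lemma bformZr t x y : b x (t *: y) = t * b x y.
Proof. by rewrite /b linearZ -scalemxAr mxE. Qed.

Lemma bformNr x y : b x (- y) = - b x y.
Proof. by rewrite -scaleN1r bformZr mulN1r. Qed.

Lemma bformNl x y : b (- x) y = - b x y.
Proof. by rewrite -scaleN1r bformZl mulN1r. Qed.

Lemma bformC x y : b x y = (-1) ^+ o * b y x.
Proof. by rewrite /b (eform_sym _ _ eB) !mxE. Qed.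

Lemma bform_isometry u x y : isometry_group B u -> b (x *m u) (y *m u) = b x y.
Proof.
move=> eu; rewrite /b trmx_mul !mulmxA -(mulmxA x) -(mulmxA x) (eu : _ = _) //.
Qed.

Lemma bform_adj u x y : isometry_group B u -> b x (y *m invmx u) = b (x *m u) y.
Proof.
move=> eu; have uu := isometry_unit eB eu.
by rewrite -(bform_isometry x (y *m invmx u) eu) mulmxKV.
Qed.

Lemma sub_radical x : (x <= E r)%MS <-> forall y, (y <= W)%MS -> b x y = 0.
Proof.
have rs : (r.+1 <= s)%N by lia.
have := sdflag_perp eB fE x rs; have -> : (s - r.+1 = r)%N by lia.
move=> ->; split=> [h y yW|h].
  by rewrite /b (isotropic_sub (submx_refl x) yW h) mxE.
apply/matrixP => i j; rewrite ord1.
have := h (row j W) (row_sub _ _); rewrite /b tr_row colE mulmxA -colE mxE => e.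
by rewrite e mxE.
Qed.

Section Fixed.
Variable u : 'M[k]_n.
Hypothesis Pu : flagP u.

Lemma flagP_unit : u \in unitmx. Proof. by case: Pu => /(isometry_unit eB). Qed.

Lemma middle_stable x : (x <= W)%MS -> (x *m u <= W)%MS.
Proof. by case: Pu => _ h xW; apply: submx_trans (submxMr _ xW) _; apply: h; lia. Qed.

End Fixed.

(* An orthogonal reflection or a symplectic transvection. *)
Lemma quasi_reflection a t : (a <= W)%MS ->
  (-1) ^+ o * (t + t ^+ 2 * b a a) + t = 0 ->
  flagP (1%:M + t *: (B *m a^T *m a)).
Proof.
move=> aW ht; case: (eB) => eBt _; set al := B *m a^T; pose e : k := (-1) ^+ o.
have ee : e * e = 1 by rewrite -expr2 sqrr_sign.
have aB : a *m B = e *: al^T by rewrite trmx_mul trmxK eBt -scalemxAr scalerA ee scale1r.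
have aal : a *m al = (b a a)%:M by rewrite /al mulmxA bformE.
have aat : al^T *m a^T = (b a a)%:M by rewrite -trmx_mul aal tr_scalar_mx.
have Ea j : (j <= r)%N -> E j *m al = 0.
  by move=> jr; rewrite mulmxA; apply: (sdflag_iso fE _ (submx_refl _) aW); lia.
apply: (flagP_half eB fE) => [|j jr]; last first.
  by rewrite mulmxDr mulmx1 -scalemxAr mulmxA Ea // mul0mx scaler0 addr0 submx_refl.
have Ba : B *m a^T = al by [].
clearbody al; rewrite /isometry_group.
have gB : (1%:M + t *: (al *m a)) *m B = B + (t * e) *: (al *m al^T).
  by rewrite mulmxDl mul1mx -scalemxAl -mulmxA aB -scalemxAr scalerA.
rewrite gB linearD linearZ /= trmx1 trmx_mul mulmxDr mulmx1 -scalemxAr mulmxA mulmxDl Ba.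
rewrite -[(t * e) *: _ *m _]scalemxAl -(mulmxA al) aat mul_mx_scalar scalerA.
have -> : al + (t * e * b a a) *: al = (1 + t * e * b a a) *: al by rewrite scalerDl scale1r.
rewrite -scalemxAl scalerA -addrA -scalerDl.
have -> : t * e + t * (1 + t * e * b a a) = 0 by rewrite -[RHS]ht -/e; ring.
by rewrite scale0r addr0.
Qed.

Lemma quasi_reflection_conj u a t : isometry_group B u ->
  u *m (1%:M + t *: (B *m a^T *m a)) *m invmx u =
  1%:M + t *: (B *m (a *m invmx u)^T *m (a *m invmx u)).
Proof.
move=> eu; have uu := isometry_unit eB eu.
have -> : B *m (a *m invmx u)^T = u *m B *m a^T.
  by rewrite -[in LHS](eu : _ = _) trmx_mul trmx_inv !mulmxA mulmxK // unitmx_tr.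
by rewrite mulmxDr mulmxDl mulmx1 mulmxV // -scalemxAr -scalemxAl !mulmxA.
Qed.

Lemma quasi_reflection_trace a c t t' :
  \tr ((1%:M + t *: (B *m c^T *m c)) *m (1%:M + t' *: (B *m a^T *m a))) =
  n%:R + t * b c c + t' * b a a + t * t' * (b c a * b a c).
Proof.
have tr1 x y : \tr (B *m x^T *m y) = b y x.
  by rewrite mxtrace_mulC mulmxA bformE mxtrace_scalar mulr1n.
rewrite mulmxDl mul1mx mulmxDr mulmx1 !mxtraceD mxtrace1 !mxtraceZ !tr1.
rewrite -scalemxAl -scalemxAr !mxtraceZ.
have -> : B *m c^T *m c *m (B *m a^T *m a) = b c a *: (B *m c^T *m a).
  by rewrite -!mulmxA (mulmxA c) (mulmxA (c *m B)) bformE mul_scalar_mx -!scalemxAr.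
rewrite mxtraceZ tr1; ring.
Qed.

Section Normal.
Variable V : 'M[k]_n -> Prop.
Hypotheses (nV : is_normal_subgroup V flagP) (uV : forall u, V u -> mx_unipotent u).

Lemma normalP u : V u -> flagP u.
Proof. by case: nV => -[h _ _ _] _ /h[]. Qed.

Lemma quasi_reflection_inv a t t' : t + t' + t * t' * b a a = 0 ->
  (1%:M + t *: (B *m a^T *m a)) *m (1%:M + t' *: (B *m a^T *m a)) = 1%:M.
Proof.
move=> ht; set P := _ *m a; have PP : P *m P = b a a *: P.
  by rewrite /P -!mulmxA (mulmxA a) (mulmxA (a *m B)) bformE mul_scalar_mx -!scalemxAr.
rewrite mulmxDl mul1mx mulmxDr mulmx1 -scalemxAl -scalemxAr PP !scalerA -addrA -!scalerDl.
by have -> : t' + (t + t * t' * b a a) = 0; [rewrite -[RHS]ht; ring | rewrite scale0r addr0].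
Qed.

(** The commutator of u with the quasi-reflection along a is a product of quasi-reflections along a
    u^-1 and a, with t' the parameter of the inverse. Its trace is computed by
    [quasi_reflection_trace] and must equal n, since the product lies in V. *)
Lemma normal_comm_reflection u a t t' : V u -> (a <= W)%MS ->
  (-1) ^+ o * (t + t ^+ 2 * b a a) + t = 0 -> t + t' + t * t' * b a a = 0 ->
  V ((1%:M + t *: (B *m (a *m invmx u)^T *m (a *m invmx u))) *m
     (1%:M + t' *: (B *m a^T *m a))).
Proof.
move=> Vu aW ht htt; have Pg := quasi_reflection aW ht.
have := normal_commutator nV Vu Pg.
have -> : invmx (1%:M + t *: (B *m a^T *m a)) = 1%:M + t' *: (B *m a^T *m a).
  have gu := flagP_unit Pg; apply: (can_inj (mulKmx gu)).
  by rewrite mulmxV // quasi_reflection_inv.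
by case: (normalP Vu) => eu _; rewrite (mulmxA u) (mulmxA u) quasi_reflection_conj.
Qed.

(** The trace of the commutator with a transvection gives b(x, x u^-1) = 0 on W. Polarizing, y (u^-1
    - u) is orthogonal to W for all y in W. As u^2 - 1 = (u + 1) (u - 1) and u + 1 is invertible on
    W, a (u - 1) is orthogonal to W as well. *)
Lemma symplectic_middle u a : o -> V u -> (a <= W)%MS -> (a *m (u - 1%:M) <= E r)%MS.
Proof.
move=> ho Vu.
have sgn : (-1) ^+ o = -1 :> k by rewrite ho.
have alt x : b x x = 0.
  have := bformC x x; rewrite sgn mulN1r => /eqP; rewrite -addr_eq0 -mulr2n -mulr_natl.
  by rewrite mulf_eq0 (negPf two0) => /eqP.
have Pu := normalP Vu; have [eu _] := Pu; have uu := flagP_unit Pu.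
have fix0 x : (x <= W)%MS -> b x (x *m invmx u) = 0.
  move=> xW; have := @normal_comm_reflection u x 1 (-1) Vu xW.
  rewrite alt !mulr0 !addr0 sgn mulr1 addNr subrr => /(_ erefl erefl) Vw.
  have := mxtrace_unipotent (uV Vw); rewrite quasi_reflection_trace !alt mulr0 addr0 mulr0 addr0.
  rewrite (bformC _ x) sgn mulN1r mul1r mulN1r mulNr opprK -[RHS]addr0 => /addrI/eqP.
  by rewrite mulf_eq0 orbb => /eqP.
have adj x y : b x (y *m invmx u) = b (x *m u) y by apply: bform_adj.
have key x y : (x <= W)%MS -> (y <= W)%MS -> b x (y *m (invmx u - u)) = 0.
  move=> xW yW; have := fix0 (x + y) (addmx_sub xW yW).
  rewrite mulmxDl bformDr !bformDl !fix0 // add0r addr0 addrC => e.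
  rewrite mulmxBr bformDr bformNr -[RHS]e; congr (_ + _).
  by rewrite adj (bformC (y *m u)) sgn mulN1r.
move=> aW; apply/sub_radical => x xW.
have [m u0] := uV Vu.
have vu : u + 1%:M \in unitmx.
  have -> : u + 1%:M = 2%:M + (u - 1%:M).
    by rewrite (raddfD (@scalar_mx k n)) /= addrC [RHS]addrC addrA subrK addrC.
  exact: nilpotent_unit_add two0 u0.
pose y := a *m invmx (u + 1%:M).
have yW : (y <= W)%MS.
  apply: submx_trans (submxMr _ aW) _; apply: stablemx_inv => //.
  rewrite mulmxDr mulmx1 addmx_sub ?submx_refl //; by case: Pu => _; apply; lia.
have -> : a *m (u - 1%:M) = - (y *m u *m (invmx u - u)).
  have -> : a = y *m (u + 1%:M) by rewrite mulmxKV.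
  clearbody y; rewrite [y *m u *m _]mulmxBr mulmxK //.
  rewrite mulmxBr mulmx1 mulmxDr mulmx1 mulmxDl.
  by apply/matrixP => i j; rewrite !mxE; ring.
by rewrite bformNl bformC key ?mulr0 ?oppr0 //; apply: middle_stable.
Qed.

Section Orthogonal.
Hypothesis ho : ~~ o.
Let sgn : (-1) ^+ o = 1 :> k. Proof. by rewrite (negPf ho). Qed.

Lemma bform_symm x y : b x y = b y x.
Proof. by rewrite bformC sgn mul1r. Qed.

Lemma normal_reflections u a : V u -> (a <= W)%MS -> b a a != 0 ->
  V ((1%:M - (2 / b a a) *: (B *m (a *m invmx u)^T *m (a *m invmx u))) *m
     (1%:M - (2 / b a a) *: (B *m a^T *m a))).
Proof.
move=> Vu aW Q0; rewrite -!scaleNr; apply: normal_comm_reflection => //.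
  by rewrite sgn; field.
by field.
Qed.

Lemma normal_sq u a : V u -> (a <= W)%MS -> b a a != 0 ->
  b a (a *m invmx u) ^+ 2 = b a a ^+ 2.
Proof.
move=> Vu aW Q0; have := mxtrace_unipotent (uV (normal_reflections Vu aW Q0)).
have [eu _] := normalP Vu.
rewrite -!scaleNr quasi_reflection_trace (bform_isometry a a (isometry_inv eB eu)).
rewrite (bform_symm _ a); set c := b a (_ *m _); set Q := b a a in Q0 *.
have -> : n%:R + - (2 / Q) * Q + - (2 / Q) * Q + - (2 / Q) * - (2 / Q) * (c * c) =
   n%:R + 2 * 2 * (c ^+ 2 / Q ^+ 2 - 1) by field.
rewrite -[RHS]addr0 => /addrI/eqP; rewrite !mulf_eq0 (negPf two0) /= subr_eq0 => /eqP e.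
by rewrite -[RHS]mul1r -e divfK // expf_neq0.
Qed.

(** [normal_sq] leaves a sign for each non-isotropic vector. Along the pencil a0 + t a, the two
    quadratic forms are polynomials F and G in t with G (F - G) (F + G) = 0, so F = G or F = -G
    throughout, and t = 0 fixes the sign. *)
Lemma normal_sign u a0 : V u -> (a0 <= W)%MS -> b a0 a0 != 0 ->
  exists2 sg : k, sg = 1 \/ sg = -1 &
    forall a, (a <= W)%MS -> b a (a *m invmx u) = sg * b a a.
Proof.
move=> Vu a0W Q0.
pose f x y := b x (y *m invmx u).
have [sg hs h0] : exists2 sg : k, sg = 1 \/ sg = -1 & f a0 a0 = sg * b a0 a0.
  have := normal_sq Vu a0W Q0; rewrite -/(f a0 a0) => /eqP; rewrite eqf_sqr.
  by case/orP => /eqP->; [exists 1; [left|rewrite mul1r]|exists (-1); [right|rewrite mulN1r]].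
exists sg => // a aW.
pose F := Poly [:: f a0 a0; f a0 a + f a a0; f a a].
pose G := Poly [:: b a0 a0; b a0 a + b a a0; b a a].
have FE t : F.[t] = f (a0 + t *: a) (a0 + t *: a).
  rewrite horner_Poly /= /f mulmxDl -scalemxAl !(bformDl, bformDr, bformZl, bformZr); ring.
have GE t : G.[t] = b (a0 + t *: a) (a0 + t *: a).
  rewrite horner_Poly /= !(bformDl, bformDr, bformZl, bformZr); ring.
have G0 : G != 0.
  by apply: contraNneq Q0 => e; rewrite -(addr0 a0) -(scale0r a) -GE e horner0.
have /eqP: G * ((F - G) * (F + G)) = 0.
  apply: poly_eval0 => t; rewrite !hornerM hornerD hornerN hornerD.
  have [->|Gt] := eqVneq G.[t] 0; first by rewrite mul0r.
  have -> : (F.[t] - G.[t]) * (F.[t] + G.[t]) = F.[t] ^+ 2 - G.[t] ^+ 2 by ring.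
  rewrite FE GE normal_sq ?subrr ?mulr0 -?GE //.
  by rewrite addmx_sub // scalemx_sub.
have e2 : (F`_2 = f a a) * (G`_2 = b a a) by rewrite !coef_Poly.
have e0 : (F`_0 = f a0 a0) * (G`_0 = b a0 a0) by rewrite !coef_Poly.
rewrite !mulf_eq0 (negPf G0) /= subr_eq0 addr_eq0 -/(f a a) => /orP[]/eqP e.
  suff -> : sg = 1 by rewrite mul1r -!e2 e.
  by apply: (mulIf Q0); rewrite mul1r -h0 -!e0 e.
suff -> : sg = -1 by rewrite mulN1r -!e2 e coefN.
by apply: (mulIf Q0); rewrite mulN1r -h0 -!e0 e coefN.
Qed.

(** The polarization of [normal_sign], once the sign -1 is excluded. With that sign, y (u^-1 + u +
    2) would be orthogonal to W for y in W; but u (u^-1 + u + 2) = (u + 1)^2 is invertible on W, so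
    a0 would be isotropic. *)
Lemma normal_polar u a0 x y : V u -> (a0 <= W)%MS -> b a0 a0 != 0 ->
  (x <= W)%MS -> (y <= W)%MS -> b x (y *m invmx u) + b x (y *m u) = 2 * b x y.
Proof.
move=> Vu a0W Q0.
have [sg hs h] := normal_sign Vu a0W Q0.
have Pu := normalP Vu; have [eu _] := Pu; have uu := flagP_unit Pu.
have pol x' y' : (x' <= W)%MS -> (y' <= W)%MS ->
    b x' (y' *m invmx u) + b x' (y' *m u) = 2 * sg * b x' y'.
  move=> xW yW; have := h (x' + y') (addmx_sub xW yW).
  rewrite mulmxDl !(bformDl, bformDr) !h // (bform_symm y' x').
  rewrite (bform_symm x' (y' *m u)) -(bform_adj y' x' eu) => e.
  apply: (addrI (sg * b x' x' + sg * b y' y')).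
  transitivity (sg * (b x' x' + b x' y' + (b x' y' + b y' y'))); last by ring.
  by rewrite -e; ring.
case: hs pol => [-> pol xW yW|sg1 pol _ _]; first by rewrite pol // mulr1.
case/eqP: Q0; have [m u0] := uV Vu.
have vu : u + 1%:M \in unitmx.
  have -> : u + 1%:M = 2%:M + (u - 1%:M).
    by rewrite (raddfD (@scalar_mx k n)) /= addrC [RHS]addrC addrA subrK addrC.
  exact: nilpotent_unit_add two0 u0.
have st z : (z <= W)%MS -> (z *m invmx (u + 1%:M) <= W)%MS.
  move=> zW; apply: submx_trans (submxMr _ zW) _; apply: stablemx_inv => //.
  rewrite mulmxDr mulmx1 addmx_sub ?submx_refl //; by case: Pu => _; apply; lia.
pose z := a0 *m invmx (u + 1%:M) *m invmx (u + 1%:M).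
have zW : (z <= W)%MS by do 2!apply: (st).
have ea : a0 = z *m u *m invmx u + z *m u *m u + 2 *: (z *m u).
  have -> : a0 = z *m (u + 1%:M) *m (u + 1%:M) by rewrite /z !mulmxKV.
  clearbody z; rewrite mulmxK // !(mulmxDl, mulmxDr) !mulmx1.
  by apply/matrixP => i j; rewrite !mxE; ring.
have zuW : (z *m u <= W)%MS by apply: middle_stable.
clearbody z; rewrite {2}ea !bformDr bformZr (pol _ _ a0W zuW) sg1; ring.
Qed.

(** It suffices to treat non-isotropic vectors, as differences of such vectors cover W unless the
    form vanishes on W. For such a vector a, put c = a u; the product of the reflections along c and
    a lies in V, and [normal_polar] applied to it shows that c - a is in the radical E_r. *)
Lemma orthogonal_middle u a : V u -> (a <= W)%MS -> (a *m (u - 1%:M) <= E r)%MS.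
Proof.
move=> Vu; suff {u Vu} h u a0 : V u -> (a0 <= W)%MS -> b a0 a0 != 0 ->
    (a0 *m (u - 1%:M) <= E r)%MS.
  have [[a0 a0W Q0]|h0] := classic (exists2 a0, (a0 <= W)%MS & b a0 a0 != 0); last first.
    have z x : (x <= W)%MS -> b x x = 0.
      by move=> xW; apply/eqP/negbNE/negP => ne; apply: h0; exists x.
    move=> aW; have [_ su] := normalP Vu.
    have aE : (a <= E r)%MS; last first.
      rewrite mulmxBr mulmx1 addmx_sub //; last by rewrite -eqmx_opp opprK.
      by apply: submx_trans (submxMr _ aE) _; apply: su; lia.
    apply/sub_radical => y yW; have := z _ (addmx_sub aW yW).
    rewrite !(bformDl, bformDr) !z // add0r addr0 (bform_symm y) -mulr2n -mulr_natl => /eqP.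
    by rewrite mulf_eq0 (negPf two0) => /eqP.
  have [Q|] := eqVneq (b a a) 0; last by move=> ? ?; apply: h.
  (* If a, a0 + a and a0 - a were all isotropic, then 2 b(a0, a0) = 0. *)
  have [Q1|] := eqVneq (b (a0 + a) (a0 + a)) 0.
    have Q2 : b (a0 - a) (a0 - a) != 0.
      apply: contraNneq Q0 => e; suff : 2 * b a0 a0 == 0 by rewrite mulf_eq0 (negPf two0).
      move: Q1 e; rewrite !(bformDl, bformDr, bformNl, bformNr) Q => Q1 e.
      rewrite -[X in _ == X]addr0 -[X in _ == X + _]Q1 -[X in _ == _ + X]e; apply/eqP; ring.
    move=> aW; have aW' : (a0 - a <= W)%MS by rewrite addmx_sub // -eqmx_opp opprK.
    have -> : a = a0 - (a0 - a) by rewrite opprB addrC subrK.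
    by rewrite mulmxBl addmx_sub ?h // -eqmx_opp opprK h.
  move=> Q1 aW; have -> : a = (a0 + a) - a0 by rewrite addrC addKr.
  by rewrite mulmxBl addmx_sub ?h ?addmx_sub // -eqmx_opp opprK h.
clear a; move: a0 => a Vu a0W Q0; set Q := b a a in Q0.
have Vu' : V (invmx u) by case: nV => -[_ _ _ Vi] _; apply: Vi.
have [eu _] := normalP Vu; pose c := a *m u.
have cW : (c <= W)%MS by apply: middle_stable (normalP Vu) _ a0W.
have ca : b c a = Q.
  have := normal_polar Vu a0W Q0 a0W a0W; rewrite (bform_adj a a eu) -/c (bform_symm a c).
  by move=> e; apply: (mulfI two0); rewrite -[RHS]e; ring.
have := normal_reflections Vu' a0W Q0; rewrite invmxK -/c -/Q.
set w := _ *m _ => Vw; have [ew _] := normalP Vw.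
have refl x z : x *m (1%:M - (2 / Q) *: (B *m z^T *m z)) = x - (2 / Q * b x z) *: z.
  by rewrite mulmxBr mulmx1 -scalemxAr !mulmxA bformE mul_scalar_mx scalerA.
have wE x : x *m w = x - (2 / Q * b x c) *: c -
    (2 / Q * b (x - (2 / Q * b x c) *: c) a) *: a by rewrite mulmxA !refl.
have main x y : (x <= W)%MS -> (y <= W)%MS -> b y a = 0 -> b y c * b x (c - a) = 0.
  move=> xW yW ya; have := normal_polar Vw a0W Q0 xW yW.
  rewrite (bform_adj x y ew) !wE !(bformDl, bformDr, bformNl, bformNr, bformZl, bformZr).
  rewrite ca (bform_symm c y) (bform_symm a y) ya => e.
  have : 2 * 2 * (b y c * (b x c - b x a)) == 0.
    apply/eqP; rewrite -[RHS](mulr0 (- Q)) -(subrr (2 * b x y)) -{1}e; field; exact: Q0.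
  by rewrite !mulf_eq0 (negPf two0) /= -mulf_eq0 => /eqP.
(* Either some y orthogonal to a is not orthogonal to c, and [main] applies; or c is orthogonal to
   all y in W orthogonal to a, and b(c, a) = Q gives the claim on x by projecting x along a. *)
have rad : forall x, (x <= W)%MS -> b x (c - a) = 0.
  have [[y [yW ya yc]]|h] := classic (exists y, [/\ (y <= W)%MS, b y a = 0 & b y c != 0]).
    by move=> x xW; have /eqP := main x y xW yW ya; rewrite mulf_eq0 (negPf yc) => /eqP.
  move=> x xW; pose y := x - (b x a / Q) *: a.
  have yW : (y <= W)%MS by rewrite addmx_sub // -scaleNr scalemx_sub.
  have ya : b y a = 0 by rewrite bformDl bformNl bformZl divfK // subrr.
  have yc : b y c = 0 by apply/eqP/negbNE/negP => yc; apply: h; exists y.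
  move: yc; rewrite /y bformDl bformNl bformZl (bform_symm a c) ca divfK //.
  by rewrite bformDr bformNr.
have -> : a *m (u - 1%:M) = c - a by rewrite mulmxBr mulmx1.
by apply/sub_radical => x xW; rewrite bform_symm rad.
Qed.

End Orthogonal.

Lemma normal_unipotent_sub u : V u -> flagU u.
Proof.
move=> Vu; have Pu := normalP Vu; apply: (flagU_half eB fE Pu) => i.
rewrite leq_eqVlt => /orP[/eqP->|ir]; last exact: (normal_block char_k eB fE nV uV).
apply/row_subP => j; rewrite row_mul.
by have [ho|ho] := boolP o; [apply: symplectic_middle|apply: orthogonal_middle]; rewrite ?row_sub.
Qed.

End Normal.

Lemma unipotent_radical_flagU : is_unipotent_radical flagU flagP.
Proof.
split; last by move=> V [nV _ _ uV] u; apply: normal_unipotent_sub.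
split; [exact: (flagU_normal eB fE)|exact: zclosed_flagU|exact: zconnected_flagU eB fE|].
by move=> u Uu; exists s; apply: (flagU_nilp fE).
Qed.

Lemma unipotent_radical_unique U : is_unipotent_radical U flagP -> forall u, U u <-> flagU u.
Proof.
move=> [[nU cU coU uU] mU] u; split=> [|Uu]; first exact: normal_unipotent_sub.
by have [h _] := unipotent_radical_flagU; apply: mU h _ Uu.
Qed.

End Middle.

(** * Jordan types and rank bounds *)

Section Jordan.
Variable k : fieldType.

Definition shift_mx n : 'M[k]_n := \matrix_(i, j) (j == i.+1 :> nat)%:R.

Lemma sum_delta n (i : nat) (F : 'I_n -> k) :
  \sum_(l < n) (l == i :> nat)%:R * F l = (if insub i is Some l then F l else 0).
Proof.
case: insubP => [l li <-|ni].
  rewrite (bigD1 l) //= eqxx mul1r big1 ?addr0 // => m ml.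
  by rewrite (negPf (_ : m != l :> nat)) ?mul0r.
rewrite big1 // => l _; case: eqP => [e|]; last by rewrite mul0r.
by rewrite -e ltn_ord in ni.
Qed.

Lemma shift_mx_mul n m (A : 'M[k]_(n, m)) i l : (shift_mx n *m A) i l =
  if insub i.+1 is Some j then A j l else 0.
Proof. by rewrite mxE -(sum_delta _ (fun j => A j l)); apply: eq_bigr => j _; rewrite mxE. Qed.

Lemma shift_mxX n j : shift_mx n ^+ j = \matrix_(i, l) (l == (i + j)%N :> nat)%:R.
Proof.
elim: j => [|j IH]; apply/matrixP => i l.
  by rewrite expmx0 !mxE addn0 eq_sym.
rewrite expmxS shift_mx_mul IH; case: insubP => [i' _ e|ni]; rewrite !mxE ?e ?addnS ?addSn //.
by case: eqP => // e; have := ltn_ord l; rewrite e; lia.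
Qed.

Lemma mxrank_shiftX n j : \rank (shift_mx n ^+ j) = (n - j)%N.
Proof.
rewrite shift_mxX; set S := \matrix_(i, l) _.
pose A : 'M[k]_(n, n - j) := \matrix_(i, l) (l == i :> nat)%:R.
pose C : 'M[k]_(n - j, n) := \matrix_(i, l) (l == (i + j)%N :> nat)%:R.
have eS : S = A *m C.
  apply/matrixP => i l; rewrite !mxE; under eq_bigr do rewrite mxE.
  rewrite (sum_delta _ (fun m => C m l)); case: insubP => [m _ e|ni]; first by rewrite mxE e.
  by case: eqP => // e; have := ltn_ord l; rewrite e; lia.
have AA : A^T *m A = 1%:M.
  apply/matrixP => i l; rewrite !mxE.
  have lt_i : (i < n)%N by have := ltn_ord i; lia.
  rewrite (bigD1 (Ordinal lt_i)) //= big1 => [|m mi]; rewrite !mxE /=.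
    by rewrite eqxx mul1r addr0 eq_sym.
  by case: eqP => [e|]; rewrite ?mul0r //; case/eqP: mi; apply: val_inj.
have CC : C *m C^T = 1%:M.
  apply/matrixP => i l; rewrite !mxE; under eq_bigr do rewrite mxE.
  rewrite (sum_delta _ (fun m => C^T m l)); case: insubP => [m _ e|ni]; last first.
    by have := ltn_ord i; lia.
  by rewrite !mxE e eqn_add2r.
apply/eqP; rewrite eqn_leq {1}eS (leq_trans (mxrankM_maxl _ _)) ?rank_leq_col //=.
have e1 : A^T *m S *m C^T = 1%:M by rewrite eS mulmxA AA mul1mx.
rewrite -{1}(mxrank1 k (n - j)) -e1.
by rewrite (leq_trans (mxrankM_maxl _ _)) // mxrankM_maxr.
Qed.

Lemma expmx_block n1 n2 (A : 'M[k]_n1) (D : 'M[k]_n2) j :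
  block_mx A 0 0 D ^+ j = block_mx (A ^+ j) 0 0 (D ^+ j).
Proof.
elim: j => [|j IH]; first by rewrite !expmx0 -scalar_mx_block.
by rewrite !expmxS IH mulmx_block !(mulmx0, mul0mx, addr0, add0r).
Qed.

Lemma reshape_index_cons d s i :
  reshape_index (d :: s) i = if (i < d)%N then 0%N else (reshape_index s (i - d)).+1.
Proof.
rewrite /reshape_index /= subn_eq0; case: ltnP => // di; congr (_.+1).
by rewrite subSn.
Qed.

Lemma nilp_jordan_cons d s n : (nilp_jordan_mx k (d + n) (d :: s)) =
  block_mx (shift_mx d) 0 0 (nilp_jordan_mx k n s).
Proof.
apply/matrixP => i j; rewrite mxE !reshape_index_cons.
case: (splitP i) => i' ei; case: (splitP j) => j' ej; rewrite ei ej.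
- have -> : i = lshift n i' by apply: val_inj.
  have -> : j = lshift n j' by apply: val_inj.
  by rewrite block_mxEul mxE eqxx andbT.
- have -> : i = lshift n i' by apply: val_inj.
  have -> : j = rshift d j' by apply: val_inj.
  by rewrite block_mxEur mxE andbF.
- have -> : i = rshift d i' by apply: val_inj.
  have -> : j = lshift n j' by apply: val_inj.
  by rewrite block_mxEdl mxE andbF.
have -> : i = rshift d i' by apply: val_inj.
have -> : j = rshift d j' by apply: val_inj.
by rewrite block_mxEdr mxE !addKn eqSS -addnS eqn_add2l.
Qed.

Definition jordan_rank (s : seq nat) (j : nat) := (\sum_(x <- s) (x - j))%N.

Lemma mxrank_jordan s j : \rank (nilp_jordan_mx k (sumn s) s ^+ j) = jordan_rank s j.
Proof.
elim: s => [|d s IH] /=; first by rewrite /jordan_rank big_nil; apply/eqP; rewrite -leqn0 rank_leq_row.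
by rewrite nilp_jordan_cons expmx_block rank_diag_block_mx IH mxrank_shiftX /jordan_rank big_cons.
Qed.

Lemma mxrank_nilp_jordan n s j : sumn s = n ->
  \rank (nilp_jordan_mx k n s ^+ j) = jordan_rank s j.
Proof. by move=> <-; apply: mxrank_jordan. Qed.

Definition mx_similar n (X Y : 'M[k]_n) := exists2 g, g \in unitmx & X = invmx g *m Y *m g.

Lemma mxrank_similar n (X Y : 'M[k]_n) j : mx_similar X Y -> \rank (X ^+ j) = \rank (Y ^+ j).
Proof.
move=> [g gu ->]; have -> : invmx g *m Y *m g = invmx g *m Y *m invmx (invmx g) by rewrite invmxK.
rewrite conjmx_exp ?unitmx_inv // invmxK mxrankMfree ?row_free_unit //.
by rewrite -mxrank_tr trmx_mul mxrankMfree ?mxrank_tr // row_free_unit unitmx_tr unitmx_inv.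
Qed.

(** With v X^d f nonzero, the rows v X^i of C and the columns X^(d-j) f of F pair to a triangular
    matrix C F with diagonal v X^d f. Hence C spans a single Jordan block of size d + 1, and the
    kernel of F is an X-stable complement. *)
Lemma nilpotent_split n (X : 'M[k]_n) d : X ^+ d.+1 = 0 -> X ^+ d != 0 ->
  exists n' (e : n = (d.+1 + n')%N) (X' : 'M[k]_n'),
    X' ^+ d.+1 = 0 /\ mx_similar (castmx (e, e) X) (block_mx (shift_mx d.+1) 0 0 X').
Proof.
move=> Xd1 Xd.
have [v [f vf]] : exists (v : 'rV_n) (f : 'cV_n), v *m X ^+ d *m f != 0.
  move: Xd; case/matrix0Pn => i [j ij]; exists (delta_mx 0 i), (delta_mx j 0).
  rewrite -rowE -colE; apply/eqP => /matrixP/(_ 0 0); rewrite !mxE => e.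
  by rewrite e eqxx in ij.
have Xge m : (d < m)%N -> X ^+ m = 0.
  by move=> dm; rewrite -(subnK dm) exprD Xd1 mulr0.
pose C : 'M[k]_(d.+1, n) := \matrix_(i, l) (v *m X ^+ i) 0 l.
pose F : 'M[k]_(n, d.+1) := \matrix_(l, j) (X ^+ (d - j) *m f) l 0.
have rC i : row i C = v *m X ^+ i by apply/rowP => l; rewrite !mxE.
have CF i j : (C *m F) i j = (v *m X ^+ (i + (d - j)) *m f) 0 0.
  have -> : (v *m X ^+ (i + (d - j)) *m f) = (v *m X ^+ i) *m (X ^+ (d - j) *m f).
    by rewrite exprD !mulmxA.
  by rewrite !mxE; apply: eq_bigr => l _; rewrite !mxE.
have CFu : C *m F \in unitmx.
  rewrite -unitmx_tr unitmxE det_trig; last first.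
    apply/is_trig_mxP => i j ij; rewrite mxE CF Xge ?mulmx0 ?mul0mx ?mxE //.
    have := ltn_ord i; lia.
  rewrite unitfE; apply/prodf_neq0 => i _; rewrite mxE CF subnKC; last by rewrite -ltnS.
  by apply: contraNneq vf => e; apply/eqP/matrixP => a b; rewrite !ord1 e mxE.
have Cf : row_free C.
  by rewrite /row_free eqn_leq rank_leq_row -{1}(mxrank_unit CFu) mxrankM_maxl.
have Ff : \rank F = d.+1.
  by apply/eqP; rewrite eqn_leq rank_leq_col -{1}(mxrank_unit CFu) mxrankM_maxr.
have dn : (d.+1 <= n)%N by rewrite -Ff rank_leq_row.
exists (n - d.+1)%N, (esym (subnKC dn)).
move: (n - d.+1)%N (subnKC dn) => n' en; move: en (esym en) => _ en; subst n.
have rK : \rank (kermx F) = n' by rewrite mxrank_ker Ff addKn.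
have [T Tf TK] := row_base_of rK.
have TF : T *m F = 0 by apply/sub_kermxP; rewrite TK.
have KX : (T *m X <= T)%MS.
  rewrite TK; apply/sub_kermxP/matrixP => i j; rewrite [RHS]mxE.
  have FE Z j' : (Z *m F : 'M_(n', d.+1)) i j' = (row i Z *m X ^+ (d - j') *m f) 0 0.
    rewrite mxE -mulmxA mxE; apply: eq_bigr => l _; by rewrite !mxE.
  rewrite FE row_mul -(mulmxA (row i T)) -expmxS.
  have [j0|j0] := posnP j; first by rewrite j0 subn0 Xd1 mulmx0 mul0mx mxE.
  have jd : (j.-1 < d.+1)%N by have := ltn_ord j; lia.
  have := FE T (Ordinal jd); rewrite TF mxE /= => /esym.
  by have -> : (d - j.-1 = (d - j).+1)%N by have := ltn_ord j; lia.
have /submxP[X' eX'] := KX.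
have CX : C *m X = shift_mx d.+1 *m C.
  apply/matrixP => i l; have -> : (C *m X) i l = row i (C *m X) 0 l by rewrite [RHS]mxE.
  rewrite shift_mx_mul row_mul rC -mulmxA -expmxSr; case: insubP => [i' _ e|ni].
    by rewrite [RHS]mxE -e.
  by rewrite Xge ?mulmx0 ?mxE //; have := ltn_ord i; lia.
have gf : row_free (col_mx C T).
  rewrite /row_free -addsmxE mxrank_disjoint_sum; first by rewrite (eqP Cf) (eqP Tf).
  apply/eqP; rewrite -submx0; have /submxP[D eD] := capmxSl C T.
  suff : D = 0 by move=> D0; rewrite eD D0 mul0mx sub0mx.
  apply: (can_inj (mulmxK CFu)); rewrite mul0mx mulmxA -eD.
  by have /submxP[D' ->] := capmxSr C T; rewrite -mulmxA TF mulmx0.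
exists X'; split.
  have e m : T *m X ^+ m = X' ^+ m *m T.
    elim: m => [|m IH]; first by rewrite !expmx0 mulmx1 mul1mx.
    by rewrite expmxSr mulmxA IH expmxSr -!mulmxA eX'.
  by apply: (row_free_inj Tf); rewrite mul0mx -e Xd1 mulmx0.
rewrite castmx_id; exists (col_mx C T); first by rewrite -row_free_unit.
apply: (can_inj (mulKmx (_ : col_mx C T \in unitmx))); first by rewrite -row_free_unit.
rewrite !mulmxA mulmxV -?row_free_unit // mul1mx mul_col_mx CX eX'.
by rewrite mul_block_col !mul0mx addr0 add0r.
Qed.

Lemma mx_similar_trans n (X Y Z : 'M[k]_n) : mx_similar X Y -> mx_similar Y Z -> mx_similar X Z.
Proof.
move=> [g gu ->] [h hu ->]; have u : h *m g \in unitmx by rewrite unitmx_mul hu.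
exists (h *m g) => //; apply: (can_inj (mulKmx u)).
by rewrite !mulmxA mulmxV // mul1mx mulmxK // mulmxV // mul1mx.
Qed.

Lemma mx_similar_block n1 n2 (A : 'M[k]_n1) (X Y : 'M[k]_n2) : mx_similar X Y ->
  mx_similar (block_mx A 0 0 X) (block_mx A 0 0 Y).
Proof.
move=> [g gu ->]; have u : block_mx 1%:M 0 0 g \in @unitmx k (n1 + n2).
  by rewrite unitmxE det_ublock det1 mul1r -unitmxE.
exists (block_mx 1%:M 0 0 g) => //; apply: (can_inj (mulKmx u)); rewrite !mulmxA mulmxV // mul1mx.
by rewrite !mulmx_block !(mulmx0, mul0mx, addr0, add0r, mul1mx, mulmx1) !mulmxA mulmxV // mul1mx.
Qed.

(** The block split off has the nilpotency index as its size, so this size bounds the index of the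
    rest; [path geq d s] carries the bound through the induction and makes the sizes
    non-increasing. *)
Lemma nilpotent_jordan n (X : 'M[k]_n) d : X ^+ d = 0 ->
  exists s, [/\ sumn s = n, path geq d s, all (leq 1) s & mx_similar X (nilp_jordan_mx k n s)].
Proof.
elim/ltn_ind: n X d => -[|n] IH X d Xd.
  exists [::]; split=> //; exists 1%:M; first exact: unitmx1.
  by apply/matrixP => -[].
have ex : exists d, X ^+ d == 0 by exists d; rewrite Xd.
case: (ex_minnP ex) => -[|d1] /eqP X0 dmin.
  by move/matrixP/(_ ord0 ord0): X0; rewrite !mxE => /eqP; rewrite oner_eq0.
have Xd1 : X ^+ d1 != 0 by apply/negP => /dmin; rewrite ltnn.
have [n' [e [X' [X'0 sim]]]] := nilpotent_split X0 Xd1.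
have nn' : (n' < n.+1)%N by rewrite e; lia.
have [s' [ss ps as' sim']] := IH n' nn' X' d1.+1 X'0.
exists (d1.+1 :: s'); rewrite /= ss ps as' dmin ?Xd //; split=> //.
have {}sim := mx_similar_trans sim (mx_similar_block (shift_mx d1.+1) sim').
move: sim; rewrite -nilp_jordan_cons; move: (d1.+1 + n')%N e => m e.
by case: m / e; rewrite castmx_id.
Qed.

Lemma jordan_rankS s j : jordan_rank s j = (jordan_rank s j.+1 + count (ltn j) s)%N.
Proof.
rewrite /jordan_rank; elim: s => [|x s IH]; first by rewrite !big_nil.
by rewrite !big_cons IH /=; case: (ltnP j x); lia.
Qed.

(** The first differences of the ranks count the parts larger than j, and the second differences
    count the parts of each positive size. *)
Lemma jordan_rank_inj s t : sorted geq s -> sorted geq t -> all (leq 1) s -> all (leq 1) t ->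
  jordan_rank s =1 jordan_rank t -> s = t.
Proof.
move=> ss st ps pt e.
have ec j : count (ltn j) s = count (ltn j) t.
  by have := e j; rewrite !(jordan_rankS _ j) (e j.+1) => /addnI.
have cm u x : (count (ltn x) u = count (ltn x.+1) u + count_mem x.+1 u)%N.
  by elim: u => [//|y u /= ->]; case: eqP; case: (ltnP x y); case: (ltnP x.+1 y) => /=; lia.
apply: (sorted_eq (leT := geq)) => //.
- by move=> a b c; rewrite /geq /=; lia.
- by move=> a b; rewrite /geq /=; lia.
rewrite /perm_eq; apply/allP => -[|x] _ /=; apply/eqP.
  have z u : all (leq 1) u -> count_mem 0%N u = 0%N.
    by elim: u => //= y u IH /andP[y0 /IH->]; rewrite addn0 eqn0Ngt y0.
  by rewrite !z.
by apply: (@addnI (count (ltn x.+1) s)); rewrite -cm (ec x.+1) -cm ec.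
Qed.

End Jordan.

(** * Parity, convexity and chain bounds for the ranks of powers *)

Section RankBounds.
Variable k : closedFieldType.

(** For a complement R of the kernel, R A R^T is an invertible skew matrix whose size p is the rank,
    and det M = (-1)^p det M forces p to be even. *)
Lemma mxrank_skew_even (char_k : 2%N \notin [pchar k]) n (A : 'M[k]_n) : A^T = - A -> ~~ odd (\rank A).
Proof.
move=> eA; have [p [R [L [RL KL _ fR]]]] := complement_coords (submx1 (kermx A)).
have KA : kermx A *m A = 0 by apply: mulmx_ker.
have inj0 x : (x : 'rV_p) *m (R *m A) = 0 -> x = 0.
  rewrite mulmxA => /sub_kermxP/submxP[D xR].
  by rewrite -[x]mulmx1 -RL mulmxA xR -mulmxA KL mulmx0.
have row_free_of m (Z : 'M[k]_(p, m)) : (forall x : 'rV_p, x *m Z = 0 -> x = 0) -> row_free Z.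
  move=> h; rewrite -kermx_eq0; apply/eqP/row_matrixP => i; rewrite row0; apply: h.
  by apply/sub_kermxP; rewrite row_sub.
have RAf := row_free_of _ _ inj0.
have -> : \rank A = p.
  rewrite -(eqP RAf); apply/eqP; rewrite eqn_leq mxrankM_maxr andbT.
  rewrite -{1}[A]mul1mx (leq_trans (mxrankS (submxMr A fR))) // addsmxMr KA.
  by rewrite mxrankS // addsmx_sub sub0mx submx_refl.
have e : (R *m A *m R^T)^T = - (R *m A *m R^T).
  by rewrite !trmx_mul trmxK eA mulNmx mulmxN mulmxA.
have u : R *m A *m R^T \in unitmx.
  rewrite -row_free_unit; apply: row_free_of => x; rewrite !mulmxA => xRAR; apply: inj0.
  rewrite mulmxA; have /submxP[D] : (1%:M <= col_mx (kermx A) R)%MS by rewrite -addsmxE.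
  move/(congr1 trmx); rewrite trmx1 trmx_mul tr_col_mx => e1.
  rewrite -[LHS]mulmx1 e1 mulmxA mul_mx_row xRAR -[x *m R *m A *m _]mulmxA.
  have -> : A *m (kermx A)^T = 0.
    by apply: trmx_inj; rewrite trmx_mul trmxK eA mulmxN KA oppr0 trmx0.
  by rewrite mulmx0 row_mx0 mul0mx.
apply/negP => op; move: u; rewrite unitmxE unitfE => /eqP; apply.
have := congr1 determinant e; rewrite det_tr -scaleN1r detZ -signr_odd op expr1 mulN1r.
move/eqP; rewrite -addr_eq0 -mulr2n -mulr_natl mulf_eq0 (negPf (two_neq0 char_k)) => /eqP; by [].
Qed.

Lemma form_skewX n o (B X : 'M[k]_n) j : eform o B -> form_skew B X ->
  (X ^+ j *m B)^T = (-1) ^+ (o + j) *: (X ^+ j *m B).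
Proof.
move=> [eB _] /eqP; rewrite addr_eq0 => /eqP sX.
have h : B *m (X ^+ j)^T = (-1) ^+ j *: (X ^+ j *m B).
  elim: j => [|j IH]; first by rewrite !expmx0 trmx1 mulmx1 mul1mx expr0 scale1r.
  rewrite {1}expmxS trmx_mul mulmxA IH -scalemxAl -mulmxA.
  have -> : B *m X^T = - (X *m B) by rewrite sX opprK.
  by rewrite mulmxN mulmxA -expmxSr [(-1) ^+ j.+1]exprS mulN1r scalerN scaleNr.
rewrite trmx_mul eB -scalemxAl h scalerA -exprD; by [].
Qed.

Lemma form_skew_rank_even (char_k : 2%N \notin [pchar k]) n o (B X : 'M[k]_n) j : eform o B ->
  form_skew B X -> odd j != o -> ~~ odd (\rank (X ^+ j)).
Proof.
move=> eB sX ho; have [_ Bu] := eB.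
have <- : \rank (X ^+ j *m B) = \rank (X ^+ j) by rewrite mxrankMfree ?row_free_unit.
apply: (mxrank_skew_even char_k); rewrite (form_skewX j eB sX) -signr_odd oddD oddb.
by case: o (odd j) ho {eB sX} => -[] //= _; rewrite scaleN1r.
Qed.

Lemma mxrank_convex n (X : 'M[k]_n) j :
  (2 * \rank (X ^+ j.+1) <= \rank (X ^+ j) + \rank (X ^+ j.+2))%N.
Proof.
have := mxrank_Frobenius X (X ^+ j) X; rewrite -expmxS -!expmxSr.
by rewrite addnn mul2n.
Qed.

(** With columns of lengths d 0, ..., d (i - 1), this is the length of row t, counted from 0: the
    conjugate partition, without any order on the columns. *)
Definition row_length (d : nat -> nat) (i t : nat) : nat := (\sum_(j < i) (t < d j))%N.

Lemma row_lengthS d i t : row_length d i.+1 t = (row_length d i t + (t < d i))%N.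
Proof. by rewrite /row_length big_ord_recr. Qed.

Lemma row_length_mono d i t t' : (t <= t')%N -> (row_length d i t' <= row_length d i t)%N.
Proof.
move=> tt'; apply: leq_sum => j _; case: ltnP => // h.
by rewrite (leq_ltn_trans tt' h).
Qed.

Lemma sum_lt T d : (d <= T)%N -> (\sum_(t < T) (t < d : nat) = d)%N.
Proof.
move=> dT; rewrite -(big_mkord predT (fun t => (t < d : nat))) (big_cat_nat _ (n := d)) //=.
rewrite [X in (X + _)%N]big_nat (eq_bigr (fun=> 1%N)) => [|i /andP[_ ->]//].
rewrite -big_nat sum_nat_const_nat muln1 subn0 [X in (_ + X)%N]big_nat big1 ?addn0 //.
by move=> i /andP[di _]; rewrite ltnNge di.
Qed.

(** Induction on s. If the first d_s rows of the shorter chain all have length at least j, the last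
    step adds at most d_s to the rank. Otherwise E_{s+1} X^j is contained in E_s X^(j-1): rows that
    grow keep their contribution when j drops to j - 1, and the remaining rows are shorter than j
    and contribute nothing. *)
Lemma chain_rank_bound n s (E : nat -> 'M[k]_n) X T j : (n <= T)%N -> E 0%N = 0 ->
  (forall i, (i < s)%N -> (E i <= E i.+1)%MS) ->
  (forall i, (i < s)%N -> (E i.+1 *m X <= E i)%MS) ->
  (\rank (E s *m X ^+ j) <=
     \sum_(t < T) (row_length (fun i => \rank (E i.+1) - \rank (E i)) s t - j))%N.
Proof.
set d := (fun i => \rank (E i.+1) - \rank (E i))%N => nT E0; elim: s j => [|s IH] j mE EX.
  by rewrite E0 mul0mx mxrank0.
have {}IH j' : (\rank (E s *m X ^+ j') <= \sum_(t < T) (row_length d s t - j'))%N.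
  by apply: IH => i is_; [apply/mE/leqW|apply/EX/leqW].
have dT : (d s <= T)%N by rewrite /d (leq_trans (leq_subr _ _)) // (leq_trans (rank_leq_row _)).
have [/forallP h|] := boolP [forall t : 'I_(d s), j <= row_length d s t]%N.
  have -> : (\sum_(t < T) (row_length d s.+1 t - j) =
      \sum_(t < T) (row_length d s t - j) + d s)%N.
    rewrite -[X in (_ + X)%N](sum_lt dT) -big_split /=; apply: eq_bigr => t _; rewrite row_lengthS.
    case: (ltnP t (d s)) => [td|]; last by rewrite !addn0.
    by have /= := h (Ordinal td); lia.
  apply: leq_trans (leq_add (IH j) (leqnn _)).
  have e := addsmx_diff_cap_eq (E s.+1) (E s).
  rewrite -(eqmxMr (X ^+ j) e) addsmxMr (leq_trans (mxrank_adds_leqif _ _)) // addnC leq_add //.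
    by rewrite mxrankS // submxMr // capmxSr.
  rewrite (leq_trans (mxrankM_maxl _ _)) //.
  by have := mxrank_cap_compl (E s.+1) (E s); rewrite (capmx_idPr (mE s (ltnSn s))) /d; lia.
rewrite negb_forall => /existsP[t0]; rewrite -ltnNge; case: j => // j mj.
rewrite expmxS mulmxA (leq_trans (mxrankS (submxMr _ (EX s (ltnSn s))))) //.
apply: leq_trans (IH j) _; apply: leq_sum => t _; rewrite row_lengthS.
case: (ltnP t (d s)) => [_|dt]; first by lia.
have /(row_length_mono d s) : (t0 <= t)%N by have := ltn_ord t0; lia.
by lia.
Qed.

End RankBounds.

(** * Models of large rank *)

Section Models.
Variables (k : closedFieldType).

(** Only one power is controlled, so the model may change with j; [generic_rank] merges the models
    later. The flag enters through its dimensions alone, since these determine it up to isometry. *)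
Definition flag_model (o : bool) r j n (dims : nat -> nat) R : Prop :=
  exists (B X : 'M[k]_n) (E : nat -> 'M[k]_n),
    [/\ eform o B, sdflag B r E, forall i, (i <= r.*2.+1)%N -> \rank (E i) = dims i,
        flagu B r E X & (R <= \rank (X ^+ j))%N].

Lemma flag_model_add o r j n1 n2 c1 c2 R1 R2 :
  flag_model o r j n1 c1 R1 -> flag_model o r j n2 c2 R2 ->
  flag_model o r j (n1 + n2) (fun i => c1 i + c2 i)%N (R1 + R2).
Proof.
move=> [B1 [X1 [E1 [[eB1 u1] [E10 m1 i1 r1] d1 [s1 x1] h1]]]].
move=> [B2 [X2 [E2 [[eB2 u2] [E20 m2 i2 r2] d2 [s2 x2] h2]]]].
exists (block_mx B1 0 0 B2), (block_mx X1 0 0 X2), (fun i => block_mx (E1 i) 0 0 (E2 i)).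
have sub n n' (A1 C1 : 'M[k]_n) (A2 C2 : 'M[k]_n') : (A1 <= C1)%MS -> (A2 <= C2)%MS ->
    (block_mx A1 0 0 A2 <= block_mx C1 0 0 C2)%MS.
  move=> /submxP[D1 ->] /submxP[D2 ->]; apply/submxP; exists (block_mx D1 0 0 D2).
  by rewrite mulmx_block !(mulmx0, mul0mx, addr0, add0r).
split.
- split; first by rewrite tr_block_mx !trmx0 eB1 eB2 scale_block_mx !scaler0.
  by rewrite unitmxE det_ublock unitrM -!unitmxE u1.
- split=> [|i is_|i is_|i is_].
  + by rewrite E10 E20 block_mx_const.
  + by apply: sub; auto.
  + by rewrite tr_block_mx !trmx0 !mulmx_block !(mulmx0, mul0mx, addr0, add0r) i1 // i2 // block_mx_const.
  by rewrite !rank_diag_block_mx addnACA r1 // r2.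
- by move=> i is_; rewrite rank_diag_block_mx d1 // d2.
- split=> [|i is_].
    by rewrite /form_skew tr_block_mx !trmx0 !mulmx_block !(mulmx0, mul0mx, addr0, add0r)
      add_block_mx !addr0 s1 s2 block_mx_const.
  by rewrite mulmx_block !(mulmx0, mul0mx, addr0, add0r); apply: sub; auto.
by rewrite expmx_block rank_diag_block_mx leq_add.
Qed.

(** The antidiagonal form with alternating signs, for which a full Jordan block is skew; it is
    symmetric for odd n and alternating for even n. *)
Definition chain_form n : 'M[k]_n := \matrix_(i, l) ((-1) ^+ i *+ (i + l == n.-1)%N).

(** Its row space is spanned by the last c basis vectors: the c-dimensional subspace stable under
    the shift. *)
Definition last_mx n (c : nat) : 'M[k]_n := diag_mx (\row_l (n - c <= l)%N%:R).

Lemma last_mxE n c i l : last_mx n c i l = ((i == l) && (n - c <= i)%N)%:R.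
Proof.
rewrite !mxE; case: eqP => [->|_]; last by rewrite mulr0n.
by rewrite mulr1n.
Qed.

Lemma sub_last_mx n m c (A : 'M[k]_(m, n)) :
  (forall i (l : 'I_n), (l < n - c)%N -> A i l = 0) -> (A <= last_mx n c)%MS.
Proof.
move=> h; apply/submxP; exists A; rewrite mul_mx_diag; apply/matrixP => i l; rewrite !mxE.
by case: leqP => [_|/h->]; rewrite ?mulr1 ?mul0r.
Qed.

Lemma mxrank_last_mx n c : (c <= n)%N -> \rank (last_mx n c) = c.
Proof.
move=> cn; have -> : last_mx n c = copid_mx (n - c).
  apply/matrixP => i l; rewrite last_mxE !mxE -val_eqE.
  by case: eqP => _ /=; rewrite ?subr0 // leqNgt; case: ltnP => _; rewrite /= ?subrr ?subr0.
by rewrite rank_copid_mx ?leq_subr // subKn.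
Qed.

Lemma chain_formT n : (chain_form n)^T = (-1) ^+ n.-1 *: chain_form n.
Proof.
apply/matrixP => i l; rewrite !mxE addnC; case: eqP => [e|]; last by rewrite !mulr0n mulr0.
rewrite !mulr1n -e exprD mulrAC -expr2 sqrr_sign mul1r; by [].
Qed.

Lemma chain_form_sq n : chain_form n *m chain_form n = (-1) ^+ n.-1 *: 1%:M.
Proof.
apply/matrixP => i l; rewrite !mxE.
have lt : (n.-1 - i < n)%N by have := ltn_ord i; lia.
rewrite (bigD1 (Ordinal lt)) //= big1 => [|j ji]; rewrite !mxE /=.
  have -> : (i + (n.-1 - i) == n.-1)%N by apply/eqP; have := ltn_ord i; lia.
  have -> : (n.-1 - i + l == n.-1)%N = (i == l).
    apply/eqP/eqP => [|->]; last by have := ltn_ord l; lia.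
    by move=> h; apply: val_inj => /=; have := ltn_ord i; have := ltn_ord l; lia.
  rewrite addr0 mulr1n mulrnAr -exprD subnKC ?mulr_natr //; have := ltn_ord i; lia.
case: eqP => [e|]; last by rewrite mulr0n mul0r.
by case/eqP: ji; apply: val_inj => /=; lia.
Qed.

Lemma chain_form_unit n : chain_form n \in unitmx.
Proof.
have h : chain_form n *m ((-1) ^+ n.-1 *: chain_form n) = 1%:M.
  by rewrite -scalemxAr chain_form_sq scalerA -expr2 sqrr_sign scale1r.
by case: (mulmx1_unit h).
Qed.

Lemma chain_form_skew n : shift_mx k n *m chain_form n + chain_form n *m (shift_mx k n)^T = 0.
Proof.
apply/matrixP => i l; rewrite [LHS]mxE [RHS]mxE shift_mx_mul.
have -> : (chain_form n *m (shift_mx k n)^T) i l = (-1) ^+ i *+ (i + l.+1 == n.-1)%N.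
  have -> : (chain_form n *m (shift_mx k n)^T) i l = (shift_mx k n *m (chain_form n)^T) l i.
    by rewrite -[shift_mx k n *m _]trmxK trmx_mul trmxK [RHS]mxE.
  rewrite shift_mx_mul; case: insubP => [j _ e|nl]; first by rewrite !mxE e.
  case: eqP => // e; have := ltn_ord i; have := ltn_ord l; lia.
case: insubP => [j _ e|ni]; rewrite ?mxE ?e.
  by rewrite addSnnS; case: eqP => _; rewrite ?exprS ?mulN1r ?mulr1n ?addNr // !mulr0n addr0.
by case: eqP => [e|_]; rewrite ?addr0 //; have := ltn_ord i; have := ltn_ord l; lia.
Qed.

Lemma last_mx_isotropic n c c' : (c + c' <= n)%N ->
  last_mx n c *m chain_form n *m (last_mx n c')^T = 0.
Proof.
move=> cc; rewrite mul_diag_mx tr_diag_mx mul_mx_diag; apply/matrixP => i l; rewrite !mxE.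
case: leqP => ci; last by rewrite !mul0r.
case: leqP => cl; last by rewrite mulr0.
case: eqP => e; last by rewrite mulr0n mulr0 mul0r.
have := ltn_ord i; have := ltn_ord l; lia.
Qed.

Lemma last_mx_mono n c c' : (c <= c')%N -> (last_mx n c <= last_mx n c')%MS.
Proof.
move=> cc; apply: sub_last_mx => i l ln; rewrite last_mxE; case: eqP => //= e.
by rewrite -e in ln; case: leqP => //; lia.
Qed.

Lemma last_mx_shift n c c' : (c' <= c.+1)%N -> (last_mx n c' *m shift_mx k n <= last_mx n c)%MS.
Proof.
move=> cc; apply: sub_last_mx => i l ln; rewrite mul_diag_mx !mxE.
by case: leqP => ci; rewrite ?mul0r // mul1r; case: eqP => // e; lia.
Qed.

Definition dims_ok r n (c : nat -> nat) :=
  [/\ c 0%N = 0%N, forall i, (i < r.*2.+1)%N -> (c i <= c i.+1 <= (c i).+1)%N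
    & forall i, (i <= r.*2.+1)%N -> (c i + c (r.*2.+1 - i) = n)%N].

Lemma flag_model_chain o r j n c : odd n = ~~ o -> dims_ok r n c ->
  flag_model o r j n c (n - j).
Proof.
move=> on [c0 cm cs]; exists (chain_form n), (shift_mx k n), (fun i => last_mx n (c i)).
have cn i : (i <= r.*2.+1)%N -> (c i <= n)%N by move/cs; lia.
split; last by rewrite mxrank_shiftX.
- split; last exact: chain_form_unit.
  rewrite chain_formT; case: n on {cs cn} => [|n] /=; first by move=> _; apply/matrixP => -[].
  by move=> /negb_inj <-; rewrite signr_odd.
- split=> [|i is_|i is_|i is_].
  + rewrite c0; apply/matrixP => i l; rewrite last_mxE subn0 mxE leqNgt ltn_ord andbF; by [].
  + by apply: last_mx_mono; case/andP: (cm i is_).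
  + by apply: last_mx_isotropic; rewrite cs.
  by rewrite !mxrank_last_mx ?cs ?cn ?leq_subr.
- by move=> i is_; rewrite mxrank_last_mx ?cn.
split=> [|i is_]; first exact: chain_form_skew.
by apply: last_mx_shift; case/andP: (cm i is_).
Qed.

Definition double_ok r n (c1 c2 : nat -> nat) :=
  [/\ c1 0%N = 0%N, c2 0%N = 0%N,
      forall i, (i < r.*2.+1)%N -> (c1 i <= c1 i.+1)%N /\ (c2 i <= c2 i.+1)%N
    & forall i, (i <= r.*2.+1)%N -> (c1 i + c2 (r.*2.+1 - i) = n)%N].

(** Two isotropic subspaces of dimension n in duality, each carrying one Jordan block, or X = 0 if z
    is false. The dimensions c1 and c2 of the two halves of the flag are dual to each other. With z
    false the steps may be arbitrarily large, so these models fill up dimensions that contribute no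
    rank. *)
Lemma flag_model_double (z : bool) o r j n c1 c2 : double_ok r n c1 c2 ->
  (z -> forall i, (i < r.*2.+1)%N -> (c1 i.+1 <= (c1 i).+1)%N /\ (c2 i.+1 <= (c2 i).+1)%N) ->
  flag_model o r j (n + n) (fun i => c1 i + c2 i)%N (if z then (n - j) + (n - j) else 0)%N.
Proof.
move=> [c10 c20 cm cs] cz.
have cs' i : (i <= r.*2.+1)%N -> (c2 i + c1 (r.*2.+1 - i) = n)%N.
  by move=> is_; have := cs (r.*2.+1 - i)%N (leq_subr _ _); rewrite subKn //; lia.
have cn1 i : (i <= r.*2.+1)%N -> (c1 i <= n)%N by move/cs; lia.
have cn2 i : (i <= r.*2.+1)%N -> (c2 i <= n)%N by move/cs'; lia.
pose D := chain_form n; pose e : k := (-1) ^+ o; pose S := (z%:R : k) *: shift_mx k n.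
have ee : e * e = 1 by rewrite -expr2 sqrr_sign.
have DT : D^T = (-1) ^+ n.-1 *: D by apply: chain_formT.
have sD : S *m D + D *m S^T = 0.
  by rewrite /S linearZ -scalemxAl /= -scalemxAr -scalerDr chain_form_skew scaler0.
have sDT : S *m D^T + D^T *m S^T = 0.
  by rewrite DT -(scalemxAr _ S) -(scalemxAl _ D) -scalerDr sD scaler0.
have iso c c' : (c + c' <= n)%N -> last_mx n c *m D^T *m (last_mx n c')^T = 0.
  by move=> cc; rewrite DT -scalemxAr -scalemxAl last_mx_isotropic // scaler0.
have sub (A1 C1 A2 C2 : 'M[k]_n) : (A1 <= C1)%MS -> (A2 <= C2)%MS ->
    (block_mx A1 0 0 A2 <= block_mx C1 0 0 C2)%MS.
  move=> /submxP[D1 ->] /submxP[D2 ->]; apply/submxP; exists (block_mx D1 0 0 D2).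
  by rewrite mulmx_block !(mulmx0, mul0mx, addr0, add0r).
exists (block_mx 0 D (e *: D^T) 0), (block_mx S 0 0 S),
  (fun i => block_mx (last_mx n (c1 i)) 0 0 (last_mx n (c2 i))).
have last0 : last_mx n 0 = 0.
  by apply/matrixP => i l; rewrite last_mxE subn0 mxE leqNgt ltn_ord andbF.
have Du : D \in unitmx by apply: chain_form_unit.
split.
- split; first by rewrite tr_block_mx !trmx0 linearZ /= trmxK scale_block_mx !scaler0 scalerA ee scale1r.
  have h : block_mx 0 D (e *: D^T) 0 *m block_mx 0 (e *: invmx D^T) (invmx D) 0 = 1%:M.
    rewrite mulmx_block !(mulmx0, mul0mx, addr0, add0r) mulmxV // -scalemxAl -scalemxAr.
    by rewrite mulmxV ?unitmx_tr // scalerA ee scale1r -scalar_mx_block.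
  by case: (mulmx1_unit h).
- split=> [|i is_|i is_|i is_].
  + by rewrite c10 c20 last0 block_mx_const.
  + by apply: sub; apply: last_mx_mono; case: (cm i is_).
  + rewrite tr_block_mx !trmx0 !mulmx_block !(mulmx0, mul0mx, addr0, add0r).
    rewrite last_mx_isotropic ?cs // -scalemxAr -scalemxAl iso ?cs' // scaler0.
    exact: block_mx_const.
  rewrite !rank_diag_block_mx !mxrank_last_mx ?cn1 ?cn2 ?leq_subr //.
  by have := cs i is_; have := cs' i is_; lia.
- by move=> i is_; rewrite rank_diag_block_mx !mxrank_last_mx ?cn1 ?cn2.
- split=> [|i is_].
    rewrite /form_skew tr_block_mx !trmx0 !mulmx_block !(mulmx0, mul0mx, addr0, add0r).
    rewrite add_block_mx !addr0 sD -scalemxAr -scalemxAl -scalerDr sDT scaler0.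
    exact: block_mx_const.
  rewrite mulmx_block !(mulmx0, mul0mx, addr0, add0r) /S -!scalemxAr.
  case: z cz {S sD sDT} => cz; last by rewrite !scale0r block_mx_const sub0mx.
  by rewrite !scale1r; apply: sub; apply: last_mx_shift; case: (cz isT i is_).
rewrite expmx_block rank_diag_block_mx /S; case: z {cz S sD sDT} => //.
by rewrite scale1r !mxrank_shiftX.
Qed.

End Models.

Section PairModels.
Variables (k : closedFieldType).

Lemma dims_ok_le r n m i i' : dims_ok r n m -> (i <= i' <= r.*2.+1)%N -> (m i <= m i')%N.
Proof.
move=> [_ mm _] /andP[]; elim: i' => [|i' IH]; first by rewrite leqn0 => /eqP->.
rewrite leq_eqVlt => /orP[/eqP-> //|] h1 h2.
by apply: leq_trans (IH h1 (ltnW h2)) _; case/andP: (mm i' h2).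
Qed.

(** If y1 and y2 in C are independent modulo A and y2 is not isotropic, the form on y1 + t y2 is
    quadratic in t and has a root. *)
Lemma isotropic_between n (B A C : 'M[k]_n) : (\rank A + 2 <= \rank C)%N ->
  exists w : 'rV_n, [/\ (w <= C)%MS, ~~ (w <= A)%MS & w *m B *m w^T = 0].
Proof.
move=> rAC.
have [i y1A] : exists i, ~~ (row i C <= A)%MS.
  by apply/row_subPn; apply/negP => /mxrankS; lia.
set y1 := row i C in y1A.
have [j y2A] : exists j, ~~ (row j C <= A + y1)%MS.
  apply/row_subPn; apply/negP => /mxrankS.
  have := (mxrank_adds_leqif A y1).1; have := rank_leq_row y1; lia.
set y2 := row j C in y2A.
have y1C : (y1 <= C)%MS by apply: row_sub.
have y2C : (y2 <= C)%MS by apply: row_sub.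
have [e|ne] := eqVneq (bform B y2 y2) 0.
  exists y2; split=> //; last by rewrite bformE e; apply: raddf0.
  by apply: contra y2A => h; rewrite (submx_trans h) // addsmxSl.
have [|t et] := @quadratic_root _ (bform B y2 y2) (bform B y1 y2 + bform B y2 y1) (bform B y1 y1).
  by rewrite ne.
exists (y1 + t *: y2); split.
- by rewrite addmx_sub // scalemx_sub.
- apply/negP => h; have [t0|t0] := eqVneq t 0.
    by case/negP: y1A; rewrite t0 scale0r addr0 in h.
  case/negP: y2A; have -> : y2 = t^-1 *: ((y1 + t *: y2) - y1).
    by rewrite addrC addKr scalerA mulVf // scale1r.
  rewrite scalemx_sub // addmx_sub ?(submx_trans h) ?addsmxSl //.
  by rewrite -eqmx_opp opprK addsmxSr.
rewrite bformE -(raddf0 (@scalar_mx k 1)); congr _%:M.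
by rewrite !(bformDl, bformDr, bformZl, bformZr) -[RHS]et; ring.
Qed.

(** A flag built from blocks of sizes 2n - 1 and 1 jumps from dimension n - 1 to n + 1 in the
    middle. Any G between F_r and F_{r+1} satisfies G X <= F_r <= G, because F_{r+1} X <= F_r;
    adding an isotropic line to F_r therefore supplies the missing member of dimension n without
    changing X. *)
Lemma flag_model_refine r j n R m cc : (0 < n)%N ->
  flag_model k false r j (n + n) cc R -> dims_ok r (n + n) m -> m r = n ->
  (forall i, (i <= r.*2.+1)%N ->
     cc i = if (i <= r)%N then minn (m i) n.-1 else maxn (m i) n.+1) ->
  flag_model k false r j (n + n) m R.
Proof.
move=> n0 [B [X [F [eB fF dF [sX FX] rX]]]] mok mr ecc.
have [m0 mm ms] := mok; have [F0 FF iF rF] := fF.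
set s := r.*2.+1 in m0 mm ms dF FX F0 FF iF rF ecc mok *.
have rs : (r <= s)%N by lia.
have r1s : (r.+1 <= s)%N by lia.
have mr1 : m r.+1 = n by have := ms r rs; rewrite (_ : s - r = r.+1)%N; lia.
have rFr : \rank (F r) = n.-1 by rewrite dF // ecc // leqnn mr; lia.
have rFr1 : \rank (F r.+1) = n.+1 by rewrite dF // ecc // ltnn mr1; lia.
have [w [wF wFr ww]] : exists w : 'rV_(n + n), [/\ (w <= F r.+1)%MS, ~~ (w <= F r)%MS & w *m B *m w^T = 0].
  by apply: isotropic_between; rewrite rFr rFr1; lia.
pose G := (F r + w)%MS.
have FrG : (F r <= G)%MS by apply: addsmxSl.
have GFr1 : (G <= F r.+1)%MS by rewrite addsmx_sub wF FF //; lia.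
have rG : \rank G = n.
  apply/eqP; rewrite eqn_leq; apply/andP; split.
    have := (mxrank_adds_leqif (F r) w).1; have := rank_leq_row w; rewrite -/G rFr; lia.
  have : (F r < G)%MS by rewrite /ltmx FrG addsmx_sub (negPf wFr) andbF.
  by move/rank_ltmx; rewrite rFr; lia.
have GX : (G *m X <= F r)%MS.
  by apply: submx_trans (submxMr _ GFr1) _; apply: FX; lia.
have GG : G *m B *m G^T = 0.
  have e : (G <= col_mx (F r) w)%MS by rewrite /G addsmxE submx_refl.
  apply: (isotropic_sub e e); rewrite tr_col_mx mul_col_mx mul_col_row ww.
  have h1 : F r *m B *m (F r)^T = 0 by apply: (sdflag_iso fF _ (submx_refl _) (submx_refl _)); lia.
  have h2 : F r *m B *m w^T = 0 by apply: (sdflag_iso fF _ (submx_refl _) wF); lia.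
  rewrite h1 h2 (eform_sym0 eB h2); exact: block_mx_const.
have le i i' : (i <= i' <= s)%N -> (m i <= m i')%N := dims_ok_le mok.
have mono := sdflag_mono fF.
pose E i := if m i == n then G else F i.
have Fle i : (i <= s)%N -> (m i < n)%N -> (i <= r)%N.
  by move=> is_; apply: contraTT; rewrite -!ltnNge => ri; have := le r.+1 i; lia.
have Fge i : (n < m i)%N -> (r < i)%N.
  by apply: contraTT; rewrite -!leqNgt => ri; have := le i r; lia.
have eqF i : (i <= s)%N -> m i = n.-1 -> (F r <= F i)%MS.
  move=> is_ mi; have ir : (i <= r)%N by apply: Fle; lia.
  have h := mono i r ir rs; rewrite -(geq_leqif (mxrank_leqif_sup h)) rFr dF // ecc // ir; lia.
have eqF1 i : (i <= s)%N -> m i = n.+1 -> (F i <= F r.+1)%MS.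
  move=> is_ mi; have ir : (r < i)%N by apply: Fge; lia.
  have h := mono r.+1 i ir is_; rewrite -(geq_leqif (mxrank_leqif_sup h)) rFr1 dF // ecc //.
  rewrite (ltn_geF ir); lia.
exists B, X, E; split=> //.
- rewrite /E; split=> [|i is_|i is_|i is_].
  + by rewrite m0 eq_sym eqn0Ngt n0 F0.
  + have /andP[m1 m2] := mm i is_.
    case: (eqVneq (m i) n) => [e|ne]; case: (eqVneq (m i.+1) n) => [e'|ne'] //.
    * rewrite (submx_trans GFr1) // mono //; apply: Fge; lia.
    * rewrite (submx_trans _ FrG) // mono // Fle //; lia.
    * exact: FF.
  + have := ms i is_; case: (eqVneq (m i) n) => [->|ne] e.
      have -> : m (s - i)%N = n by lia.
      by rewrite eqxx GG.
    have /negPf -> : m (s - i)%N != n by lia.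
    exact: iF.
  + have := ms i is_; case: (eqVneq (m i) n) => [->|ne] e.
      have -> : m (s - i)%N = n by lia.
      by rewrite eqxx rG.
    have /negPf -> : m (s - i)%N != n by lia.
    exact: rF.
- move=> i is_; rewrite /E; case: (eqVneq (m i) n) => [->|ne] //.
  rewrite dF // ecc //; case: leqP => ir; first by have := le i r; lia.
  by have := le r.+1 i; lia.
split=> // i is_; have /andP[m1 m2] := mm i is_; rewrite /E.
case: (eqVneq (m i) n) => [e|ne]; case: (eqVneq (m i.+1) n) => [e'|ne'].
- exact: submx_trans GX FrG.
- apply: submx_trans FrG; apply: submx_trans (submxMr _ (eqF1 _ _ _)) (FX r _) => //; lia.
- by apply: submx_trans GX (eqF i _ _); lia.
exact: FX.
Qed.

Lemma flag_model_ext o r j n n' c c' R R' : n = n' -> R = R' ->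
  (forall i, (i <= r.*2.+1)%N -> c i = c' i) ->
  flag_model k o r j n c R -> flag_model k o r j n' c' R'.
Proof.
move=> <- <- cc [B [X [F [eB fF dF uX rX]]]]; exists B, X, F; split=> // i is_.
by rewrite dF // cc.
Qed.

(** Rows a and b have the parity that a single block of type o cannot have. For j <= b, two dual
    blocks of size (a + b) / 2 reach the bound. For j > b only the longer row matters: a block of
    size a - 1 is taken, and X is 0 on the remaining dimensions. *)
Lemma flag_model_pair (o : bool) r j a b c c' : dims_ok r a c -> dims_ok r b c' ->
  a = ((c r).*2 + o)%N -> b = ((c' r).*2 + o)%N -> (b <= a)%N ->
  flag_model k o r j (a + b) (fun i => c i + c' i)%N
    (if (j <= b)%N then a + b - j.*2 else a.-1 - j)%N.
Proof.
move=> cok cok' ea eb ba; have o1 : (o <= 1)%N by case: (o).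
have [c0 cm cs] := cok; have [c0' cm' cs'] := cok'.
have le i i' : (i <= i' <= r.*2.+1)%N -> (c i <= c i')%N := dims_ok_le cok.
have le' i i' : (i <= i' <= r.*2.+1)%N -> (c' i <= c' i')%N := dims_ok_le cok'.
have cr1 : c r.+1 = (c r + o)%N.
  by have := cs r; rewrite (_ : r.*2.+1 - r = r.+1)%N; lia.
have cr1' : c' r.+1 = (c' r + o)%N.
  by have := cs' r; rewrite (_ : r.*2.+1 - r = r.+1)%N; lia.
(* In the symplectic case this filler has dimension b + 1 and makes up for the block of size a - 1;
   in the orthogonal case it has dimension b. *)
have zero : flag_model k o r j (c' r + o + (c' r + o))
    (fun i => (if (i <= r)%N then 0 else c' i - c' r) + (if (i <= r)%N then c' i else c' r + o))%N 0.
  apply: (@flag_model_double k false) => //; split=> [||i is_|i is_].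
  - by rewrite leq0n.
  - by rewrite leq0n.
  - have := cm' i is_; case: (ltngtP i r) => [ir|ri|->].
    + lia.
    + have := le' r i; have := le' r i.+1; lia.
    by lia.
  have := cs' i is_; case: (leqP i r) => ir.
    have -> : (r.*2.+1 - i <= r)%N = false by lia.
    by lia.
  have -> : (r.*2.+1 - i <= r)%N by lia.
  have := le' r i; lia.
have [jb|bj] := leqP j b.
  (* The lower half of each dimension function is continued by the upper half of the other one,
     shifted to agree at r; this makes the two functions dual. *)
  pose c1 i := if (i <= r)%N then c' i else (c i - (c r - c' r))%N.
  pose c2 i := if (i <= r)%N then c i else (c' i + (c r - c' r))%N.
  have ok : double_ok r (c r + c' r + o) c1 c2.
    rewrite /c1 /c2; split=> [||i is_|i is_].
    - by rewrite leq0n.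
    - by rewrite leq0n.
    - have := cm' i is_; have := cm i is_; case: (ltngtP i r) => [ir|ri|->]; lia.
    have := cs' i is_; have := cs i is_; case: (leqP i r) => ir.
      have -> : (r.*2.+1 - i <= r)%N = false by lia.
      by lia.
    have -> : (r.*2.+1 - i <= r)%N by lia.
    have := le r i; lia.
  have inc i : (i < r.*2.+1)%N -> (c1 i.+1 <= (c1 i).+1)%N /\ (c2 i.+1 <= (c2 i).+1)%N.
    move=> is_; rewrite /c1 /c2; have := cm' i is_; have := cm i is_.
    case: (ltngtP i r) => [ir|ri|->]; first by lia.
      by have := le r i; lia.
    by lia.
  apply: flag_model_ext (@flag_model_double k true o r j _ c1 c2 ok (fun _ => inc)); [lia|lia|].
  move=> i is_; rewrite /c1 /c2; case: leqP => ir; first by rewrite addnC.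
  have := le r.+1 i; lia.
case: o {o1} ea eb cr1 cr1' zero => /= ea eb cr1 cr1' zero.
  have ok : dims_ok r (c r).*2 (fun i => c i - (r < i))%N.
    split=> [|i is_|i is_]; first by rewrite c0.
      by have := cm i is_; have := le r.+1 i; case: (ltngtP i r) => [ir|ri|->]; lia.
    have := cs i is_; case: (leqP i r) => ir.
      have -> : (r < r.*2.+1 - i)%N by lia.
      have := le r.+1 (r.*2.+1 - i)%N; lia.
    have -> : (r < r.*2.+1 - i)%N = false by lia.
    have := le r.+1 i; lia.
  have odd0 : odd (c r).*2 = ~~ true by rewrite odd_double.
  have := flag_model_add (@flag_model_chain k true r j _ _ odd0 ok) zero.
  apply: flag_model_ext; [lia|lia|] => i is_ /=; case: (leqP i r) => ir; first by lia.
  have := le r.+1 i; have := le' r.+1 i; lia.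
have [n0|n0] := posnP (c r).
  apply: flag_model_ext zero; [lia|lia|] => i is_.
  by have := cs i is_; have := cs' i is_; case: (leqP i r) => ir; lia.
pose c1 i := if (i <= r)%N then minn (c i) (c r).-1 else maxn (c i).-1 (c r).
have ok : dims_ok r (c r).*2.-1 c1.
  rewrite /c1; split=> [|i is_|i is_]; first by rewrite leq0n c0 min0n.
    by have := cm i is_; case: (ltngtP i r) => [ir|ri|->]; lia.
  have := cs i is_; case: (leqP i r) => ir.
    have -> : (r.*2.+1 - i <= r)%N = false by lia.
    by have := le i r; lia.
  have -> : (r.*2.+1 - i <= r)%N by lia.
  by have := le r i; lia.
have ok1 : dims_ok r 1 (fun i => (r < i)%N : nat).
  split=> // i is_; first by case: (ltngtP i r) => [ir|ri|->]; lia.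
  by case: (leqP i r) => ir; lia.
have odd1 : odd (c r).*2.-1 = ~~ false by rewrite -subn1 oddB ?odd_double //; lia.
have m1 := flag_model_add (@flag_model_chain k false r j _ _ odd1 ok)
                          (@flag_model_chain k false r j 1 _ (erefl _) ok1).
have ok' : dims_ok r (c r + c r) c by move: cok; rewrite ea addnn addn0.
have m2 : flag_model k false r j (c r + c r) c (a.-1 - j).
  apply: (flag_model_refine n0 _ ok' (erefl _) (cc := fun i => (c1 i + (r < i))%N)).
    by apply: flag_model_ext m1 => //; lia.
  move=> i is_; rewrite /c1; case: (leqP i r) => ir; first by lia.
  have := le r i; lia.
have := flag_model_add m2 zero; apply: flag_model_ext; [lia|lia|] => i is_.
by case: (leqP i r) => ir; have := le' r i; lia.
Qed.

End PairModels.

(** * The Richardson type of a flag *)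

Section Collapse.
Local Open Scope nat_scope.

(* The collapse to an orthogonal (o = false) or symplectic (o = true) partition of the
   partition with rows mu, whose first q rows are odd and whose other rows are even. *)
Definition collapse (o : bool) (q : nat) (mu : nat -> nat) (t : nat) : nat :=
  if (t < q) != o then mu t
  else if odd (t - (if o then 0 else q)) then
    (if mu t.-1 == mu t then mu t else (mu t).+1)
  else (if mu t == mu t.+1 then mu t else (mu t).-1).

(* (true, t) stands for the pair of rows t, t+1 and (false, t) for the single row t; the
   collapse preserves the sum over each block of a suitable list. *)
Definition block_val (f : nat -> nat) (x : bool * nat) : nat :=
  if x.1 then f x.2 + f x.2.+1 else f x.2.

Definition block_ok (o : bool) (q : nat) (x : bool * nat) : bool :=
  if x.1 then [&& (x.2 < q) == o, (x.2.+1 < q) == o & ~~ odd (x.2 - (if o then 0 else q))]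
             && (o || (q <= x.2))
  else (x.2 < q) != o.

Lemma sum_pairs (f : nat -> nat) b K :
  \sum_(b <= t < b + K.*2) f t = \sum_(x <- [seq (true, b + i.*2) | i <- iota 0 K]) block_val f x.
Proof.
elim: K => [|K IH]; first by rewrite addn0 big_geq ?big_nil.
rewrite doubleS !addnS !big_nat_recr ?leqW ?leq_addr // -[K.+1]addn1 iotaD map_cat big_cat.
by rewrite /= big_seq1 IH /block_val /= add0n addnA.
Qed.

(** Rows whose parity suits the form stand alone, the others are paired: for o = true the odd rows,
    which are the first q and so must be even in number; for o = false the even rows from q on,
    where zero rows may complete the last pair. *)
Lemma blocks_exist (o : bool) q T0 : (o -> ~~ odd q) -> exists T L,
  [/\ T0 <= T, forall f : nat -> nat, \sum_(t < T) f t = \sum_(x <- L) block_val f x & all (block_ok o q) L].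
Proof.
move=> oq; case: o oq => [/(_ isT) qe|_].
  pose T := maxn T0 q; have qT : q <= T by rewrite leq_maxr.
  exists T, ([seq (true, 0 + i.*2) | i <- iota 0 q./2] ++ [seq (false, t) | t <- index_iota q T]).
  have eq2 : q = (q./2).*2 by rewrite -[LHS]odd_double_half (negPf qe).
  split; first exact: leq_maxl.
    move=> f; rewrite big_cat /= -sum_pairs big_map add0n -eq2 -big_cat_nat //.
    by rewrite big_mkord.
  rewrite all_cat !all_map; apply/andP; split; apply/allP => t; rewrite ?mem_iota ?mem_index_iota.
    move=> /andP[_ tq]; rewrite /= /block_ok /= add0n subn0 odd_double.
    by have [-> ->] : t.*2 < q /\ t.*2.+1 < q by lia.
  by move=> /andP[qt _]; rewrite /= /block_ok /= ltnNge qt.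
exists (q + T0.*2), ([seq (false, t) | t <- index_iota 0 q] ++ [seq (true, q + i.*2) | i <- iota 0 T0]).
split; first by lia.
  move=> f; rewrite big_cat /= -sum_pairs big_map -big_cat_nat ?leq_addr //.
  by rewrite big_mkord.
rewrite all_cat !all_map; apply/andP; split; apply/allP => t; rewrite ?mem_iota ?mem_index_iota.
  by rewrite add0n subn0 => /andP[_ tq]; rewrite /= /block_ok /= tq.
move=> _; rewrite /= /block_ok /= addKn odd_double leq_addr.
have -> : (q + t.*2 < q) = false by lia.
by have -> : ((q + t.*2).+1 < q) = false by lia.
Qed.

Section Rows.
Variables (o : bool) (r : nat) (d : nat -> nat).
Hypothesis dsym : forall i, i <= r.*2 -> d i = d (r.*2 - i).
Notation s := r.*2.+1.
Notation m := (row_length d).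
Notation q := (d r).
Notation mu := (m s).
Notation lam := (collapse o q mu).

Lemma row_length_sym i t : i <= s -> m i t + m (s - i) t = mu t.
Proof.
move=> is_; rewrite /row_length -!(big_mkord predT (fun j => (t < d j : nat))).
rewrite (big_cat_nat (n := i) (p := s)) //=; congr (_ + _).
rewrite [RHS]big_nat_rev /= -{2}(add0n i) big_addn; apply: eq_big_nat => j /andP[_ js].
by rewrite [in RHS]dsym; [congr (_ < d _ : nat)|]; lia.
Qed.

Lemma row_dims_ok t : dims_ok r (mu t) (fun i => m i t).
Proof.
split=> [|i _|i is_]; first by rewrite /row_length big_ord0.
  by rewrite row_lengthS; case: ltnP => _ /=; lia.
exact: row_length_sym.
Qed.

Lemma mu_eq t : mu t = (m r t).*2 + (t < q).
Proof.
have rs : r <= s by lia.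
have := row_length_sym t rs; have -> : s - r = r.+1 by lia.
by rewrite row_lengthS; lia.
Qed.

Lemma mu_mono t t' : t <= t' -> mu t' <= mu t.
Proof. exact: row_length_mono. Qed.

(** The right-hand side is the rank reached by [flag_model_pair] on a pair and by [flag_model_chain]
    on a single row. *)
Lemma block_collapse j x : block_ok o q x -> block_val (fun t => lam t - j) x =
  if x.1 then (if j <= mu x.2.+1 then mu x.2 + mu x.2.+1 - j.*2 else (mu x.2).-1 - j)
  else mu x.2 - j.
Proof.
case: x => -[] t /=; rewrite /block_ok /block_val /= /collapse /=; last by move=> ->.
move=> /andP[/and3P[/eqP e1 /eqP e2 te] ot]; rewrite e1 e2 eqxx /= (negPf te).
have -> : odd (t.+1 - (if o then 0 else q)).
  by case: (o) te ot => /= te ot; [rewrite subn0 in te *|rewrite subSn //=]; rewrite ?te.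
have := mu_mono (leqnSn t); have := mu_eq t; have := mu_eq t.+1; rewrite e1 e2.
move: (mu t) (mu t.+1) => a b ea eb ba; rewrite ea eb.
by rewrite eqn_add2r; case: eqP => h; case: leqP; move: ba; rewrite ea eb; case: (o) => /=; lia.
Qed.

(** The sequence mu, being non-increasing, passes below j at most once; the sum of f telescopes. *)
Lemma mu_active_le1 (L : seq (bool * nat)) T j :
  (forall f : nat -> nat, \sum_(t < T) f t = \sum_(x <- L) block_val f x) ->
  \sum_(x <- L) (if x.1 then (mu x.2.+1 < j < mu x.2 : nat) else 0) <= 1.
Proof.
move=> hL; pose f t : nat := (j <= mu t) - (j <= mu t.+1).
have h K : \sum_(t < K) f t + (j <= mu K) = (j <= mu 0).
  elim: K => [|K IH]; first by rewrite big_ord0.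
  rewrite -IH big_ord_recr /= /f -addnA; congr (_ + _).
  by have := mu_mono (leqnSn K); case: (leqP j (mu K)); case: (leqP j (mu K.+1)) => /=; lia.
apply: (@leq_trans (\sum_(x <- L) block_val f x)); last first.
  by rewrite -hL; have := h T; case: (j <= mu 0) => /=; lia.
apply: leq_sum => -[[] t] _ //=; rewrite /block_val /= /f.
by have := mu_mono (leqnSn t); case: (leqP j (mu t)); case: (leqP j (mu t.+1)) => /=; lia.
Qed.

Section Sums.
Variables (T : nat) (L : seq (bool * nat)).
Hypotheses (hL : forall f : nat -> nat, \sum_(t < T) f t = \sum_(x <- L) block_val f x)
  (okL : all (block_ok o q) L).

(* The number of pairs (a, b) of rows with b < j < a, for which the collapse lowers by one
   the bound on the rank of the j-th power. *)
Definition active j := \sum_(x <- L) (if x.1 then (mu x.2.+1 < j < mu x.2 : nat) else 0).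

Lemma collapse_sum j : \sum_(t < T) (mu t - j) = \sum_(t < T) (lam t - j) + active j.
Proof.
rewrite (hL (fun t => mu t - j)) (hL (fun t => lam t - j)) /active -big_split /=.
rewrite !big_seq; apply: eq_bigr => x xL; have ok := allP okL x xL.
rewrite (block_collapse j ok); case: x ok {xL} => -[] t /= ok; last by rewrite addn0.
rewrite /block_val /=; move: ok => /andP[/and3P[/eqP e1 /eqP e2 te] ot].
have := mu_mono (leqnSn t); have := mu_eq t; have := mu_eq t.+1; rewrite e1 e2 /=.
move: (mu t) (mu t.+1) => a b -> ->.
by case: leqP => h1; case: ltnP => h2 /=; lia.
Qed.

Lemma collapse_sum_even j : odd j != o -> ~~ odd (\sum_(t < T) (lam t - j)).
Proof.
move=> jo; rewrite (hL (fun t => lam t - j)) big_seq.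
elim/big_ind: _ => [//|a b ha hb|x xL]; first by rewrite oddD (negPf ha) (negPf hb).
have ok := allP okL x xL; rewrite (block_collapse j ok); case: x ok {xL} => -[] t /=.
  move=> /andP[/and3P[/eqP e1 /eqP e2 te] ot].
  have := mu_eq t; have := mu_eq t.+1; rewrite e1 e2 /= => -> ->.
  case: leqP => h; first by case: (o) jo h; lia.
  by case: (o) jo; lia.
rewrite /block_ok /= => h; rewrite mu_eq; move: h jo; case: (o) => /=; case: (t < q) => //= _ jo; lia.
Qed.

(** The rows a and b of an active pair have the parity of j + 1, so b < j + 1 < a sharpens to b < j
    and j + 2 < a. All rows up to a then exceed j + 2 and all others are below j, so the sum is
    linear on j, j + 1, j + 2. *)
Lemma collapse_convex j : 0 < active j.+1 -> odd j.+1 = o ->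
  [/\ 0 < active j, 0 < active j.+2 &
   \sum_(t < T) (mu t - j) + \sum_(t < T) (mu t - j.+2) = 2 * \sum_(t < T) (mu t - j.+1)].
Proof.
rewrite lt0n sum_nat_seq_neq0 => /hasP[[[] t] xL] //=; rewrite eqb0 negbK => /andP[h1 h2] jo.
have /andP[/and3P[/eqP e1 /eqP e2 _] _] := allP okL _ xL; rewrite /= in e1 e2.
have := mu_eq t; have := mu_eq t.+1; rewrite e1 e2 => ea eb.
have h3 : mu t.+1 < j by case: (o) ea eb jo h1 h2; lia.
have h4 : j.+2 < mu t by case: (o) ea eb jo h1 h2; lia.
have act i : mu t.+1 < i -> i < mu t -> 0 < active i.
  move=> i1 i2; rewrite lt0n sum_nat_seq_neq0; apply/hasP; exists (true, t) => //=.
  by rewrite i1 i2.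
split; [apply: act; lia|apply: act; lia|].
rewrite big_distrr -big_split /=; apply: eq_bigr => i _.
have [it|ti] := leqP i t; first by have := mu_mono it; lia.
by have := mu_mono ti; lia.
Qed.

End Sums.

End Rows.
End Collapse.

Section Generic.
Variables (k : closedFieldType) (char_k : 2%N \notin [pchar k]).

Lemma flag_model_blocks (o : bool) r (d : nat -> nat) j (L : seq (bool * nat)) :
  (forall i, i <= r.*2 -> d i = d (r.*2 - i))%N ->
  let mu := row_length d r.*2.+1 in
  all (block_ok o (d r)) L ->
  flag_model k o r j (\sum_(x <- L) block_val mu x)%N
    (fun i => \sum_(x <- L) block_val (row_length d i) x)%N
    (\sum_(x <- L) block_val (fun t => collapse o (d r) mu t - j) x)%N.
Proof.
move=> dsym mu; elim: L => [_|x L IH /= /andP[okx /IH{}IH]].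
  have dok : double_ok r 0 (fun=> 0%N) (fun=> 0%N) by split.
  have := @flag_model_double k false o r j 0 _ _ dok; move=> /(_ (fun _ => _))h.
  by apply: flag_model_ext (h _) => // [||i _]; rewrite ?big_nil //.
have mx : flag_model k o r j (block_val mu x) (fun i => block_val (row_length d i) x)
    (block_val (fun t => collapse o (d r) mu t - j)%N x).
  rewrite (block_collapse dsym j okx); case: x okx => -[] t /=.
    move=> /andP[/and3P[/eqP e1 /eqP e2 te] ot]; rewrite /block_val /=.
    apply: flag_model_pair; try exact: (row_dims_ok dsym).
    - by rewrite /mu (mu_eq dsym) e1.
    - by rewrite /mu (mu_eq dsym) e2.
    exact: mu_mono.
  rewrite /block_ok /block_val /= => h.
  apply: flag_model_chain; last exact: (row_dims_ok dsym).
  rewrite /mu (mu_eq dsym) oddD odd_double /= oddb; by case: (_ < _)%N h; case: (o).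
have := flag_model_add mx IH; apply: flag_model_ext => [||i _]; by rewrite big_cons.
Qed.

Lemma row_length_sum d i T : (forall j, j < i -> d j <= T)%N ->
  (\sum_(t < T) row_length d i t = \sum_(j < i) d j)%N.
Proof.
move=> dT; rewrite exchange_big /=; apply: eq_bigr => j _; apply: sum_lt; exact: dT.
Qed.

Lemma flag_model_transport n (o : bool) (B : 'M[k]_n) r E j R : eform o B -> sdflag B r E ->
  flag_model k o r j n (fun i => \rank (E i)) R ->
  exists2 X, flagu B r E X & (R <= \rank (X ^+ j))%N.
Proof.
move=> eB fE [B' [X' [E' [eB' fE' dE' [sX' EX'] rX']]]].
have [|g gu [gB gE]] := sdflags_isometric char_k eB eB' fE fE'; first by move=> i is_; rewrite dE'.
exists (invmx g *m X' *m g); last first.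
  apply: leq_trans rX' _; rewrite (@mxrank_similar _ _ (invmx g *m X' *m g) X') //.
  by exists g.
have gTu : g^T \in unitmx by rewrite unitmx_tr.
split=> [|i is_].
  apply: (can_inj (mulKmx gu)); apply: (can_inj (mulmxK gTu)); rewrite /= mulmx0 mul0mx.
  rewrite -[RHS]sX' -gB mulmxDr mulmxDl !trmx_mul trmx_inv !mulmxA.
  by rewrite mulmxV // mul1mx -(mulmxA _ (invmx g^T)) mulVmx // mulmx1.
have e1 := gE i.+1 is_; have e0 := gE i (ltnW is_).
rewrite -(eqmxMr _ e1) -e0 !mulmxA mulmxK // submxMr // EX' //.
Qed.

Section OneFlag.
Variables (n : nat) (o : bool) (B : 'M[k]_n) (r : nat) (E : nat -> 'M[k]_n).
Hypotheses (eB : eform o B) (fE : sdflag B r E).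
Notation s := r.*2.+1.
Let d i := (\rank (E i.+1) - \rank (E i))%N.

Lemma sdflag_rank_mono i : (i < s)%N -> (\rank (E i) <= \rank (E i.+1))%N.
Proof. by move=> is_; apply: mxrankS; case: fE => _ ->. Qed.

Lemma sdflag_dsym i : (i <= r.*2)%N -> d i = d (r.*2 - i)%N.
Proof.
move=> ir; case: fE => _ _ _ rE.
have h1 := rE i (leqW ir); have h2 := rE i.+1 (_ : i.+1 <= s)%N.
have h3 := @sdflag_rank_mono i; rewrite /d; move: h1 h2 h3.
have -> : (s - i = (r.*2 - i).+1)%N by lia.
have -> : (s - i.+1 = r.*2 - i)%N by lia.
by move=> h1 /(_ _) h2 h3; have := h2 ir; have := h3 ir; lia.
Qed.

Lemma sdflag_dsum i : (i <= s)%N -> (\sum_(j < i) d j = \rank (E i))%N.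
Proof.
elim: i => [|i IH] is_; first by rewrite big_ord0; case: fE => -> _ _ _; rewrite mxrank0.
by rewrite big_ord_recr /= IH 1?ltnW // /d; have := sdflag_rank_mono is_; lia.
Qed.

Lemma sdflag_odd_middle : o -> ~~ odd (d r).
Proof.
move=> ho; have ne : ~~ odd n.
  have [eBt Bu] := eB; have <- : \rank B = n by apply: mxrank_unit.
  by apply: (mxrank_skew_even char_k); rewrite eBt ho expr1 scaleN1r.
have rs : (r <= s)%N by lia.
case: fE => _ _ _ rE; have := rE r rs; rewrite (_ : s - r = r.+1)%N; last by lia.
by have := @sdflag_rank_mono r; rewrite /d; lia.
Qed.

Definition flag_type (T j : nat) : nat :=
  (\sum_(t < T) (collapse o (d r) (row_length d s) t - j))%N.

(** The length T is chosen so that the rows below T split exactly into blocks. The upper bound is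
    proved for each X, whereas the lower bound may use a different X for each j. *)
Lemma flag_type_exists : exists2 T, (n.+2 <= T)%N &
  (forall X j, flagu B r E X -> (\rank (X ^+ j) <= flag_type T j)%N) /\
  (forall j, exists2 X, flagu B r E X & (flag_type T j <= \rank (X ^+ j))%N).
Proof.
have [T [L [nT hL okL]]] := blocks_exist n.+2 sdflag_odd_middle.
exists T => //; have nT' : (n <= T)%N by lia.
pose mu := row_length d s.
have rX X j : flagu B r E X -> (\rank (X ^+ j) <= \sum_(t < T) (mu t - j))%N.
  move=> [sX EX]; have [E0 mE _ _] := fE.
  have := chain_rank_bound j nT' E0 mE EX; rewrite -/d; apply: leq_trans.
  have /submxP[D eD] := sdflag_full fE (1%:M : 'M_n).
  by rewrite -{1}[X ^+ j]mul1mx eD -mulmxA mxrankM_maxr.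
have dT i j : (i <= s)%N -> (j < i)%N -> (d j <= T)%N.
  by move=> _ _; rewrite /d (leq_trans (leq_subr _ _)) // (leq_trans (rank_leq_row _)).
split=> [X j uX|j].
  have cs i : (\sum_(t < T) (mu t - i) = flag_type T i + active r d L i)%N.
    exact: (collapse_sum sdflag_dsym hL okL i).
  (* The rank and the collapsed bound are both even and the uncollapsed bound exceeds the latter by
     at most one, so this excess cannot be used. *)
  have par i : odd i != o -> (\rank (X ^+ i) <= flag_type T i)%N.
    move=> io; have := collapse_sum_even sdflag_dsym hL okL io.
    have := form_skew_rank_even char_k eB (proj1 uX) io.
    have := rX X i uX; rewrite cs; have : (active r d L i <= 1)%N := mu_active_le1 r d i hL.
    by rewrite /flag_type; lia.
  have [jo|/par//] := eqVneq (odd j) o.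
  have [ha|ha] := posnP (active r d L j); first by have := rX X j uX; rewrite cs ha addn0.
  case: j jo ha => [|j] jo ha.
    by move: ha; rewrite /active big1 // => -[[] t] _.
  (* At j and j + 2 parity saves one each; by convexity, twice the rank at j + 1 is at most twice
     the uncollapsed bound minus 2. *)
  have [h0 h2 e] := collapse_convex sdflag_dsym T okL ha jo.
  have := mxrank_convex X j; have /par : odd j != o by rewrite -jo /=; case: odd.
  have /par : odd j.+2 != o by rewrite -jo /=; case: odd.
  move: e; rewrite -/mu !cs; have : (active r d L j.+1 <= 1)%N := mu_active_le1 r d _ hL.
  by lia.
have := @flag_model_blocks o r d j L sdflag_dsym okL; rewrite -!hL.
move=> h; apply: (flag_model_transport eB fE); apply: flag_model_ext h => //.
  rewrite row_length_sum ?sdflag_dsum // => [|j' js]; last exact: (dT s).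
  by case: fE => E0 _ _ /(_ s (leqnn _)); rewrite subnn E0 mxrank0 addn0.
by move=> i is_; rewrite -hL row_length_sum ?sdflag_dsum // => j' js; apply: (dT i).
Qed.

End OneFlag.
End Generic.

(** * Generic ranks and the Richardson criterion *)

Section Criterion.
Variables (k : closedFieldType) (char_k : 2%N \notin [pchar k]).

Lemma rank_minor n (M : 'M[k]_n) : exists (A : 'M_(\rank M, n)) (C : 'M_(n, \rank M)),
  A *m M *m C = 1%:M.
Proof.
exists (pinvmx (col_base M)), (pinvmx (row_base M)).
have e : pinvmx (col_base M) *m M = row_base M.
  transitivity (pinvmx (col_base M) *m (col_base M *m row_base M)); first by rewrite mulmx_base.
  by rewrite mulmxA mulVpmx ?col_base_full // mul1mx.
by rewrite e mulmxVp // row_base_free.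
Qed.

(** The function f is a product of minors that equal 1 at X, one for each power. *)
Lemma rank_test n (X : 'M[k]_n) m : exists f : 'M[k]_n -> k,
  [/\ polyfun f, f X != 0 &
    forall Y, f Y != 0 -> forall j, (j < m)%N -> (\rank (X ^+ j) <= \rank (Y ^+ j))%N].
Proof.
elim: m => [|m [f [pf fX fY]]].
  by exists (fun=> 1); split; [apply: polyfun_cst|apply: oner_neq0|].
have [A [C AC]] := rank_minor (X ^+ m).
exists (fun Y => f Y * \det (A *m Y ^+ m *m C)); split.
- apply: polyfunM => //; apply: polyfun_det; apply: polymxM; last exact: polymx_cst.
  by apply: polymxM; [apply: polymx_cst|apply: polymx_exp].
- by rewrite AC det1 mulr1.
move=> Y; rewrite mulf_eq0 negb_or => /andP[/fY h dY] j; rewrite ltnS leq_eqVlt.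
case/orP=> [/eqP->|/h//].
have u : A *m Y ^+ m *m C \in unitmx by rewrite unitmxE unitfE.
rewrite -(mxrank_unit u) (leq_trans (mxrankM_maxl _ _)) // mxrankM_maxr //.
Qed.

(** Each rank condition is guarded by a polynomial that is nonzero somewhere on T, and
    [zaffine_common] makes two of them nonzero at one point. *)
Lemma generic_rank n (T : 'M[k]_n -> Prop) (rho : nat -> nat) m : zaffine T ->
  (exists X, T X) -> (forall j, exists2 X, T X & (rho j <= \rank (X ^+ j))%N) ->
  exists2 X, T X & forall j, (j < m)%N -> (rho j <= \rank (X ^+ j))%N.
Proof.
move=> aT T0 h; elim: m => [|m [X TX hX]]; first by case: T0 => X TX; exists X.
have [Y TY rY] := h m.
have [f [pf fX hf]] := rank_test X m; have [g [pg gY hg]] := rank_test Y m.+1.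
have [Z TZ] := zaffine_common aT pf pg TX TY fX gY.
rewrite mulf_eq0 negb_or => /andP[fZ gZ]; exists Z => // j; rewrite ltnS leq_eqVlt.
case/orP=> [/eqP->|jm]; first by rewrite (leq_trans rY) // (hg Z gZ).
by rewrite (leq_trans (hX j jm)) // (hf Z fZ).
Qed.

Lemma zclosed_zero n (f : 'M[k]_n -> k) : polyfun f -> zclosed (fun X => f X = 0).
Proof.
move=> pf; apply: (@zclosed_family _ _ (fun g => g = f)) => [g ->//|X].
by split=> [fX g ->|->].
Qed.

Section OneFlag.
Variables (n : nat) (o : bool) (B : 'M[k]_n) (r : nat) (E : nat -> 'M[k]_n).
Hypotheses (eB : eform o B) (fE : sdflag B r E).
Notation s := r.*2.+1.
Notation d := (fun i => \rank (E i.+1) - \rank (E i))%N.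
Notation G := (isometry_group B).

Lemma flagu0 : flagu B r E 0.
Proof.
split=> [|i _]; last by rewrite mulmx0 sub0mx.
by rewrite /form_skew mul0mx trmx0 mulmx0 addr0.
Qed.

Lemma nilpotent_orbit_rank la X : part_of n la -> form_skew B X -> X ^+ s = 0 ->
  nilpotent_orbit G la X <-> forall j, \rank (X ^+ j) = jordan_rank la j.
Proof.
move=> /andP[/andP[sla pla] /eqP nla] sX X0; split.
  move=> [_ [g gu eX]] j; rewrite (mxrank_similar (Y := nilp_jordan_mx k n la)); last by exists g.
  exact: mxrank_nilp_jordan.
move=> h; split; first exact: (lie_isometry_nilp char_k X0 sX).
have [t [nt pt at_ sim]] := nilpotent_jordan X0.
have <- : t = la.
  apply: jordan_rank_inj => // [|j]; first exact: path_sorted pt.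
  by rewrite -h (mxrank_similar _ sim) mxrank_nilp_jordan.
by [].
Qed.

Variable T : nat.
Hypothesis hT : (forall X j, flagu B r E X -> (\rank (X ^+ j) <= flag_type o r E T j)%N) /\
  (forall j, exists2 X, flagu B r E X & (flag_type o r E T j <= \rank (X ^+ j))%N).

Lemma generic_flagu : exists2 X, flagu B r E X & forall j, \rank (X ^+ j) = flag_type o r E T j.
Proof.
case: hT => ub lb.
have [|X uX hX] := @generic_rank _ (flagu B r E) (flag_type o r E T) s (@zaffine_flagu _ _ _ _ _) _ lb.
  by exists 0; apply: flagu0.
exists X => // j; apply/eqP; rewrite eqn_leq ub //=.
have [/hX//|sj] := ltnP j s; have [Y uY] := lb j.
by rewrite -(subnK sj) exprD (flagu_nilp fE uY) mulr0 mxrank0 leqn0 => /eqP->.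
Qed.

Lemma richardson_criterion la : part_of n la ->
  is_richardson_orbit G (flagP B r E) (nilpotent_orbit G la) <->
  forall j, jordan_rank la j = flag_type o r E T j.
Proof.
move=> pla; have [X0 uX0 rX0] := generic_flagu; have [ub _] := hT.
have X0s := flagu_nilp fE uX0.
have orb X : flagu B r E X ->
    nilpotent_orbit G la X <-> forall j, \rank (X ^+ j) = jordan_rank la j.
  by move=> uX; apply: nilpotent_orbit_rank; [|case: uX|apply: (flagu_nilp fE uX)].
have [f [pf fX0 hf]] := rank_test X0 s.
have full X : flagu B r E X -> (forall j, (j < s)%N -> (flag_type o r E T j <= \rank (X ^+ j))%N) ->
    forall j, \rank (X ^+ j) = flag_type o r E T j.
  move=> uX h j; apply/eqP; rewrite eqn_leq ub //=; have [/h//|sj] := ltnP j s.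
  by rewrite -rX0 -(subnK sj) !exprD X0s mulr0 mxrank0.
have lieU X : lie (flagU B r E) X <-> flagu B r E X by apply: (lie_flagU char_k fE).
have fullf X : flagu B r E X -> f X != 0 -> forall j, \rank (X ^+ j) = flag_type o r E T j.
  by move=> uX fX; apply: full => // j js; rewrite -rX0; apply: hf.
split.
  move=> [_ [U rU [_ dense]]] j.
  have eU : U = flagU B r E.
    apply: functional_extensionality => u; apply: propositional_extensionality.
    exact: (unipotent_radical_unique char_k eB fE).
  subst U.
  (* Otherwise the orbit would meet u inside the zero set of f, which is closed and misses X0. *)
  have [X [OX [/lieU uX fX]]] : exists X, nilpotent_orbit G la X /\ lie (flagU B r E) X /\ f X != 0.
    apply: NNPP => h; case/eqP: fX0; apply: (dense _ (zclosed_zero pf)); last exact/lieU.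
    by move=> X [OX lX]; apply/eqP/negbNE/negP => fX; apply: h; exists X.
  by rewrite -((orb X uX).1 OX) fullf.
move=> hla; split; last first.
  exists (flagU B r E); first exact: (unipotent_radical_flagU char_k eB fE).
  split.
    (* The locus of maximal ranks is the complement of the common zeros of all g whose nonvanishing
       forces maximal ranks; [rank_test] supplies such a g at each point of the orbit in u. *)
    pose F (g : 'M[k]_n -> k) := polyfun g /\ forall Y, g Y != 0 ->
      forall j, (j < s)%N -> (flag_type o r E T j <= \rank (Y ^+ j))%N.
    exists (fun X => forall g, F g -> g X = 0); first by apply: (@zclosed_family _ _ F) => // g [].
    move=> X; split=> [[OX lX]|[lX nZ]].
      split=> // Z; have uX := (lieU X).1 lX; have rX := (orb X uX).1 OX.
      have [g [pg gX hg]] := rank_test X s; case/eqP: gX; apply: Z; split=> // Y gY j js.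
      by rewrite -hla -rX; apply: hg.
    have uX := (lieU X).1 lX; split=> //; apply/(orb X uX) => j.
    have [g ng] := not_all_ex_not _ _ nZ; have [[pg hg] gX] := imply_to_and _ _ ng.
    by rewrite hla; apply: full => // i is_; apply: hg => //; apply/eqP.
  move=> Z [I ZI] OZ X /lieU uX; apply/ZI => p Ip.
  apply: (@zaffine_dense _ _ (flagu B r E) f (mx_eval p) X0) uX => //.
  - exact: zaffine_flagu.
  - by exists p.
  move=> Y uY fY; apply: (ZI Y).1 => //; apply: OZ; split; last exact/lieU.
  by apply/(orb Y uY) => j; rewrite hla; apply: fullf.
have OX0 : nilpotent_orbit G la X0 by apply/(orb X0 uX0) => j; rewrite hla.
have sX0 := proj1 uX0.
exists X0; split; [by case: OX0|by exists s|].
move=> Y; split=> [[lY [h hu eY]]|[g Gg ->]].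
  have sY : form_skew B Y by apply: (lie_isometry_skew _ lY) => g.
  case: OX0 => _ [h0 h0u eX0].
  have gu : invmx h *m h0 \in unitmx by rewrite unitmx_mul unitmx_inv hu.
  apply: (skew_similar_conj char_k eB gu) => //; apply: (can_inj (mulmxK gu)).
  by rewrite /= mulmxKV // eY eX0 !mulmxA mulmxK // mulmxK.
have gu := isometry_unit eB Gg.
apply/nilpotent_orbit_rank => //.
- exact: (skew_conj eB Gg sX0).
- by rewrite conjmx_exp // X0s mulmx0 mul0mx.
move=> j; rewrite -[g]invmxK (mxrank_similar (Y := X0)); first by rewrite hla rX0.
by exists (invmx g); rewrite ?unitmx_inv // invmxK.
Qed.

End OneFlag.
End Criterion.

(** * Partitions that are collapses *)

Section Partitions.
Local Open Scope nat_scope.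

Section PairLists.
Implicit Types (o : bool) (P : seq (nat * nat)) (s t : seq nat).

Definition flat P : seq nat := flatten [seq [:: x.1; x.2] | x <- P].

Definition parity o s := all (fun x => odd x == o) s.

(* z is the entry that follows the last pair. *)
Fixpoint pairs_ok o (z : nat) P : bool :=
  if P is x :: P' then
    (if odd x.1 == o then x.1 == x.2 else (odd x.2 != o) && (head z (flat P') < x.2))
    && pairs_ok o z P'
  else true.

(* For o = false (orthogonal case) the odd-indexed blocks are the even-pair partitions and the
   even-indexed ones the odd 2-step-descending partitions; for o = true, parities are exchanged. *)
Definition block_seq o m (l : nat -> seq nat) : Prop :=
  (forall i, 0 < i <= m -> odd i -> (i != 1 -> l i != [::]) /\ (pair_part (l i) /\ parity o (l i)))
  /\ (forall i, 0 < i <= m -> ~~ odd i ->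
        l i != [::] /\ (two_step_descending_part (l i) /\ parity (~~ o) (l i))).

Lemma size_flat P : size (flat P) = (size P).*2.
Proof. by elim: P => //= x P ->. Qed.

Lemma nth_flat0 P i : nth 0 (flat P) i.*2 = (nth (0, 0) P i).1.
Proof. by elim: P i => [|x P IH] [|i] //=; rewrite ?nth_nil. Qed.

Lemma nth_flat1 P i : nth 0 (flat P) i.*2.+1 = (nth (0, 0) P i).2.
Proof. by elim: P i => [|x P IH] [|i] //=; rewrite ?nth_nil. Qed.

Lemma is_part_cons x s : is_part (x :: s) = [&& head 0 s <= x, 0 < x & is_part s].
Proof.
rewrite /is_part /=; case: s => [|y s] /=; first by rewrite !andbT.
by rewrite /geq /=; case: (y <= x); case: (0 < x) => //=; rewrite ?andbF.
Qed.

Lemma is_part_catr s t : is_part (s ++ t) -> is_part t.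
Proof. by elim: s => //= x s IH; rewrite is_part_cons => /and3P[_ _ /IH]. Qed.

Lemma is_part_catl s t : is_part (s ++ t) -> is_part s.
Proof.
elim: s => // x s IH; rewrite cat_cons !is_part_cons => /and3P[h -> /IH->]; rewrite !andbT.
by case: s h {IH}.
Qed.

Lemma pair_part_nil : pair_part [::].
Proof. by split=> // i; rewrite /=; lia. Qed.

Lemma two_step_nil : two_step_descending_part [::].
Proof. by split=> // i; rewrite /=; lia. Qed.

Lemma pair_part_cons2 x y s : is_part [:: x, y & s] ->
  pair_part [:: x, y & s] <-> x = y /\ pair_part s.
Proof.
move=> ps; have ps' : is_part s by move: ps; rewrite !is_part_cons => /and3P[_ _ /and3P[]].
split=> [[_ os h]|[xy [_ os h]]]; last subst y.
  split; first by have := h 1; rewrite /entry /=; apply.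
  split=> //; first by move: os; rewrite /= negbK.
  move=> i hi; have := h i.+1; rewrite /entry.
  have -> : (2 * i.+1 - 1).-1 = (2 * i - 1).-1.+2 by lia.
  have -> : (2 * i.+1).-1 = (2 * i).-1.+2 by lia.
  by apply; move: hi; rewrite /=; lia.
split=> //; do ?by rewrite /= negbK.
case=> [|[|i]] // hi.
have := h i.+1; rewrite /entry.
have -> : (2 * i.+2 - 1).-1 = (2 * i.+1 - 1).-1.+2 by lia.
have -> : (2 * i.+2).-1 = (2 * i.+1).-1.+2 by lia.
by apply; move: hi; rewrite /=; lia.
Qed.

Lemma two_step_cons2 x y s : is_part [:: x, y & s] ->
  two_step_descending_part [:: x, y & s] <-> head 0 s < y /\ two_step_descending_part s.
Proof.
move=> ps; have ps' : is_part s by move: ps; rewrite !is_part_cons => /and3P[_ _ /and3P[]].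
have y0 : 0 < y by move: ps; rewrite !is_part_cons => /and3P[_ _ /and3P[]].
split=> [[_ os h]|[hy [_ os h]]].
  split.
    case: s os h {ps ps'} => [|z [|w s]] //= os h.
    by have := h 1; rewrite /entry /=; apply; lia.
  split=> //; first by move: os; rewrite /= negbK.
  move=> i hi; have := h i.+1; rewrite /entry.
  have -> : (2 * i.+1 + 1).-1 = (2 * i + 1).-1.+2 by lia.
  have -> : (2 * i.+1).-1 = (2 * i).-1.+2 by lia.
  by apply; move: hi; rewrite /=; lia.
split=> //; do ?by rewrite /= negbK.
case=> [|[|i]] // hi.
have := h i.+1; rewrite /entry.
have -> : (2 * i.+2 + 1).-1 = (2 * i.+1 + 1).-1.+2 by lia.
have -> : (2 * i.+2).-1 = (2 * i.+1).-1.+2 by lia.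
by apply; move: hi; rewrite /=; lia.
Qed.

(** The first block is always of the equal-pair kind, possibly empty. An equal pair in front joins
    it; any other pair joins or creates the second block if the first is empty, and otherwise opens
    two new blocks, the first of them empty. *)
Lemma pairs_blocks o z P : pairs_ok o z P -> is_part (flat P) ->
  exists m l, [/\ 0 < m, flat P = flatten [seq l i | i <- iota 1 m] & block_seq o m l].
Proof.
elim: P => [|x P IH].
  move=> _ _; exists 1, (fun=> [::]); split=> //; split=> i /andP[i0 i1].
    have -> : i = 1 by lia.
    by split=> //; split=> //; apply: pair_part_nil.
  by have -> : i = 1 by lia.
have fx : flat (x :: P) = [:: x.1, x.2 & flat P] by [].
rewrite fx => /= /andP[okx okP] pt.
have /IH : is_part (flat P) by move: pt; rewrite !is_part_cons => /and3P[_ _ /and3P[]].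
move=> /(_ okP)[m [l [m0 eP [bo be]]]].
have iS : iota 1 m = 1 :: iota 2 m.-1 by case: (m) m0.
have eP1 : flat P = l 1 ++ flatten [seq l i | i <- iota 2 m.-1] by rewrite eP iS.
have [_ [pl1 parl1]] := bo 1 m0 isT.
move: okx; case: ifP => hx okx.
  (* an equal pair is absorbed by the first block *)
  have ptl : is_part [:: x.1, x.2 & l 1].
    by apply: (@is_part_catl _ (flatten [seq l i | i <- iota 2 m.-1])); rewrite /= -eP1.
  exists m, (fun i => if i == 1 then [:: x.1, x.2 & l 1] else l i); split=> //.
    rewrite iS /= eP1; congr [:: _, _ & _ ++ flatten _]; apply/eq_in_map => i.
    by rewrite mem_iota; case: eqP => // ->.
  split=> i hi oi; case: (eqVneq i 1) => [e|ne].
  - split=> //; split.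
      by apply/pair_part_cons2 => //; split=> //; apply/eqP.
    by rewrite /= hx -(eqP okx) hx.
  - by have [h hp] := bo i hi oi; split=> // _; apply: h.
  - by rewrite e in oi.
  exact: be.
have /andP[hx2 hlt] := okx.
have hx1 : odd x.1 == ~~ o by case: (odd x.1) (o) hx => -[].
have {}hx2 : odd x.2 == ~~ o by case: (odd x.2) (o) hx2 => -[].
have [e1|ne1] := eqVneq (l 1) [::]; last first.
  (* a new descending block in front, after an empty block of equal pairs *)
  have p2 : is_part [:: x.1; x.2].
    by apply: (@is_part_catl _ (flat P)).
  exists m.+2, (fun i => if i == 1 then [::] else if i == 2 then [:: x.1; x.2] else l i.-2).
  split=> //.
    rewrite [iota 1 m.+2]/= eP /=; congr [:: _, _ & flatten _].
    rewrite -[3]/(2 + 1) iotaDl -map_comp; apply/eq_in_map => i; rewrite mem_iota => /andP[i0 _] /=.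
    by case: i i0 => // i _; rewrite !addSn add0n.
  split=> i hi oi; case: (eqVneq i 1) => [e|ni1].
  - by split=> //; split=> //; apply: pair_part_nil.
  - case: (eqVneq i 2) => [e|ni2]; first by rewrite e in oi.
    have [h hp] : (i.-2 != 1 -> l i.-2 != [::]) /\ (pair_part (l i.-2) /\ parity o (l i.-2)).
      by apply: bo; [lia|move: oi; case: i hi ni1 ni2 => [|[|i]] //= _ _ _; rewrite negbK].
    split=> // _; have [-> //|/h//] := eqVneq i.-2 1.
  - by rewrite e in oi.
  case: (eqVneq i 2) => [e|ni2].
    split=> //; split; last by rewrite /= hx1 hx2.
    apply/two_step_cons2 => //; split; last exact: two_step_nil.
    by move: p2; rewrite !is_part_cons => /and3P[_ _ /and3P[]].
  by apply: be; [lia|move: oi; case: i hi ni1 ni2 => [|[|i]] //= _ _ _; rewrite negbK].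
have [m1|m2] := leqP m 1.
  have em : m = 1 by lia.
  have eP0 : flat P = [::] by rewrite eP1 e1 em.
  exists 2, (fun i => if i == 1 then [::] else [:: x.1; x.2]); split=> //=; first by rewrite eP0.
  rewrite eP0 in pt; split=> i hi oi.
    have -> : i = 1 by case: i hi oi => [|[|[|]]].
    by split=> //; split=> //; apply: pair_part_nil.
  have -> : i = 2 by case: i hi oi => [|[|[|]]].
  split=> //; split; last by rewrite /= hx1 hx2.
  apply/two_step_cons2 => //; split; last exact: two_step_nil.
  by move: pt; rewrite !is_part_cons => /and3P[_ _ /and3P[]].
have iS2 : iota 2 m.-1 = 2 :: iota 3 m.-2 by case: (m) m2 => [|[|]].
have eP2 : flat P = l 2 ++ flatten [seq l i | i <- iota 3 m.-2] by rewrite eP1 e1 iS2.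
have [l2n [tl2 parl2]] := be 2 m2 isT.
have hl2 : head 0 (l 2) < x.2.
  move: hlt; rewrite eP2; case: (l 2) l2n => //.
have ptl : is_part [:: x.1, x.2 & l 2].
  by apply: (@is_part_catl _ (flatten [seq l i | i <- iota 3 m.-2])); rewrite /= -eP2.
exists m, (fun i => if i == 2 then [:: x.1, x.2 & l 2] else l i); split=> //.
  rewrite iS iS2 /= e1 eP2 /=; congr [:: _, _ & _ ++ flatten _]; apply/eq_in_map => i.
  by rewrite mem_iota; case: eqP => // ->.
split=> i hi oi; case: (eqVneq i 2) => [e|ne].
- by rewrite e in oi.
- exact: bo.
- split=> //; split; last by rewrite /= hx1 hx2.
  exact/two_step_cons2.
exact: be.
Qed.

Lemma even_size_flat s : ~~ odd (size s) -> exists Q, s = flat Q.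
Proof.
have [n] := ubnP (size s); elim: n s => // n IH [|x [|y s]] //=; first by exists [::].
rewrite !ltnS negbK => sn os; have [|Q ->] := IH s _ os; first by lia.
by exists ((x, y) :: Q).
Qed.

Lemma flat_cat P Q : flat (P ++ Q) = flat P ++ flat Q.
Proof. by rewrite /flat map_cat flatten_cat. Qed.

Lemma pairs_ok_pair_part o z s P : pair_part s -> parity o s -> pairs_ok o z P ->
  exists2 P', s ++ flat P = flat P' & pairs_ok o z P'.
Proof.
move=> ps pars okP; have [Q eQ] : exists Q, s = flat Q by apply: even_size_flat; case: ps.
exists (Q ++ P); first by rewrite flat_cat eQ.
elim: Q s eQ ps pars => [//|x Q IH] s eQ; rewrite eQ => ps.
have fx : flat (x :: Q) = [:: x.1, x.2 & flat Q] by [].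
rewrite fx in ps *; have [pt _ _] := ps.
move/(pair_part_cons2 pt): ps => [e ps] /=.
by move=> /and3P[-> _ pars]; rewrite e eqxx /= (IH (flat Q)).
Qed.

Lemma pairs_ok_two_step o z s P : two_step_descending_part s -> parity (~~ o) s ->
  pairs_ok o z P -> (s != [::] -> head z (flat P) < last 0 s) ->
  exists2 P', s ++ flat P = flat P' & pairs_ok o z P'.
Proof.
move=> ps pars okP hz; have [Q eQ] : exists Q, s = flat Q by apply: even_size_flat; case: ps.
exists (Q ++ P); first by rewrite flat_cat eQ.
elim: Q s eQ ps pars hz => [//|x Q IH] s eQ; rewrite eQ => ps.
have fx : flat (x :: Q) = [:: x.1, x.2 & flat Q] by [].
rewrite fx in ps *; have [pt _ _] := ps.
move/(two_step_cons2 pt): ps => [e ps] /= /and3P[px1 px2 pars] hz.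
have -> : (odd x.1 == o) = false by case: (odd x.1) (o) px1 => -[].
have -> : odd x.2 != o by case: (odd x.2) (o) px2 => -[].
rewrite flat_cat (IH (flat Q)) //; last by case: (Q) hz => // y Q' /(_ isT).
by rewrite andbT; case: (Q) e hz => [_ /(_ isT)|y Q' e _].
Qed.

(** The condition on z and m concerns a final descending block, whose last entry must exceed z: this
    is automatic for z = 0, and for odd m the last block consists of equal pairs. *)
Lemma blocks_pairs o z m l : block_seq o m l -> is_part (flatten [seq l i | i <- iota 1 m]) ->
  z = 0 \/ odd m ->
  exists2 P, flatten [seq l i | i <- iota 1 m] = flat P & pairs_ok o z P.
Proof.
move=> [bo be] pt hz.
have sub n a : a + n = m.+1 -> 0 < a -> is_part (flatten [seq l i | i <- iota a n]).
  move=> e a0; move: pt; have -> : m = a.-1 + n by lia.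
  by rewrite iotaD map_cat flatten_cat add1n prednK // => /is_part_catr.
suff h n a : a + n = m.+1 -> 0 < a ->
    exists2 P, flatten [seq l i | i <- iota a n] = flat P & pairs_ok o z P.
  by apply: h; lia.
elim: n a => [|n IH] a e a0; first by exists [::].
have [|//|P eP okP] := IH a.+1; first by lia.
have am : 0 < a <= m by lia.
have pa := sub _ _ e a0; rewrite /= eP in pa.
have [oa|ea] := boolP (odd a).
  have [_ [pl parl]] := bo a am oa.
  by rewrite /= eP; apply: pairs_ok_pair_part.
have [ln [pl parl]] := be a am ea.
rewrite /= eP; apply: pairs_ok_two_step => // _.
have lastp : forall s t, is_part (s ++ t) -> s != [::] -> head 0 t <= last 0 s /\ 0 < last 0 s.
  elim=> // x [|y s] IHs t; rewrite cat_cons is_part_cons => /and3P[h1 h2 h3] _; first by [].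
  by have := IHs t h3 isT.
have [h1 h2] := lastp _ _ pa ln.
case: n e {IH} eP => [|n] e eP.
  rewrite -eP /=; case: hz => [-> //|om].
  have am' : a = m by lia.
  by rewrite am' om in ea.
have a1m : 0 < a.+1 <= m by lia.
have [lan [_ parla]] := bo a.+1 a1m ea; rewrite -eP /= in h1 *.
have {}lan : l a.+1 != [::] by apply: lan; case: (a) a0.
(* The strict inequality comes from parity: the entries of the next block have the opposite one. *)
have : odd (last 0 (l a)) != o.
  have : last 0 (l a) \in l a by case: (l a) ln => // x s _; apply: mem_last.
  by move=> /(allP parl); case: odd (o) => -[].
case: (l a.+1) lan parla h1 => // x s _ /= /andP[px _] h1 lo.
by rewrite ltn_neqAle h1 andbT; apply: contraNneq lo => <-.
Qed.

End PairLists.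

Section Rows.
Implicit Types (o : bool) (P : seq (nat * nat)) (s la A C : seq nat) (c : nat -> nat).

Definition half_rows q c (t : nat) : nat := (c t).*2 + (t < q).

Definition richardson_rows o la : Prop := exists q c,
  [/\ forall t, c t.+1 <= c t, o -> ~~ odd q
    & forall t, nth 0 la t = collapse o q (half_rows q c) t].

Lemma flat_iota (f : nat -> nat) b K :
  flat [seq (f (b + i.*2), f (b + i.*2).+1) | i <- iota 0 K] = [seq f i | i <- iota b K.*2].
Proof.
elim: K => [//|K IH]; rewrite doubleS -[K.+1]addn1 iotaD map_cat flat_cat IH.
rewrite -[K.*2.+2]addn2 iotaD map_cat /= add0n.
by rewrite /flat /=.
Qed.

Section FromRows.
Variables (o : bool) (q : nat) (c : nat -> nat).
Hypothesis c_mono : forall t, c t.+1 <= c t.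
Notation mu := (half_rows q c).
Notation lam := (collapse o q mu).
Notation b0 := (if o then 0 else q).

Lemma half_rows_mono t : mu t.+1 <= mu t.
Proof. by rewrite /half_rows; have := c_mono t; lia. Qed.

Lemma half_rows_odd t : odd (mu t) = (t < q).
Proof. by rewrite /half_rows oddD odd_double oddb. Qed.

Definition pair_at i := (b0 + i.*2 < q) == o /\ ((b0 + i.*2).+1 < q) == o.

Lemma collapse_pair i : pair_at i -> let t := b0 + i.*2 in
  (mu t = mu t.+1 /\ lam t = mu t /\ lam t.+1 = mu t) \/
  (mu t.+1 + 2 <= mu t /\ lam t = (mu t).-1 /\ lam t.+1 = (mu t.+1).+1).
Proof.
move=> [/eqP h1 /eqP h2] t; rewrite /collapse h1 h2 eqxx /= addKn odd_double.
have -> : odd ((b0 + i.*2).+1 - b0) by rewrite subSn ?leq_addr //= addKn odd_double.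
rewrite -/t; have := half_rows_odd t; have := half_rows_odd t.+1; rewrite h1 h2.
have := half_rows_mono t; case: (eqVneq (mu t) (mu t.+1)) => [->|ne]; first by left.
by move=> le o1 o2; right; split=> //; lia.
Qed.

(** An unequal pair (a, b) of rows becomes (a - 1, b + 1), of the other parity; b + 1 exceeds the
    next collapsed row, which is at most b since the first row of a pair is never raised. *)
Lemma pairs_ok_rows a K : (forall i, a <= i < a + K -> pair_at i) ->
  pairs_ok o 0 [seq (lam (b0 + i.*2), lam (b0 + i.*2).+1) | i <- iota a K].
Proof.
elim: K a => [//|K IH] a h /=; rewrite IH ?andbT; last by move=> i hi; apply: h; lia.
have pa : pair_at a by apply: h; lia.
have [h1 h2] := pa; have := half_rows_odd (b0 + a.*2); have := half_rows_odd (b0 + a.*2).+1.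
rewrite (eqP h1) (eqP h2).
case: (collapse_pair pa) => [[e1 [e2 e3]]|[e1 [e2 e3]]]; rewrite e2 e3 => o1 o2.
  by rewrite o2 eqxx.
have -> : (odd (mu (b0 + a.*2)).-1 == o) = false.
  by move: e1 o2; case: (mu (b0 + a.*2)) => [|x] /= hx; [lia|move=> <-; case: odd].
have -> : odd (mu (b0 + a.*2).+1).+1 != o by rewrite /= o1; case: (o).
rewrite /=; case: K IH h => [//|K] IH h /=; rewrite ltnS.
have pb : pair_at a.+1 by apply: h; lia.
have le := half_rows_mono (b0 + a.*2).+1.
have e : (b0 + a.*2).+2 = b0 + a.+1.*2 by lia.
rewrite e in le; apply: leq_trans le.
by case: (collapse_pair pb) => [[_ [-> _]]|[_ [-> _]]]; rewrite ?leq_pred.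
Qed.

End FromRows.

Lemma rows_pairs_orth la : is_part la -> richardson_rows false la ->
  exists l0 P, [/\ la = l0 ++ flat P, all_odd l0 & pairs_ok false 0 P].
Proof.
move=> pla [q [c [cm _ ela]]].
pose lam := collapse false q (half_rows q c).
have ela' : la = mkseq lam (size la).
  by apply: (@eq_from_nth _ 0); rewrite ?size_mkseq // => i il; rewrite nth_mkseq // ela.
have pa i : pair_at false q i by rewrite /pair_at; split; apply/eqP; lia.
have lamq t : t < q -> lam t = half_rows q c t by move=> tq; rewrite /lam /collapse tq.
have pos t : 0 < nth 0 la t -> t < size la by have [//|h] := ltnP t (size la); rewrite nth_default.
have posn t : t < size la -> 0 < nth 0 la t.
  by case/andP: pla => _ /allP h tl; apply: h; apply: mem_nth.
have qs : q <= size la.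
  case: (posnP q) => [->//|q0]; rewrite -(prednK q0); apply: pos.
  by rewrite ela -/lam lamq ?prednK // /half_rows prednK // leqnn; lia.
(* A positive entry cannot be paired with 0: the collapse of an unequal pair has a positive second
   entry. *)
have ev : ~~ odd (size la - q).
  apply/negP => od; pose i := (size la - q)./2.
  have es : size la = (q + i.*2).+1.
    by have := odd_double_half (size la - q); rewrite od -/i; lia.
  have : nth 0 la (q + i.*2).+1 = 0 by rewrite nth_default // es.
  have := posn (q + i.*2); rewrite es ltnSn => /(_ isT); rewrite !ela.
  by case: (collapse_pair cm (pa i)) => [[_ [-> ->]]|[_ [-> ->]]]; lia.
have es : size la = q + (size la - q)./2.*2.
  by have := odd_double_half (size la - q); rewrite (negPf ev); lia.
exists [seq lam i | i <- iota 0 q],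
  [seq (lam (q + i.*2), lam (q + i.*2).+1) | i <- iota 0 (size la - q)./2].
split.
- by rewrite flat_iota -map_cat -{2}(add0n q) -iotaD -es.
- apply/allP => x /mapP[t]; rewrite mem_iota add0n => /andP[_ tq] ->.
  by rewrite lamq // half_rows_odd.
exact: (pairs_ok_rows cm).
Qed.

Lemma rows_pairs_symp la : is_part la -> richardson_rows true la ->
  exists P C, [/\ la = flat P ++ C, all_even C & pairs_ok true 0 P].
Proof.
move=> pla [q [c [cm /(_ isT) qe ela]]].
pose lam := collapse true q (half_rows q c).
have ela' : la = mkseq lam (size la).
  by apply: (@eq_from_nth _ 0); rewrite ?size_mkseq // => i il; rewrite nth_mkseq // ela.
have eq2 : q = q./2.*2 by rewrite -[LHS]odd_double_half (negPf qe).
have pa i : 0 <= i < 0 + q./2 -> pair_at true q i.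
  by move=> hi; rewrite /pair_at; split; apply/eqP; lia.
have pos t : 0 < nth 0 la t -> t < size la by have [//|h] := ltnP t (size la); rewrite nth_default.
have qs : q <= size la.
  case: (posnP q) => [->//|q0].
  have q1 : q = (0 + (q./2.-1).*2).+2 by lia.
  rewrite q1; apply: pos; rewrite ela.
  have h : 0 <= q./2.-1 < 0 + q./2 by lia.
  have := half_rows_odd q c (0 + (q./2.-1).*2).
  by case: (collapse_pair cm (pa _ h)) => [[_ [_ ->]]|[_ [_ ->]]] //; lia.
exists [seq (lam (0 + i.*2), lam (0 + i.*2).+1) | i <- iota 0 q./2], [seq lam i | i <- iota q (size la - q)].
split.
- by rewrite flat_iota -eq2 -map_cat -{2}(add0n q) -iotaD subnKC.
- apply/allP => x /mapP[t]; rewrite mem_iota => /andP[qt _] ->.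
  by rewrite /lam /collapse ltnNge qt /= half_rows_odd ltnNge qt.
exact: (pairs_ok_rows cm).
Qed.

Section ToRows.
Variables (o : bool) (P : seq (nat * nat)) (A C : seq nat).
Hypotheses (oA : o -> A = [::]) (oC : ~~ o -> C = [::]).
Hypotheses (parA : parity (~~ o) A) (parC : parity (~~ o) C).
Hypothesis okP : pairs_ok o (head 0 C) P.
Hypothesis hA : A = [::] \/ P = [::] \/ odd (head 0 (flat P)) == o.
Hypothesis pla : is_part (A ++ flat P ++ C).

(** The inverse of the collapse on a pair. As it may raise the first entry, [hA] asks for an equal
    pair after a nonempty [A]; as it may lower the second, [pairs_ok] asks that entry to exceed the
    next one. *)
Definition uncollapse (x : nat * nat) := if odd x.1 == o then x else (x.1.+1, x.2.-1).

Lemma uncollapse_path Q y : pairs_ok o (head 0 C) Q -> is_part (flat Q ++ C) ->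
  head 0 (flat (map uncollapse Q) ++ C) <= y -> path geq y (flat (map uncollapse Q) ++ C).
Proof.
elim: Q y => [|x Q IH] y.
  move=> _ pC hC; case: (C) pC hC => // z C' /=; rewrite /is_part /= => /andP[pz _] zy.
  by rewrite pz andbT.
have e : flat [seq uncollapse i | i <- x :: Q] =
  [:: (uncollapse x).1, (uncollapse x).2 & flat (map uncollapse Q)] by [].
have fx : flat (x :: Q) = [:: x.1, x.2 & flat Q] by [].
rewrite e fx /= => /andP[okx okQ] pt xy; rewrite xy /=.
move: pt; rewrite is_part_cons /= => /and3P[h1 _]; rewrite is_part_cons => /and3P[h2 h3 pQ].
have hnext : head 0 (flat (map uncollapse Q) ++ C) <= (uncollapse x).2 <= (uncollapse x).1.
  rewrite /uncollapse; move: okx; case: ifP => px okx.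
    rewrite /= h1 andbT; case: (Q) h2 okQ => [//|x' Q'] /= h2 /andP[okx' _].
    rewrite -/(uncollapse x') /uncollapse; case: ifP => px' //=.
    rewrite ltn_neqAle h2 andbT; apply: contraFneq px' => ->.
    by rewrite -(eqP okx).
  move: okx => /andP[px2 hlt]; rewrite /=; apply/andP; split; last by lia.
  case: (Q) hlt okQ => [|x' Q'] /= hlt; first by move: hlt; case: (C) => [|z C'] /=; lia.
  move=> /andP[okx' _]; rewrite -/(uncollapse x') /uncollapse; case: ifP => px' /=; first by lia.
  by case: (o) px2 px' hlt; lia.
by move: hnext => /andP[hn ->]; apply: IH.
Qed.

Let muL := A ++ flat (map uncollapse P) ++ C.

Lemma uncollapse_sorted : sorted geq muL.
Proof.
have pPC := is_part_catr pla.
have /= := @uncollapse_path P _ okP pPC (leqnn _) => hp.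
rewrite /muL; case: (A) hA pla => [|a A'] hA' pla'.
  by rewrite cat0s; apply: path_sorted hp.
rewrite cat_cons /= cat_path; move: (pla'); rewrite /is_part cat_cons /= cat_path.
move=> /andP[/andP[-> _] _] /=; apply: uncollapse_path => //.
have hl : head 0 (flat P ++ C) <= last a A'.
  have lastp : forall s t x, is_part (x :: s ++ t) -> head 0 t <= last x s.
    elim=> [|y s IHs] t x /=; first by rewrite is_part_cons => /and3P[].
    by rewrite is_part_cons => /and3P[_ _ /IHs].
  exact: lastp pla'.
case: hA' => [//|[eP|]]; first by rewrite eP in hl *.
move: hl; case: (P) => [//|x Q] /= hl px.
by rewrite /uncollapse px.
Qed.

Let q := size A + (if o then size (flat P) else 0).

Lemma nth_muL t : nth 0 muL t =
  if t < size A then nth 0 A t else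
  if t < size A + size (flat P) then nth 0 (flat (map uncollapse P)) (t - size A)
  else nth 0 C (t - (size A + size (flat P))).
Proof.
rewrite /muL nth_cat; case: ltnP => // h; rewrite nth_cat size_flat size_map -size_flat.
by rewrite ltn_subLR // subnDA.
Qed.

Lemma nth_parity s (b : bool) t : parity b s -> t < size s -> odd (nth 0 s t) = b.
Proof. by move=> /allP h ts; apply/eqP/h/mem_nth. Qed.

Lemma pairs_ok_nth Q z i : pairs_ok o z Q -> i < size Q -> let x := nth (0, 0) Q i in
  (odd x.1 == o /\ x.1 = x.2) \/ ((odd x.1 == o) = false /\ odd x.2 != o).
Proof.
elim: Q i => [//|x Q IH] [|i] /= /andP[okx okQ] iQ; last exact: IH.
by move: okx; case: ifP => _; [move/eqP; left|move=> /andP[? _]; right].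
Qed.

Lemma flat_nth_odd i b t : (t = i.*2 + (b : bool)) -> i < size P ->
  nth 0 (flat P) t = (if b then (nth (0, 0) P i).2 else (nth (0, 0) P i).1) /\
  nth 0 (flat (map uncollapse P)) t =
    (if b then (uncollapse (nth (0, 0) P i)).2 else (uncollapse (nth (0, 0) P i)).1).
Proof.
move=> -> iP; case: b; rewrite ?addn1 ?addn0 ?nth_flat0 ?nth_flat1 (nth_map (0, 0)) //.
Qed.

Lemma pair_pos i : i < size P -> 0 < (nth (0, 0) P i).2.
Proof.
move=> iP; rewrite -nth_flat1.
have /andP[_ /allP h] := is_part_catl (is_part_catr pla); apply: h; apply: mem_nth.
by rewrite size_flat; lia.
Qed.

Lemma pair_le i : i < size P -> (nth (0, 0) P i).2 <= (nth (0, 0) P i).1.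
Proof.
move=> iP; rewrite -nth_flat1 -nth_flat0.
have /andP[/(sortedP 0) h _] := is_part_catl (is_part_catr pla); apply: h.
by rewrite size_flat; lia.
Qed.

Lemma muL_odd t : odd (nth 0 muL t) = (t < q).
Proof.
rewrite nth_muL /q; case: ltnP => h1.
  rewrite (nth_parity parA) //; have -> : o = false by case: (o) oA h1 => [->|].
  by rewrite addn0.
case: ltnP => h2; last first.
  have [hs|hs] := ltnP (t - (size A + size (flat P))) (size C).
    by rewrite (nth_parity parC) //; case: (o) oC hs => [_ _|-> //]; rewrite ltnNge h2.
  rewrite nth_default //=; apply/esym/negbTE; rewrite -leqNgt; move: h2.
  by case: (o); lia.
pose i := (t - size A)./2; have ti : t - size A = i.*2 + odd (t - size A).
  by have := odd_double_half (t - size A); rewrite -/i; lia.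
have iP : i < size P by move: h2; rewrite size_flat; lia.
have [_ ->] := flat_nth_odd ti iP; have := pairs_ok_nth okP iP.
have x20 := pair_pos iP.
rewrite /uncollapse /=; move: (nth _ P i) x20 => x x20.
have -> : (t < size A + (if o then size (flat P) else 0)) = o.
  by case: (o); rewrite ?h2 // addn0 ltnNge h1.
case=> [[px ex]|[px px2]]; rewrite px.
  by case: ifP => _; rewrite -?ex; apply/eqP.
case: ifP => _ /=; last by case: (odd x.1) (o) px => -[].
by move: px2 x20; case: x.2 => [|y] //=; case: odd (o) => -[].
Qed.

(** In the uncollapsed sequence [muL] exactly the first q entries are odd, so it has the form of
    [half_rows] with c given by the integer halves. *)
Lemma pairs_rows : richardson_rows o (A ++ flat P ++ C).
Proof.
exists q, (fun t => (nth 0 muL t)./2).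
have e : half_rows q (fun t => (nth 0 muL t)./2) =1 nth 0 muL.
  by move=> t; rewrite /half_rows -muL_odd addnC odd_double_half.
have mono t : nth 0 muL t.+1 <= nth 0 muL t.
  have [h|h] := ltnP t.+1 (size muL); last by rewrite [nth 0 muL t.+1]nth_default.
  by have /(sortedP 0) := uncollapse_sorted; apply.
split=> [t|ho|t].
- exact: half_leq.
- by rewrite /q oA // ho size_flat odd_double.
rewrite /collapse !e; have [tA|At] := ltnP t (size A).
  have eo : o = false by case: (o) oA tA => [->|].
  by rewrite /q eo addn0 tA /= nth_muL tA nth_cat tA.
rewrite nth_cat ltnNge At /= nth_cat ltn_subLR // -subnDA.
have [tP|Pt] := ltnP t (size A + size (flat P)); last first.
  case: (boolP o) => ho.
    have tq : (t < q) = false by rewrite /q ho; lia.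
    by rewrite tq /= nth_muL ltnNge At /= ltnNge Pt.
  have z t' : size A + size (flat P) <= t' -> nth 0 muL t' = 0.
    move=> h; rewrite nth_default // /muL oC // cats0 size_cat size_flat size_map -size_flat //.
  have eq : q = size A by rewrite /q (negPf ho) addn0.
  rewrite oC // nth_nil eq ltnNge At /= (z t Pt) (z t.+1 (leqW Pt)) eqxx; case: ifP => // od.
  by rewrite z //; move: od Pt; rewrite size_flat; lia.
have tq : (t < q) = o.
  by rewrite /q; case: (o); rewrite ?tP // addn0 ltnNge At.
have tb : t - (if o then 0 else q) = t - size A.
  by rewrite /q; case: (o) oA => [->//|_]; rewrite addn0.
rewrite tq eqxx /= tb.
pose i := (t - size A)./2; have ti : t - size A = i.*2 + odd (t - size A).
  by have := odd_double_half (t - size A); rewrite -/i; lia.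
have iP : i < size P by move: tP; rewrite size_flat; lia.
have [-> eu] := flat_nth_odd ti iP.
have pp := pair_pos iP; have pl := pair_le iP; have ok := pairs_ok_nth okP iP.
have st : nth 0 muL t = nth 0 (flat (map uncollapse P)) (t - size A).
  by rewrite nth_muL ltnNge At tP.
case: ifP ti eu => od ti eu.
  have tp : 0 < t - size A by rewrite ti; lia.
  have st' : nth 0 muL t.-1 = nth 0 (flat (map uncollapse P)) (t - size A).-1.
    rewrite nth_muL.
    have -> : (t.-1 < size A) = false by lia.
    have -> : t.-1 < size A + size (flat P) by lia.
    by congr (nth 0 _ _); lia.
  have ti' : (t - size A).-1 = i.*2 + false by rewrite ti; lia.
  have [_ eu'] := flat_nth_odd ti' iP.
  rewrite st st' eu eu' /uncollapse; case: ok => [[px ex]|[px px2]]; rewrite px /=.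
    by rewrite ex eqxx.
  by case: eqP; lia.
have st' : nth 0 muL t.+1 = nth 0 (flat (map uncollapse P)) (t - size A).+1.
  rewrite nth_muL.
  have -> : (t.+1 < size A) = false by lia.
  have -> : t.+1 < size A + size (flat P) by move: tP ti; rewrite size_flat; lia.
  by congr (nth 0 _ _); lia.
have ti' : (t - size A).+1 = i.*2 + true by rewrite ti; lia.
have [_ eu'] := flat_nth_odd ti' iP.
rewrite st st' eu eu' /uncollapse; case: ok => [[px ex]|[px px2]]; rewrite px /=.
  by rewrite ex eqxx.
by case: eqP; lia.
Qed.

End ToRows.
End Rows.

Lemma parity_even s : parity false s = all_even s.
Proof. by apply: eq_all => x; rewrite eqbF_neg. Qed.

Lemma parity_odd s : parity true s = all_odd s.
Proof. by apply: eq_all => x; rewrite eqb_id. Qed.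

Lemma is_part_flatten (ss : seq (seq nat)) s : is_part (flatten ss) -> s \in ss -> is_part s.
Proof.
elim: ss => //= t ss IH pt; rewrite inE => /orP[/eqP->|]; first exact: is_part_catl pt.
by apply: IH; apply: is_part_catr pt.
Qed.

Lemma richardson_rows_orth la : is_part la -> richardson_rows false la <->
  exists (m : nat) (l : nat -> seq nat),
    [/\ is_concatenation la [seq l i | i <- iota 0 m.+1],
        all_odd (l 0),
        forall i, 0 < i <= m -> odd i -> l i != [::] /\ even_pair (l i)
      & forall i, 0 < i <= m -> ~~ odd i -> l i != [::] /\ odd_two_step_descending (l i)].
Proof.
move=> pla; split=> [/(rows_pairs_orth pla)[l0 [P [ela al0 okP]]]|[m [l [[_ pt ela] al0 bo be]]]].
  have pP : is_part (flat P) by apply: (@is_part_catr l0); rewrite -ela.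
  have [m [l [m0 eP [bo be]]]] := pairs_blocks okP pP.
  have conc ss : la = flatten ss -> is_concatenation la ss.
    by move=> e; split=> //; rewrite -?e // => t; apply: is_part_flatten; rewrite -e.
  have iS : iota 1 m = 1 :: iota 2 m.-1 by case: (m) m0.
  (* The first block must not be empty here. If it is, the odd block [l 2] is merged into [l0] and
     the indices drop by two. *)
  have [e1|ne1] := eqVneq (l 1) [::]; last first.
    exists m, (fun i => if i == 0 then l0 else l i); split=> // [|i hi oi|i hi oi].
    - apply: conc; rewrite /= ela eP; congr (_ ++ flatten _); apply/eq_in_map => i.
      by rewrite mem_iota; case: i.
    - have -> : (i == 0) = false by case: i hi {oi}.
      have [h [pp par]] := bo i hi oi; split; last by split; rewrite -?parity_even.
      by have [->|/h] := eqVneq i 1.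
    have -> : (i == 0) = false by case: i hi {oi}.
    by have [h [pp par]] := be i hi oi; split=> //; split; rewrite -?parity_odd.
  have [m1|m2] := leqP m 1.
    exists 0, (fun=> l0); split=> // [|i|i]; try lia.
    apply: conc; rewrite /= ela eP iS /= e1; congr (_ ++ _).
    by have -> : m.-1 = 0 by lia.
  have iS2 : iota 2 m.-1 = 2 :: iota 3 m.-2 by case: (m) m2 => [|[|]].
  have [_ [_ par2]] := be 2 m2 isT.
  exists m.-2, (fun i => if i == 0 then l0 ++ l 2 else l i.+2); split=> // [||i hi oi|i hi oi].
  - apply: conc; rewrite /= ela eP iS iS2 /= e1 /= catA; congr (_ ++ flatten _).
    rewrite -[3]/(2 + 1) iotaDl -map_comp; apply/eq_in_map => i; rewrite mem_iota /= add2n.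
    by case: i.
  - by rewrite /= /all_odd all_cat; apply/andP; split=> //; rewrite -[all _ _]parity_odd.
  - have -> : (i == 0) = false by case: i hi {oi}.
    have hi2 : 0 < i.+2 <= m by lia.
    have oi2 : odd i.+2 by rewrite /= negbK.
    have [h [pp par]] := bo i.+2 hi2 oi2; split; first by apply: h; case: i hi {oi hi2 oi2 pp par}.
    by split; rewrite -?parity_even.
  have -> : (i == 0) = false by case: i hi {oi}.
  have hi2 : 0 < i.+2 <= m by lia.
  have ei2 : ~~ odd i.+2 by rewrite /= negbK.
  by have [h [pp par]] := be i.+2 hi2 ei2; split=> //; split; rewrite -?parity_odd.
have blk : block_seq false m l.
  split=> i hi oi.
    by have [h [pp ae]] := bo i hi oi; split=> //; split=> //; rewrite parity_even.
  by have [h [pp ae]] := be i hi oi; split=> //; split=> //; rewrite parity_odd.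
have pt1 : is_part (flatten [seq l i | i <- iota 1 m]) by apply: is_part_catr pt.
have [P eP okP] := blocks_pairs (z := 0) blk pt1 (or_introl (erefl _)).
have -> : la = l 0 ++ flat P ++ [::] by rewrite cats0 ela /= eP.
apply: pairs_rows => //; first by rewrite /= parity_odd.
  (* The first pair begins the nonempty block [l 1] of even parts, so uncollapsing leaves it as it
     is. *)
  right; case: (P) eP => [|x Q] eP; [by left|right]; rewrite -eP.
  case: m {pt ela be pt1 blk} eP bo => [//|m] eP bo; have [] := bo 1 isT isT.
  rewrite /= in eP *; case: (l 1) => [//|y s] _ [_ /= /andP[ye _]].
  by rewrite eqbF_neg.
by rewrite cats0 -eP -[_ ++ _]/(flatten [seq l i | i <- iota 0 m.+1]).
Qed.

Lemma richardson_rows_symp la : is_part la -> richardson_rows true la <->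
  exists (m : nat) (l : nat -> seq nat) (mu : seq nat),
    [/\ is_concatenation la (rcons [seq l i | i <- iota 1 m] mu),
        forall i, 0 < i <= m -> odd i -> (i != 1 -> l i != [::]) /\ odd_pair (l i),
        forall i, 0 < i <= m -> ~~ odd i -> l i != [::] /\ even_two_step_descending (l i)
      & all_even mu].
Proof.
move=> pla; split=> [/(rows_pairs_symp pla)[P [C [ela aC okP]]]|].
  have pP : is_part (flat P) by apply: (@is_part_catl _ C); rewrite -ela.
  have [m [l [m0 eP [bo be]]]] := pairs_blocks okP pP.
  exists m, l, C; split=> // [|i hi oi|i hi oi].
  - have e : la = flatten (rcons [seq l i | i <- iota 1 m] C) by rewrite flatten_rcons -eP.
    by split=> //; rewrite -?e // => t; apply: is_part_flatten; rewrite -e.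
  - by have [h [pp par]] := bo i hi oi; split=> //; split; rewrite -?parity_odd.
  by have [h [pp par]] := be i hi oi; split=> //; split; rewrite -?parity_even.
(* a last descending block consists of even parts and can be merged with mu *)
move=> [m [l [mu [[_ pt ela] bo be amu]]]].
wlog om : m mu pt ela bo be amu / m = 0 \/ odd m.
  case: (boolP (odd m)) => [om|em] h; first by apply: (h m mu) => //; right.
  case: m pt ela bo be em h => [|m] pt ela bo be em h; first by apply: (h 0 mu) => //; left.
  have e : flatten (rcons [seq l i | i <- iota 1 m.+1] mu) = flatten (rcons [seq l i | i <- iota 1 m] (l m.+1 ++ mu)).
    by rewrite -[X in iota 1 X]addn1 iotaD map_cat !flatten_rcons flatten_cat /= cats0 add1n catA.
  apply: (h m (l m.+1 ++ mu)); rewrite -?e //.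
  - by move=> i hi; apply: bo; lia.
  - by move=> i hi; apply: be; lia.
  - have hm : 0 < m.+1 <= m.+1 by rewrite leqnn.
    by have [_ [_ ae]] := be m.+1 hm em; rewrite /all_even all_cat; apply/andP.
  by right; move: em; rewrite /= negbK.
have blk : block_seq true m l.
  split=> i hi oi.
    by have [h [pp ae]] := bo i hi oi; split=> //; split=> //; rewrite parity_odd.
  by have [h [pp ae]] := be i hi oi; split=> //; split=> //; rewrite parity_even.
rewrite flatten_rcons in pt ela.
have pt1 : is_part (flatten [seq l i | i <- iota 1 m]) by apply: is_part_catl pt.
have [P eP okP] : exists2 P, flatten [seq l i | i <- iota 1 m] = flat P & pairs_ok true (head 0 mu) P.
  case: om => [m0|om]; first by exists [::] => //; rewrite m0.
  by apply: (blocks_pairs blk pt1); right.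
have -> : la = [::] ++ flat P ++ mu by rewrite ela eP.
apply: pairs_rows => //; [by rewrite /= parity_even|by left|by rewrite /= -eP].
Qed.

End Partitions.

(** * Flags and parabolic subgroups *)

Section RowsOfFlags.
Local Open Scope nat_scope.

Lemma eq_collapse o q mu mu' : mu =1 mu' -> collapse o q mu =1 collapse o q mu'.
Proof. by move=> e t; rewrite /collapse !e. Qed.

Section Mono.
Variables (o : bool) (q : nat) (c : nat -> nat).
Hypothesis (c_mono : forall t, c t.+1 <= c t) (oq : o -> ~~ odd q).
Notation mu := (half_rows q c).
Notation lam := (collapse o q mu).
Notation b0 := (if o then 0 else q).

Lemma collapse_ge t : (t < q) != o \/ odd (t - b0) -> mu t <= lam t.
Proof. by rewrite /collapse => -[-> //|->]; case: ifP => // _; case: ifP. Qed.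

Lemma collapse_le t : (t < q) != o \/ ~~ odd (t - b0) -> lam t <= mu t.
Proof. by rewrite /collapse => -[-> //|/negPf->]; case: ifP => // _; case: ifP => // _; apply: leq_pred. Qed.

(** The rows of one pair are the only neighbours that move towards each other; if they differ, equal
    parity makes them differ by at least 2. *)
Lemma collapse_mono t : lam t.+1 <= lam t.
Proof.
have m : mu t.+1 <= mu t by apply: half_rows_mono.
have tr : ((t.+1 < q) != o \/ ~~ odd (t.+1 - b0)) -> ((t < q) != o \/ odd (t - b0)) ->
    lam t.+1 <= lam t.
  by move=> /collapse_le h1 /collapse_ge h2; apply: leq_trans h1 (leq_trans m h2).
have ho : (t < q) = o -> t >= b0 by case: (o); lia.
have [gt|pt] := boolP ((t < q) != o).
  have [gt1|pt1] := boolP ((t.+1 < q) != o); first by apply: tr; left.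
  apply: tr; last by left.
  right; move: gt pt1; rewrite negbK => gt /eqP; case: (o) gt => /=; first by lia.
  by move=> h1 h2; have -> : t.+1 - q = 0 by lia.
have tb : b0 <= t by apply: ho; move: pt; rewrite negbK => /eqP.
have [od|ev] := boolP (odd (t - b0)).
  by apply: tr; right=> //; rewrite subSn //= negbK.
have pt1 : (t.+1 < q) = o.
  move: pt ev tb; rewrite negbK => /eqP; case: (o) oq => /=; last by lia.
  move=> /(_ isT) qe h; rewrite subn0; lia.
move: pt; rewrite negbK => /eqP pt.
rewrite /collapse pt pt1 eqxx /= (negPf ev) subSn //= ev.
have o1 : odd (mu t) = (t < q) by apply: half_rows_odd.
have o2 : odd (mu t.+1) = (t.+1 < q) by apply: half_rows_odd.
move: o1 o2; rewrite pt pt1.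
case: (eqVneq (mu t) (mu t.+1)) => [->//|ne] o1 o2; move: o1 o2 ne m.
by move: (mu t) (mu t.+1) => x y; lia.
Qed.

End Mono.

Lemma nth_filter_pos (f : nat -> nat) T t : (forall t, f t.+1 <= f t) ->
  nth 0 [seq x <- mkseq f T | 0 < x] t = if t < T then f t else 0.
Proof.
move=> fm; have mono a b : a <= b -> f b <= f a.
  elim: b => [|b IH]; first by rewrite leqn0 => /eqP->.
  by rewrite leq_eqVlt => /orP[/eqP->//|/IH]; apply: leq_trans.
elim: T t => [|T IH] t; first by rewrite nth_nil.
rewrite /mkseq -[T.+1]addn1 iotaD map_cat filter_cat /= add0n addn1 ltnS.
have [f0|fT] := posnP (f T).
  rewrite cats0 IH; case: (ltngtP t T) => [tT|tT|->] //.
have -> : [seq x <- [seq f i | i <- iota 0 T] | 0 < x] = mkseq f T.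
  apply/all_filterP/allP => x /mapP[i]; rewrite mem_iota => /andP[_ iT] ->.
  by apply: leq_trans fT (mono _ _ _); lia.
rewrite nth_cat size_mkseq; case: (ltngtP t T) => [tT|tT|->]; first by rewrite nth_mkseq.
  by rewrite nth_default //=; lia.
by rewrite subnn.
Qed.

Lemma sum_initial (b : nat -> bool) T t : (forall t, b t.+1 -> b t) -> t < T ->
  (t < \sum_(i < T) b i) = b t.
Proof.
move=> bm; have mono i j : i <= j -> b j -> b i.
  elim: j => [|j IH]; first by rewrite leqn0 => /eqP->.
  by rewrite leq_eqVlt => /orP[/eqP->//|/IH h /bm].
elim: T => [//|T IH]; rewrite big_ord_recr /= ltnS => tT.
have le : \sum_(i < T) b i <= T.
  by rewrite -[X in _ <= X]card_ord -sum1_card; apply: leq_sum => i _; case: (b i).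
have [bT|nbT] := boolP (b T).
  have -> : \sum_(i < T) b i = T.
    rewrite (eq_bigr (fun=> 1)) ?sum_nat_const ?card_ord ?muln1 // => i _.
    by rewrite (mono i T) // ltnW.
  by rewrite addn1 ltnS tT (mono t T).
rewrite addn0; move: tT; rewrite leq_eqVlt => /orP[/eqP->|/IH//].
by rewrite (negPf nbT) ltnNge le.
Qed.

Lemma jordan_rank_nth la T j : size la <= T -> jordan_rank la j = \sum_(t < T) (nth 0 la t - j).
Proof.
move=> sT; rewrite /jordan_rank (big_nth 0) -(big_mkord predT (fun t => nth 0 la t - j)).
rewrite [RHS](big_cat_nat (n := size la)) //= [X in _ + X]big_nat_cond [X in _ + X]big1 ?addn0 //.
by move=> i /andP[/andP[h _] _]; rewrite nth_default.
Qed.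

Lemma size_part n la : part_of n la -> size la <= n.
Proof.
case/andP=> /andP[_ pla] /eqP <-; elim: la pla => //= x la IH /andP[x0 /IH]; lia.
Qed.

End RowsOfFlags.

Section Flags.
Variables (k : closedFieldType) (char_k : 2%N \notin [pchar k]).

Section OneForm.
Variables (n : nat) (o : bool) (B : 'M[k]_n).
Hypothesis eB : eform o B.

(** Ranks determine a partition, so [la] is the list of positive collapsed rows; rows from T on
    vanish, which gives equality at every t. *)
Lemma rows_of_flag r (E : nat -> 'M[k]_n) T la : sdflag B r E -> (n.+2 <= T)%N ->
  part_of n la -> (forall j, jordan_rank la j = flag_type o r E T j) -> richardson_rows o la.
Proof.
move=> fE nT pla hj; have dsym := sdflag_dsym char_k fE.
pose d i := (\rank (E i.+1) - \rank (E i))%N.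
have oq := sdflag_odd_middle char_k eB fE.
pose c t := row_length d r t.
have cm t : (c t.+1 <= c t)%N by apply: row_length_mono.
have emu : row_length d r.*2.+1 =1 half_rows (d r) c by move=> t; rewrite (mu_eq dsym).
pose lam := collapse o (d r) (half_rows (d r) c).
have lm t : (lam t.+1 <= lam t)%N by apply: collapse_mono.
have dn i : (d i <= n)%N by rewrite /d (leq_trans (leq_subr _ _)) // rank_leq_row.
have mu0 t : (n <= t)%N -> half_rows (d r) c t = 0%N.
  move=> nt; rewrite -emu /row_length big1 // => i _.
  by rewrite ltnNge (leq_trans (dn i)).
have lam0 t : (T <= t)%N -> lam t = 0%N.
  move=> Tt; rewrite /lam /collapse (mu0 t) ?(mu0 t.+1) ?(mu0 t.-1) //; try lia.
  by case: ifP => // _; case: ifP.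
have [/andP[sla pos] /eqP sn] := andP pla.
exists (d r), c; split=> // t; rewrite -/lam.
have -> : la = [seq x <- mkseq lam T | (0 < x)%N].
  apply: jordan_rank_inj => //; last 1 first.
  - move=> j; rewrite hj /jordan_rank big_filter /mkseq big_map.
    rewrite /flag_type -(big_mkord predT (fun t => collapse o (d r) (row_length d r.*2.+1) t - j)%N).
    rewrite /index_iota subn0 [RHS]big_mkcond; apply: eq_bigr => i _; rewrite (eq_collapse _ _ emu).
    by rewrite -/lam; case: posnP => // ->.
  - apply: sorted_filter; first by move=> a b e; rewrite /geq /=; lia.
    by apply/(sortedP 0%N) => i; rewrite size_mkseq => iT; rewrite !nth_mkseq ?(ltnW iT) //; exact: lm.
  - exact: filter_all.
by rewrite nth_filter_pos //; case: ltnP => // /lam0.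
Qed.

End OneForm.
End Flags.

(** The models, taken with j = 0 and used only for their flags, realize all admissible dimensions on
    some form B' of type o; an equivalence of B' with B transports the flag. *)
Lemma sdflag_exists (k : closedFieldType) (char_k : 2%N \notin [pchar k]) n (o : bool) (B : 'M[k]_n)
    r (d : nat -> nat) : eform o B -> (o -> ~~ odd (d r)) ->
  (forall i, (i <= r.*2)%N -> d i = d (r.*2 - i)%N) -> (\sum_(i < r.*2.+1) d i = n)%N ->
  exists2 E, sdflag B r E & forall i, (i <= r.*2.+1)%N -> \rank (E i) = (\sum_(j < i) d j)%N.
Proof.
move=> eB oq dsym dn.
have [T [L [dT hL okL]]] := blocks_exist (\sum_(i < r.*2.+1) d i) oq.
have dle i : (i <= r.*2)%N -> (d i <= T)%N.
  by move=> ir; apply: leq_trans dT; rewrite (bigD1 (Ordinal (ir : i < r.*2.+1)%N)) //= leq_addr.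
have sumd i : (i <= r.*2.+1)%N -> (\sum_(x <- L) block_val (row_length d i) x = \sum_(j < i) d j)%N.
  by move=> is_; rewrite -hL row_length_sum // => j ji; apply: dle; lia.
have [B' [X' [E' [eB' fE' rE' _ _]]]] :
  flag_model k o r 0 n (fun i => \sum_(j < i) d j)%N (\sum_(x <- L) block_val
   (fun t => collapse o (d r) (row_length d r.*2.+1) t - 0) x)%N.
  apply: flag_model_ext (flag_model_blocks k 0 dsym okL) => [|//|i is_]; last exact: sumd.
  by rewrite sumd.
(* For the trivial flag, with r = 0, [sdflags_isometric] says that any two forms of type o are
   equivalent. *)
pose E0 (i : nat) : 'M[k]_n := if i == 0%N then 0 else 1%:M.
have fl (C : 'M[k]_n) : sdflag C 0 E0.
  split=> // [[] // _|[|[|]] // _|[|[|]] // _]; rewrite /E0 /= ?sub0mx ?mul0mx //.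
  - by rewrite trmx0 mulmx0.
  - by rewrite mxrank0 mxrank1.
  by rewrite mxrank0 mxrank1 addn0.
have [g gu [gB _]] := sdflags_isometric char_k eB eB' (fl B) (fl B') (fun i _ => erefl).
exists (fun i => E' i *m g) => [|i is_]; last by rewrite mxrankMfree ?row_free_unit // rE'.
case: fE' => E'0 mE' iE' sE'; split=> [|i is_|i is_|i is_].
- by rewrite E'0 mul0mx.
- by rewrite submxMr // mE'.
- by rewrite trmx_mul -!mulmxA (mulmxA B) (mulmxA g) (mulmxA g) gB mulmxA iE'.
- by rewrite !mxrankMfree ?row_free_unit // sE'.
Qed.

Section OneForm.
Variables (k : closedFieldType) (char_k : 2%N \notin [pchar k]).
Variables (n : nat) (o : bool) (B : 'M[k]_n).
Hypothesis eB : eform o B.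

Lemma flag_of_rows la : part_of n la -> richardson_rows o la -> exists r E,
  [/\ sdflag B r E, forall i, (i < r)%N -> (\rank (E i) < \rank (E i.+1))%N
    & forall T j, (n.+2 <= T)%N -> jordan_rank la j = flag_type o r E T j].
Proof.
move=> pla [q [c [cm oq hla]]]; have sla := size_part pla.
have mm t : (half_rows q c t.+1 <= half_rows q c t)%N by apply: half_rows_mono.
(* A row may be lowered by the collapse, but of the rows t and t + 1 at least one is not, so
   vanishing is claimed from t + 1 on. *)
have mu0' t : (size la <= t)%N -> half_rows q c t.+1 = 0%N.
  move=> lat; apply/eqP; rewrite -leqn0.
  have l0 : collapse o q (half_rows q c) t = 0%N by rewrite -hla nth_default.
  have l1 : collapse o q (half_rows q c) t.+1 = 0%N by rewrite -hla nth_default // ltnW.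
  have [h|h] := boolP (((t < q)%N != o) || odd (t - (if o then 0%N else q))).
    by apply: leq_trans (mm t) _; rewrite -l0; apply: collapse_ge; apply/orP.
  rewrite -l1; apply: collapse_ge; apply/orP; move: h; rewrite negb_or negbK => /andP[/eqP h1 h2].
  case: ((t.+1 < q)%N =P o) => //= h3; rewrite subSn /= ?h2 //.
  by move: h1; case: (o); lia.
pose T1 := (size la).+1.
have c0 t : (T1 <= t)%N -> c t = 0%N.
  by case: t => // t /mu0'; rewrite /half_rows; lia.
have qT : (q <= T1)%N.
  by have := mu0' _ (leqnn (size la)); rewrite /half_rows leqNgt; case: ltnP => // _; rewrite addn1.
have cmono a b : (a <= b)%N -> (c b <= c a)%N.
  elim: b => [|b IH]; first by rewrite leqn0 => /eqP->.
  by rewrite leq_eqVlt => /orP[/eqP->//|/IH]; apply: leq_trans.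
(* The jumps before the middle form the conjugate partition of c, so [rows] recovers c from them;
   the middle jump is q, and symmetry gives the rest. The choice r = c 0 makes the first r jumps
   positive, as a flag requires. *)
pose r := c 0%N; pose p i := (\sum_(t < T1) (i < c t))%N.
pose d i := if (i < r)%N then p i else if i == r then q else p (r.*2 - i)%N.
have pT i : (p i <= T1)%N.
  rewrite -[X in (_ <= X)%N]card_ord -sum1_card; apply: leq_sum => j _; exact: leq_b1.
have dr : d r = q by rewrite /d ltnn eqxx.
have dsym i : (i <= r.*2)%N -> d i = d (r.*2 - i)%N.
  move=> ir; rewrite /d; case: ltngtP => h1; case: ltngtP => h2; try lia.
  by rewrite subKn.
have rows t : row_length d r t = c t.
  have [tT|Tt] := ltnP t T1.
    rewrite -[RHS](@sum_lt r) ?cmono //; apply: eq_bigr => j _; rewrite /d ltn_ord.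
    by rewrite (@sum_initial (fun t => j < c t)%N) // => u h; apply: leq_trans h (cm u).
  rewrite c0 //; apply: big1 => j _; rewrite /d ltn_ord ltnNge (leq_trans (pT j)) //.
have emu : row_length d r.*2.+1 =1 half_rows q c by move=> t; rewrite (mu_eq dsym) dr rows.
have dn : (\sum_(i < r.*2.+1) d i = n)%N.
  have oq' : o -> ~~ odd (d r) by rewrite dr.
  have [T [L [TT hL okL]]] := blocks_exist T1 oq'.
  have dT j : (j < r.*2.+1)%N -> (d j <= T)%N.
    by move=> _; apply: leq_trans TT; rewrite /d; case: ifP => // _; case: ifP.
  apply: etrans (esym (row_length_sum dT)) _.
  have := collapse_sum dsym hL okL 0.
  have -> : active r d L 0 = 0%N by rewrite /active big1 // => -[[] u] _.
  rewrite addn0 dr.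
  have e : (\sum_(t < T) (collapse o q (row_length d r.*2.+1) t - 0) = jordan_rank la 0)%N.
    rewrite (@jordan_rank_nth _ T) ?(leq_trans _ TT) //; apply: eq_bigr => t _.
    by rewrite hla (eq_collapse _ _ emu).
  rewrite e /jordan_rank (eq_bigr (fun t => row_length d r.*2.+1 (nat_of_ord t))) => [->|t _]; last exact: subn0.
  case/andP: pla => _ /eqP <-; rewrite sumnE; apply: eq_bigr => x _; exact: subn0.
have oq' : o -> ~~ odd (d r) by rewrite dr.
have [E fE rE] := sdflag_exists char_k eB oq' dsym dn.
have dE i : (i < r.*2.+1)%N -> (\rank (E i.+1) - \rank (E i))%N = d i.
  by move=> is_; rewrite !rE ?big_ord_recr /= ?addKn // ltnW.
exists r, E; split=> // [i ir|T j nT].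
  have is_ : (i < r.*2.+1)%N by lia.
  have : (0 < d i)%N by rewrite /d ir /p (bigD1 ord0) //= ir.
  by rewrite -dE //; lia.
rewrite (@jordan_rank_nth _ T); last by lia.
rewrite /flag_type; apply: eq_bigr => t _; rewrite hla dE; last by lia.
rewrite dr; congr (_ - j)%N; apply: eq_collapse => u; rewrite -emu.
by apply: eq_bigr => i _; rewrite dE.
Qed.
End OneForm.

Section Flags.
Variables (k : closedFieldType) (n : nat) (o : bool) (B : 'M[k]_n).
Hypothesis eB : eform o B.

Lemma sdflag_of_isotropic F : isotropic_flag B F -> exists r E, sdflag B r E /\
  forall g, flagP B r E g <-> isometry_group B g /\ forall V, V \in F -> stablemx V g.
Proof.
move=> [/(pathP 0) pF iF]; pose r := size F; pose V i := nth 0 (0 :: F) i.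
have VS i : (i < r)%N -> (V i <= V i.+1)%MS by move=> /pF; apply: ltmxW.
have iV i : (i <= r)%N -> V i *m B *m (V i)^T = 0.
  by case: i => [_|i ir]; [rewrite /V /= !mul0mx|apply/iF/mem_nth].
pose E i := if (i <= r)%N then V i else kermx (B *m (V (r.*2.+1 - i)%N)^T).
have EK i : (i <= r)%N -> E (r.*2.+1 - i)%N = kermx (B *m (V i)^T).
  move=> ir; have h : (r.*2.+1 - i <= r)%N = false by lia.
  by rewrite /E h subKn //; lia.
have EV i : (i <= r)%N -> E i = V i by rewrite /E => ->.
have KV i : kermx (B *m (V i)^T) *m B *m (V i)^T = 0 by rewrite -mulmxA mulmx_ker.
have rK i : (\rank (V i) + \rank (kermx (B *m (V i)^T)) = n)%N.
  have [_ Bu] := eB; rewrite mxrank_ker (eqmxMfull _ (_ : row_full B)) ?row_full_unit //.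
  by rewrite mxrank_tr subnKC // rank_leq_row.
have split_index i : (i <= r.*2.+1)%N -> (i <= r)%N \/ exists2 j, (j <= r)%N & i = (r.*2.+1 - j)%N.
  by move=> is_; case: (leqP i r) => h; [left|right; exists (r.*2.+1 - i)%N; lia].
have fE : sdflag B r E.
  split=> // [i is_|i /split_index[ir|[j jr ->]]|i /split_index[ir|[j jr ->]]].
  - have [ir|ri] := ltnP i r; first by rewrite !EV ?VS // ltnW.
    have [->|[j jr ->]] : i = r \/ exists2 j, (j < r)%N & i = (r.*2.+1 - j.+1)%N.
      by case: (eqVneq i r) => [|h]; [left|right; exists (r.*2 - i)%N; lia].
      rewrite EV // (_ : r.+1 = r.*2.+1 - r)%N ?EK //; last by lia.
      by apply/sub_kermxP; rewrite mulmxA iV.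
    rewrite EK // (_ : (r.*2.+1 - j.+1).+1 = r.*2.+1 - j)%N ?EK; try lia.
    by apply/sub_kermxP; rewrite mulmxA (isotropic_sub (submx_refl _) (VS j jr)).
  - by rewrite EK // EV // (eform_sym0 eB).
  - by rewrite EK // subKn ?EV //; lia.
  - by rewrite EK // EV.
  - by rewrite EK // subKn ?EV // 1?addnC //; lia.
exists r, E; split=> // g; split=> [[gB gE]|[gB gF]].
  split=> // W /(nthP 0)[i]; rewrite -/r => ir <-.
  by have := gE i.+1; rewrite EV //; apply; lia.
apply: (flagP_half eB fE) => // -[|i] ir; rewrite EV //.
  by rewrite /V /= mul0mx sub0mx.
by apply/gF/mem_nth.
Qed.

Lemma sdflag_parabolic r E : sdflag B r E ->
  (forall i, (i < r)%N -> (\rank (E i) < \rank (E i.+1))%N) -> is_parabolic B (flagP B r E).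
Proof.
move=> fE rE; exists [seq E i | i <- iota 1 r]; last first.
  move=> g; split=> [[gB gE]|[gB gF]].
    by split=> // V /mapP[i]; rewrite mem_iota => /andP[i0 ir] ->; apply: gE; lia.
  apply: (flagP_half eB fE) => // -[|i] ir; last by apply/gF/map_f; rewrite mem_iota; lia.
  by case: fE => -> _ _ _; rewrite mul0mx sub0mx.
split=> [|V /mapP[i]]; last first.
  by rewrite mem_iota => /andP[i0 ir] ->; apply: (sdflag_iso fE (_ : i + i <= _)%N) => //; lia.
case: fE => E0 mE _ _.
apply/(pathP 0) => i; rewrite size_map size_iota => ir.
rewrite (nth_map 0%N) ?size_iota // nth_iota // add1n.
have -> : nth 0 (0 :: [seq E i0 | i0 <- iota 1 r]) i = E i.
  case: i ir => [|i] ir; first by rewrite E0.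
  by rewrite /= (nth_map 0%N) ?size_iota ?nth_iota //; lia.
by rewrite ltmxErank mE ?rE //; lia.
Qed.

Hypothesis char_k : 2%N \notin [pchar k].

Lemma richardson_iff_rows la : part_of n la ->
  (exists2 P, is_parabolic B P &
     is_richardson_orbit (isometry_group B) P (nilpotent_orbit (isometry_group B) la)) <->
  richardson_rows o la.
Proof.
move=> pla; split=> [[P [F iF hP] rP]|rows].
  have [r [E [fE eP]]] := sdflag_of_isotropic iF.
  have PE : P = flagP B r E.
    apply: functional_extensionality => g; apply: propositional_extensionality.
    by rewrite hP eP.
  have [T nT hT] := flag_type_exists char_k eB fE.
  apply: (rows_of_flag char_k eB fE nT pla).
  by apply/(richardson_criterion char_k eB fE hT pla); rewrite -PE.
have [r [E [fE rE hla]]] := flag_of_rows char_k eB pla rows.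
have [T nT hT] := flag_type_exists char_k eB fE.
exists (flagP B r E); first exact: sdflag_parabolic.
by apply/(richardson_criterion char_k eB fE hT pla) => j; apply: hla.
Qed.

End Flags.

Theorem theorem1p2 (k : closedFieldType) (char_k : 2%N \notin [pchar k]) :
  (forall (N : nat) (B : 'M[k]_N) (la : seq nat),
     (3 <= N)%N -> B^T = B -> B \in unitmx -> orthogonal_part N la ->
     ((exists2 P, is_parabolic B P &
         is_richardson_orbit (isometry_group B) P
           (nilpotent_orbit (isometry_group B) la))
      <->
      exists (m : nat) (l : nat -> seq nat),
        [/\ is_concatenation la [seq l i | i <- iota 0 m.+1],
            all_odd (l 0%N),
            forall i, (0 < i <= m)%N -> odd i ->
              l i != [::] /\ even_pair (l i)
          & forall i, (0 < i <= m)%N -> ~~ odd i ->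
              l i != [::] /\ odd_two_step_descending (l i)]))
  /\
  (forall (n : nat) (B : 'M[k]_(2 * n)) (la : seq nat),
     B^T = - B -> B \in unitmx -> symplectic_part (2 * n) la ->
     ((exists2 P, is_parabolic B P &
         is_richardson_orbit (isometry_group B) P
           (nilpotent_orbit (isometry_group B) la))
      <->
      exists (m : nat) (l : nat -> seq nat) (mu : seq nat),
        [/\ is_concatenation la (rcons [seq l i | i <- iota 1 m] mu),
            forall i, (0 < i <= m)%N -> odd i ->
              (i != 1%N -> l i != [::]) /\ odd_pair (l i),
            forall i, (0 < i <= m)%N -> ~~ odd i ->
              l i != [::] /\ even_two_step_descending (l i)
          & all_even mu])).
Proof.
split=> [N B la _ BT Bu [pla _]|n B la BT Bu [pla _]].
  have eB : eform false B by split; rewrite ?expr0 ?scale1r.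
  have pl : is_part la by case/andP: pla.
  exact: iff_trans (richardson_iff_rows eB char_k pla) (richardson_rows_orth pl).
have eB : eform true B by split; rewrite ?expr1 ?scaleN1r.
have pl : is_part la by case/andP: pla.
exact: iff_trans (richardson_iff_rows eB char_k pla) (richardson_rows_symp pl).
Qed.
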